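(* Let $G$ be a signed digraph with $n$ vertices which is homogenous and has no positive cycles, no sources and no initial cycles. Then every and-or-net on $G$ has a synchronizing word of length at most $10(\sqrt{5}+1)^n$.
   Context: A signed digraph on $V$ is $(V,E)$ with $E\subseteq V\times V\times\{-1,1\}$ (arc from $j$ to $i$ of sign $s$; loops allowed). Paths and cycles have no repeated vertices (a loop is a cycle); the sign of a path/cycle is the product of its arc signs. A strong component is a maximal strongly connected induced subgraph; it is initial if no arc enters it from outside. An initial cycle is an initial strong component that is a cycle. A source is a vertex of in-degree zero. A path is forward if it has at least one arc and the two end vertices of its last arc lie in distinct strong components. $G$ is $i$-homogenous if every strong component of $G$ contains a vertex $j$ such that all forward paths from $j$ to $i$ have the same sign (vacuously if there are none); $G$ is homogenous if it is $i$-homogenous for every vertex $i$. A Boolean network (BN) is $f:\{0,1\}^V\to\{0,1\}^V$; its signed interaction digraph has a positive (negative) arc from $j$ to $i$ iff for some $x$ with $x_j=0$, $f_i(x+e_j)-f_i(x)$ is positive (negative). An and-or-net on $G$ is a BN whose signed interaction digraph is $G$ and each $f_i$ is a conjunction ($f_i(x)=1$ iff $x_j=1$ for all positive and $x_j=0$ for all negative in-neighbors $j$ of $i$) or a disjunction ($f_i(x)=0$ iff $x_j=0$ for all positive and $x_j=1$ for all negative in-neighbors). $f^i(x)$ is $x$ with $x_i$ replaced by $f_i(x)$; $f^{i_1\cdots i_\ell}=f^{i_\ell}\circ\cdots\circ f^{i_1}$; $w$ is synchronizing if $f^w$ is constant. *)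

(* Defs.v *)
From mathcomp Require Import all_boot.
From Stdlib Require Rdefinitions Raxioms Rpow_def R_sqrt.

Set Implicit Arguments.
Unset Strict Implicit.
Unset Printing Implicit Defensive.

Section SignedDigraphs.
Variable V : finType.

(* A signed digraph on V: a set of arcs (j, i, s) = arc from j to i of sign s,
   where s = true encodes +1 and s = false encodes -1.  Loops allowed. *)
Definition sdigraph := {set V * V * bool}.

Definition arc_src (e : V * V * bool) : V := e.1.1.
Definition arc_tgt (e : V * V * bool) : V := e.1.2.
Definition arc_sign (e : V * V * bool) : bool := e.2.

Variable G : sdigraph.

Fixpoint is_walk (u : V) (a : seq (V * V * bool)) : bool :=
  match a with
  | [::] => true
  | e :: a' => (arc_src e == u) && (e \in G) && is_walk (arc_tgt e) a'
  end.

Definition walk_vertices (u : V) (a : seq (V * V * bool)) : seq V :=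
  u :: map arc_tgt a.

Definition is_path (u v : V) (a : seq (V * V * bool)) : bool :=
  [&& is_walk u a, uniq (walk_vertices u a) & last u (map arc_tgt a) == v].

Definition sgn (a : seq (V * V * bool)) : bool :=
  ~~ odd (count (fun e => ~~ arc_sign e) a).

Definition is_cycle (u : V) (a : seq (V * V * bool)) : bool :=
  [&& a != [::], is_walk u a, last u (map arc_tgt a) == u
    & uniq (map arc_tgt a)].

Definition positive_cycle_free : Prop :=
  ~ exists u a, is_cycle u a && sgn a.

Definition adj : rel V := fun j i => [exists s, (j, i, s) \in G].

Definition scc (v : V) : {set V} :=
  [set u | connect adj u v && connect adj v u].

Definition is_strong_component (C : {set V}) : Prop := exists v, C = scc v.

Definition initial (C : {set V}) : bool :=
  [forall e in G, (arc_tgt e \in C) ==> (arc_src e \in C)].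

Definition induces_cycle (C : {set V}) : Prop :=
  exists u a, [/\ is_cycle u a, [set arc_tgt e | e in a] = C
    & forall e, e \in G -> arc_src e \in C -> arc_tgt e \in C -> e \in a].

Definition initial_cycle (C : {set V}) : Prop :=
  [/\ is_strong_component C, initial C & induces_cycle C].

Definition source (i : V) : bool := [forall e in G, arc_tgt e != i].

Definition forward_path (u v : V) (a : seq (V * V * bool)) : bool :=
  [&& is_path u v a, a != [::] &
      scc (arc_src (last (u, u, true) a)) != scc (arc_tgt (last (u, u, true) a))].

Definition i_homogenous (i : V) : Prop :=
  forall C, is_strong_component C ->
    exists2 j, j \in C & forall a b, forward_path j i a -> forward_path j i b ->
                                     sgn a = sgn b.

Definition homogenous : Prop := forall i, i_homogenous i.

End SignedDigraphs.

Section BooleanNetworks.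
Variable V : finType.
Definition config := {ffun V -> bool}.
Definition BN := config -> config.

(* x + e_j, for x with x_j = 0 *)
Definition set_true (x : config) (j : V) : config :=
  [ffun k => if k == j then true else x k].

Definition interaction_digraph (f : BN) : sdigraph V :=
  [set e | [exists x : config,
     ~~ x (arc_src e) &&
     (if arc_sign e
      then ~~ f x (arc_tgt e) && f (set_true x (arc_src e)) (arc_tgt e)
      else f x (arc_tgt e) && ~~ f (set_true x (arc_src e)) (arc_tgt e))]].

Definition is_conjunction (G : sdigraph V) (f : BN) (i : V) : Prop :=
  forall x, f x i = [forall j, (((j, i, true) \in G) ==> x j)
                            && (((j, i, false) \in G) ==> ~~ x j)].

Definition is_disjunction (G : sdigraph V) (f : BN) (i : V) : Prop :=
  forall x, f x i = ~~ [forall j, (((j, i, true) \in G) ==> ~~ x j)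
                               && (((j, i, false) \in G) ==> x j)].

Definition and_or_net (G : sdigraph V) (f : BN) : Prop :=
  interaction_digraph f = G /\
  forall i, is_conjunction G f i \/ is_disjunction G f i.

Definition update (f : BN) (i : V) (x : config) : config :=
  [ffun k => if k == i then f x i else x k].

Definition apply_word (f : BN) (w : seq V) (x : config) : config :=
  foldl (fun y i => update f i y) x w.

Definition synchronizing (f : BN) (w : seq V) : Prop :=
  forall x y, apply_word f w x = apply_word f w y.

End BooleanNetworks.

Definition sync_bound (n : nat) : Rdefinitions.R :=
  Rdefinitions.Rmult (Raxioms.INR 10)
    (Rpow_def.pow (Rdefinitions.Rplus (R_sqrt.sqrt (Raxioms.INR 5)) Rdefinitions.R1) n).

(* Main.v *)
(** Every in-neighbour of a vertex has a bad value, which alone forces the vertex.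
    To give all in-literals of a target prescribed values, freeze vertices one at
    a time: a vertex forced by a frozen one costs one letter; otherwise a minimal
    closed set of free vertices contains a vertex [p] all of whose paths to the
    target have the same sign, and [p] is first brought to its favourable value by
    the same procedure with target [p], where negativity of the cycles through [p]
    provides the signs.  This takes [F(n + 3) - 2] letters, [F] being Fibonacci.

    In a strong net that is not a cycle, absence of positive cycles yields a vertex
    [c] whose out-neighbours all have a second in-neighbour, and a value [s] of [c]
    that is bad for none of them; [c] is driven by a vertex [i] with two
    in-neighbours through vertices of in-degree one.  Given two configurations,
    make all in-literals of [i] bad in the first, then steer the second until a
    single in-literal of [i] becomes bad.  Now [i] is forced in both, hence [c]
    gets the value [s] in both, and the rest of the net behaves homogenously.

    A homogenous net is merged one strong component at a time, in topological
    order; the components already merged are steered before a letter so that they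
    do not interfere with it.  Any two configurations thus merge within
    [13 F(n + 1) + 8 F(n) - 13] letters.  Since a single letter at the target of a
    non-loop arc leaves at most three quarters of the [2^n] configurations, merging
    pairs one after another gives the bound. *)

From Stdlib Require Import Reals Lra Classical_Prop.
Require Import Defs.
From mathcomp Require Import all_boot zify.

Set Implicit Arguments.
Unset Strict Implicit.
Unset Printing Implicit Defensive.

(** The obstacle is cost: a letter inside a component may need a steering run through everything
    upstream, so costs multiply along the order of components. The saving is that a letter at a
    vertex already forced needs no steering: the upstream part is identical in both configurations,
    so if it interferes it forces the vertex in both at once. Hence letters are counted in two
    classes, and a strategy for a component must tolerate forced outcomes of its soft letters; the
    game [win] records this. Removing [c] from a strong net creates no source, but may create
    initial cycles. These are the one part that cannot be merged once [c] has the value [s]; so the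
    two configurations are first made to agree on one vertex of each, while [c] still has the other
    value in one of them. The bounds close under F(m+n+1) = F(m+1) F(n+1) + F(m) F(n), applied to
    [m] merged vertices and a component. Finally 1 + sqrt 5 is twice the golden ratio, and three
    quarters of 13 F(n+1) + 8 F(n) is at most 10 times its [n]-th power. *)

(** * From merging pairs to synchronizing words *)

Section Merging.
Variables (V : finType) (f : BN V).

Lemma apply_word_cat (u v : seq V) (x : config V) :
  apply_word f (u ++ v) x = apply_word f v (apply_word f u x).
Proof. exact: foldl_cat. Qed.

Definition word_image (w : seq V) (X : {set config V}) : {set config V} :=
  [set apply_word f w x | x in X].

Lemma card_word_image_lt (w : seq V) (X : {set config V}) (x y : config V) :
  x \in X -> y \in X -> x != y -> apply_word f w x = apply_word f w y ->
  #|word_image w X| < #|X|.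
Proof.
move=> xX yX nxy exy.
have sub : word_image w X \subset word_image w (X :\ x).
  apply/subsetP=> _ /imsetP[z zX ->].
  have [->|nzx] := eqVneq z x.
    by rewrite exy; apply: imset_f; rewrite !inE eq_sym nxy.
  by apply: imset_f; rewrite !inE nzx.
apply: leq_ltn_trans (subset_leq_card sub) _.
apply: leq_ltn_trans (leq_imset_card _ _) _.
by rewrite [#|X|](cardsD1 x) xX.
Qed.

Definition merging_within (L : nat) : Prop :=
  forall x y : config V,
  exists2 w : seq V, size w <= L & apply_word f w x = apply_word f w y.

(** Each merging word lowers the size of the image by at least one. *)
Lemma merging_synchronizing_set (L m : nat) (X : {set config V}) :
  merging_within L -> #|X| <= m.+1 ->
  exists2 w : seq V, size w <= m * L &
    {in X &, forall x y, apply_word f w x = apply_word f w y}.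
Proof.
move=> mrg; elim: m X => [|m IHm] X leX.
  exists [::] => // x y xX yX.
  by rewrite (card_le1_eqP leX _ _ xX yX).
have [/card_le1_eqP X1 | /card_gt1P[x [y [xX yX nxy]]]] := leqP #|X| 1.
  by exists [::] => // x y xX yX; rewrite (X1 _ _ xX yX).
have [u leu exy] := mrg x y.
have ltX := card_word_image_lt xX yX nxy exy.
have [|v lev vP] := IHm (word_image u X).
  by rewrite -ltnS; apply: leq_trans leX.
exists (u ++ v) => [|a b aX bX]; first by rewrite size_cat mulSn leq_add.
by rewrite !apply_word_cat; apply: vP; apply: imset_f.
Qed.

End Merging.

(** * Fibonacci costs of a run *)

Fixpoint fib (n : nat) : nat :=
  if n is m.+1 then (if m is k.+1 then fib m + fib k else 1) else 0.

Lemma fibSS n : fib n.+2 = fib n.+1 + fib n.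
Proof. by []. Qed.

Lemma fib_gt0 n : 0 < fib n.+1.
Proof. by elim: n => // n IHn; rewrite fibSS ltn_addr. Qed.

(* Letters, and letters applied to a vertex none of whose in-literals is bad,
   that a run preparing the in-literals of a target through [n] vertices uses. *)
Definition run_len n := fib (n + 3) - 2.
Definition run_hard n := fib (n + 2) - 1.

Lemma run_lenSS n : run_len n.+2 = run_len n.+1 + run_len n + 2.
Proof.
rewrite /run_len !addn3 (fibSS n.+3) (fibSS n.+2) (fibSS n.+1).
have := fib_gt0 n; have := fib_gt0 n.+1; lia.
Qed.

Lemma run_hardSS n : run_hard n.+2 = run_hard n.+1 + run_hard n + 1.
Proof.
rewrite /run_hard !addn2 (fibSS n.+2).
have := fib_gt0 n.+1; have := fib_gt0 n.+2; lia.
Qed.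

Lemma run_lenS n : run_len n < run_len n.+1.
Proof. by elim: n => // n IHn; rewrite run_lenSS; have := leq_addl (run_len n) 2; lia. Qed.

Lemma run_hardS n : run_hard n < run_hard n.+1.
Proof. by elim: n => // n IHn; rewrite run_hardSS; lia. Qed.

Lemma run_len_mono m n : m <= n -> run_len m <= run_len n.
Proof.
move=> /subnK <-; elim: (n - m) => // k IHk.
exact: leq_trans IHk (ltnW (run_lenS _)).
Qed.

Lemma run_hard_mono m n : m <= n -> run_hard m <= run_hard n.
Proof.
move=> /subnK <-; elim: (n - m) => // k IHk.
exact: leq_trans IHk (ltnW (run_hardS _)).
Qed.

Notation srcs := (map (@arc_src _)).
Notation tgts := (map (@arc_tgt _)).

(** * Simple walks, their signs, and closed sets *)

Section Digraph.
Variables (V : finType) (G : sdigraph V).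
Implicit Types (U C D K A : {set V}) (u v t k p : V).
Implicit Types (e : V * V * bool) (a b : seq (V * V * bool)) (s tau : bool).

Lemma sgn_cons e a : sgn (e :: a) = (sgn a == arc_sign e).
Proof. by rewrite /sgn /= oddD oddb; case: (arc_sign e); case: (odd _). Qed.

Lemma sgn_cat a b : sgn (a ++ b) = (sgn a == sgn b).
Proof. by rewrite /sgn count_cat oddD; case: (odd _) => /=; case: (odd _). Qed.

Lemma is_walk_cat u a b :
  is_walk G u (a ++ b) = is_walk G u a && is_walk G (last u (tgts a)) b.
Proof. by elim: a u => //= e a IHa u; rewrite IHa !andbA. Qed.

Lemma walk_sources u a : is_walk G u a ->
  u :: tgts a = rcons (srcs a) (last u (tgts a)).
Proof.
elim: a u => //= e a IHa u /andP[/andP[/eqP <- eG] wa].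
by rewrite -IHa.
Qed.

Lemma walk_arcs u a e : is_walk G u a -> e \in a -> e \in G.
Proof.
elim: a u => //= e' a IHa u /andP[/andP[_ e'G] wa].
by rewrite inE => /predU1P[-> //|]; apply: IHa wa.
Qed.

(** Only sources are required to be distinct. For [t] outside [U] this covers at once the paths from
    [u] to [t] and, when [u = t], the cycles through [t]. *)
Definition simple_walk U u t a :=
  [&& a != [::], is_walk G u a, last u (tgts a) == t,
      all (fun v => v \in U) (behead (srcs a)) & uniq (srcs a)].

Lemma simple_walk_sub U U' u t a :
  U \subset U' -> simple_walk U u t a -> simple_walk U' u t a.
Proof.
move=> sUU' /and5P[an wa la /allP inU un]; apply/and5P; split=> //.
by apply/allP=> v /inU; apply: (subsetP sUU').
Qed.

Lemma simple_walk_cons U k u t e a :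
  e \in G -> arc_src e = k -> arc_tgt e = u -> u \in U -> k \notin U ->
  simple_walk (U :\ u) u t a -> simple_walk U k t (e :: a).
Proof.
move=> eG <- <- uU kU; case: a => // e' a /and5P[_ wa la inU un].
apply/and5P; split=> //; first by rewrite /= eqxx eG.
  move: wa => /= /andP[/andP[/eqP -> _] _]; rewrite uU /=.
  by apply/allP=> v /(allP inU); rewrite inE => /andP[].
rewrite [map _ _]/= cons_uniq un andbT; apply: contra kU.
rewrite -[arc_src e' :: _]/(srcs (e' :: a)) => kin.
move: wa kin => /= /andP[/andP[/eqP -> _] _]; rewrite inE => /predU1P[->//|].
by move/(allP inU); rewrite inE => /andP[].
Qed.

Lemma simple_walkD1 U u t a : simple_walk U u t a -> simple_walk (U :\ u) u t a.
Proof.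
case: a => // e a /and5P[an wa la /allP inU un]; apply/and5P; split=> //.
move: wa un => /= /andP[/andP[/eqP es _] _] /andP[ne _].
apply/allP=> v va; rewrite !inE inU // andbT -es.
by apply: contraNneq ne => <-.
Qed.

Lemma simple_walk1 U u t e : e \in G -> arc_src e = u -> arc_tgt e = t ->
  simple_walk U u t [:: e].
Proof. by move=> eG <- <-; rewrite /simple_walk /= !eqxx eG. Qed.

Lemma simple_walk_cycle U t a :
  t \notin U -> simple_walk U t t a -> is_cycle G t a.
Proof.
move=> tU /and5P[an wa /eqP la inU un]; rewrite /is_cycle an wa la eqxx andTb.
have := walk_sources wa; rewrite la; case: a an {wa la} inU un => // e a _ inU un.
rewrite [srcs (_ :: _)]/= rcons_cons => -[_ et].
have {}un : uniq (srcs a) by case/andP: un.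
rewrite (_ : tgts (e :: a) = rcons (srcs a) t) // rcons_uniq un !andbT.
by apply: contra tU => /(allP inU).
Qed.

Lemma negative_cycle U t a : positive_cycle_free G ->
  t \notin U -> simple_walk U t t a -> sgn a = false.
Proof.
move=> pcf tU /(simple_walk_cycle tU) ca; apply: negbTE; apply/negP=> sa.
by apply: pcf; exists t, a; rewrite ca.
Qed.

(* Giving [k] the value [s] pushes the end [t] of every simple walk from [k]
   with inner vertices in [U] towards the value [tau]. *)
Definition favors s tau U k t := forall a, simple_walk U k t a -> sgn a = (s == tau).

Lemma favors_sub s tau U U' k t :
  U' \subset U -> favors s tau U k t -> favors s tau U' k t.
Proof. by move=> sU fa a /(simple_walk_sub sU)/fa. Qed.

(** Favour passes along an arc: prefixing [e] turns walks from [u] into walks from [k], and the sign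
    condition says that [s'] is the value transmitted by [k]. *)
Lemma favors_step s s' tau U k u t e :
  e \in G -> arc_src e = k -> arc_tgt e = u -> u \in U -> k \notin U ->
  arc_sign e = (s == s') -> favors s tau U k t -> favors s' tau (U :\ u) u t.
Proof.
move=> eG se te uU kU sg fa a /(simple_walk_cons eG se te uU kU)/fa.
rewrite sgn_cons sg; by case: (sgn a); case: s sg fa => _ _; case: s'; case: tau.
Qed.

(** Cycles being negative, the present value of [t] pushes [t] towards the opposite one. This is how
    a run meant to flip a vertex gets its first favourable value. *)
Lemma favors_cycle s tau U t : positive_cycle_free G ->
  t \notin U -> s != tau -> favors s tau U t t.
Proof. by move=> pcf tU /negPf ne a /(negative_cycle pcf tU); rewrite ne. Qed.

Definition constant_sign U p t := forall a b,
  simple_walk U p t a -> simple_walk U p t b -> sgn a = sgn b.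

Lemma constant_sign_step s tau U k p t e :
  e \in G -> arc_src e = k -> arc_tgt e = p -> p \in U -> k \notin U ->
  favors s tau U k t -> constant_sign U p t.
Proof.
move=> eG se te pU kU fa a b /simple_walkD1 sa /simple_walkD1 sb.
have := fa _ (simple_walk_cons eG se te pU kU sa).
rewrite -(fa _ (simple_walk_cons eG se te pU kU sb)) !sgn_cons.
by case: (sgn a); case: (sgn b); case: (arc_sign e).
Qed.

Lemma constant_sign_sub U U' k t :
  U' \subset U -> constant_sign U k t -> constant_sign U' k t.
Proof.
by move=> s c a b /(simple_walk_sub s) sa /(simple_walk_sub s); apply: c.
Qed.

Definition closed_in U C :=
  [forall e in G, (arc_tgt e \in C) ==> (arc_src e \in U) ==> (arc_src e \in C)].

Lemma closed_inP U C : reflect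
  (forall e, e \in G -> arc_tgt e \in C -> arc_src e \in U -> arc_src e \in C)
  (closed_in U C).
Proof.
apply: (iffP forall_inP) => [h e eG tC sU|h e eG].
  by move: (h e eG); rewrite tC sU.
by apply/implyP=> tC; apply/implyP; apply: h.
Qed.

Lemma closed_inPn U C : reflect
  (exists e, [/\ e \in G, arc_tgt e \in C, arc_src e \in U & arc_src e \notin C])
  (~~ closed_in U C).
Proof.
apply: (iffP idP) => [|[e [eG tC sU sC]]].
  rewrite negb_forall => /existsP[e]; rewrite !negb_imply => /and4P[eG tC sU sC].
  by exists e.
by apply/negP=> /closed_inP/(_ e eG tC sU); rewrite (negPf sC).
Qed.

Lemma minimal_closed U A : A != set0 -> closed_in U A ->
  exists C, [/\ C \subset A, C != set0, closed_in U C &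
    forall D, D \subset C -> D != set0 -> closed_in U D -> D = C].
Proof.
move=> A0 cA; pose P := [pred D : {set V} | (D != set0) && closed_in U D].
have PA : P A by rewrite /= A0.
have [C /minsetP[/andP[C0 cC] minC] sCA] := minset_exists PA.
by exists C; split=> // D sDC D0 cD; apply: minC => //=; rewrite D0.
Qed.

End Digraph.

(** * Runs that prepare the in-literals of a target *)

Section Updates.
Variables (V : finType) (r : V -> bool) (G : sdigraph V).
Implicit Types (U C D K A : {set V}) (u v t k p : V) (x y : config V) (w : seq V).
Implicit Types (e : V * V * bool) (a b : seq (V * V * bool)) (s tau : bool).

(* [r v] is the value that a single in-literal can force on [v] (false for a
   conjunction, true for a disjunction), and [bad e] the value of the source of
   [e] for which [e] does so. *)
Definition bad e := arc_sign e == r (arc_tgt e).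

Definition hit x v := [exists e in G, (arc_tgt e == v) && (x (arc_src e) == bad e)].

Definition set_at x v s : config V := [ffun k => if k == v then s else x k].
Definition force v x := set_at x v (r v).
Definition upd v x := set_at x v (hit x v == r v).
Definition upds w x := foldl (fun y v => upd v y) x w.

Fixpoint hards w x :=
  if w is v :: w' then ~~ hit x v + hards w' (upd v x) else 0.

Lemma set_at_eq x v s : set_at x v s v = s.
Proof. by rewrite ffunE eqxx. Qed.

Lemma set_at_neq x v s k : k != v -> set_at x v s k = x k.
Proof. by rewrite ffunE => /negPf->. Qed.

Lemma hitP x v : reflect (exists e, [/\ e \in G, arc_tgt e = v & x (arc_src e) = bad e])
  (hit x v).
Proof.
apply: (iffP exists_inP) => [[e eG /andP[/eqP te /eqP be]]|[e [eG te be]]].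
  by exists e.
by exists e => //; rewrite te be !eqxx.
Qed.

Lemma hit_arc x e : e \in G -> x (arc_src e) = bad e -> hit x (arc_tgt e).
Proof. by move=> eG be; apply/hitP; exists e. Qed.

Lemma not_hit x v : (forall e, e \in G -> arc_tgt e = v -> x (arc_src e) != bad e) ->
  hit x v = false.
Proof. by move=> h; apply/hitP=> -[e [eG te /eqP]]; apply/negP/h. Qed.

Lemma upd_hit x v : hit x v -> upd v x = force v x.
Proof. by rewrite /upd /force => ->; case: (r v). Qed.

Lemma upd_val_hit x v : hit x v -> upd v x v = r v.
Proof. by move/upd_hit->; rewrite set_at_eq. Qed.

Lemma upd_val_free x v : hit x v = false -> upd v x v = ~~ r v.
Proof. by rewrite /upd set_at_eq => ->; case: (r v). Qed.

Lemma upds_cat w1 w2 x : upds (w1 ++ w2) x = upds w2 (upds w1 x).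
Proof. exact: foldl_cat. Qed.

Lemma hards_cat w1 w2 x : hards (w1 ++ w2) x = hards w1 x + hards w2 (upds w1 x).
Proof. by elim: w1 x => //= v w1 IHw x; rewrite IHw addnA. Qed.

Lemma hards_size w x : hards w x <= size w.
Proof. by elim: w x => //= v w IHw x; case: (hit x v) => /=; have := IHw (upd v x); lia. Qed.

Lemma upds_out w x k : k \notin w -> upds w x k = x k.
Proof.
elim: w x => //= v w IHw x; rewrite inE negb_or => /andP[kv kw].
by rewrite IHw // set_at_neq.
Qed.

Lemma upds_out_set w x A k : all (fun v => v \in A) w -> k \notin A -> upds w x k = x k.
Proof. by move=> /allP wA kA; apply: upds_out; apply: contra kA => /wA. Qed.

Lemma bad_matched e s : (s == bad e) = (arc_sign e == (s == r (arc_tgt e))).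
Proof. by rewrite /bad; case: s; case: arc_sign; case: (r _). Qed.

Lemma not_bad_matched e s : (s != bad e) = (arc_sign e == (s == ~~ r (arc_tgt e))).
Proof. by rewrite /bad; case: s; case: arc_sign; case: (r _). Qed.

Record run_ready U K A t tau x : Prop := RunReady {
  run_sub : A \subset U;
  run_closed : closed_in G U A;
  run_target : t \notin U;
  run_frozen : forall k, k \in K -> k \notin U;
  run_favors : forall k, k \in K -> favors G (x k) tau U k t;
  run_outside : forall e, e \in G -> arc_tgt e \in A -> arc_src e \notin U ->
    arc_src e \notin K -> x (arc_src e) != bad e;
  run_good : forall C, C \subset A -> C != set0 -> closed_in G U C ->
    exists2 p, p \in C & constant_sign G U p t;
  run_in : forall u, u \in A ->
    exists e, [/\ e \in G, arc_tgt e = u & arc_src e \in U :|: K] }.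

(** Freezing [u] may create new closed parts, but each of these is entered from [u], and
    [constant_sign_step] then provides its good vertex. *)
Lemma run_ready_move U K A t tau x x' u :
  run_ready U K A t tau x -> u \in A -> (forall v, v \notin A -> x' v = x v) ->
  favors G (x' u) tau (U :\ u) u t ->
  run_ready (U :\ u) (u |: K) (A :\ u) t tau x'.
Proof.
case=> sAU cA tU KU fK oA gA iA uA xx' fu; have uU := subsetP sAU _ uA.
have nA v : v \notin U -> v \notin A by apply/contra/(subsetP sAU).
split.
- exact: setSD.
- apply/closed_inP=> e eG; rewrite !inE => /andP[tu tA] /andP[-> sU] /=.
  exact: (closed_inP _ _ _ cA).
- by rewrite !inE (negPf tU) andbF.
- by move=> k /setU1P[->|/KU kU]; rewrite !inE ?eqxx // (negPf kU) andbF.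
- move=> k /setU1P[->//|kK]; rewrite xx' ?nA ?KU //.
  by apply: favors_sub (fK _ kK); apply: subD1set.
- move=> e eG; rewrite !inE => /andP[_ tA] nU; rewrite negb_or => /andP[su sK].
  have {}nU : arc_src e \notin U by move: nU; rewrite su.
  by rewrite xx' ?nA //; apply: oA.
- move=> C sC C0 cC.
  have sCA : C \subset A by apply: subset_trans sC (subD1set _ _).
  have [cU|/closed_inPn[e [eG tC sU sC']]] := boolP (closed_in G U C).
    have [p pC cp] := gA _ sCA C0 cU; exists p => //.
    by apply: constant_sign_sub cp; apply: subD1set.
  have eu : arc_src e = u.
    apply/eqP; apply: contraNT sC' => neu.
    by apply: (closed_inP _ _ _ cC) => //; rewrite !inE neu.
  exists (arc_tgt e) => //; apply: constant_sign_step eG eu erefl _ _ fu.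
    by move/subsetP: sC => /(_ _ tC); rewrite !inE => /andP[-> /(subsetP sAU)].
  by rewrite !inE eqxx.
- move=> v; rewrite inE => /andP[vu vA]; have [e [eG te se]] := iA _ vA.
  exists e; split=> //; move: se; rewrite !inE.
  by case: (arc_src e == u); rewrite ?orbT.
Qed.

Definition starts_forced K A x :=
  [exists e in G, [&& arc_src e \in K, arc_tgt e \in A & x (arc_src e) == bad e]].

Definition len_bound K A x :=
  if starts_forced K A x then (run_len #|A|.-1).+1 else run_len #|A|.
Definition hard_bound K A x :=
  if starts_forced K A x then run_hard #|A|.-1 else run_hard #|A|.

Lemma starts_forced_neq0 K A x : starts_forced K A x -> 0 < #|A|.
Proof. by case/exists_inP=> e _ /and3P[_ tA _]; apply/card_gt0P; exists (arc_tgt e). Qed.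

Lemma len_bound_le K A x : len_bound K A x <= run_len #|A|.
Proof.
rewrite /len_bound; case: ifP => // /starts_forced_neq0.
by case: #|A| => // n _; apply: run_lenS.
Qed.

Lemma hard_bound_le K A x : hard_bound K A x <= run_hard #|A|.
Proof. by rewrite /hard_bound; case: ifP => // _; apply/run_hard_mono/leq_pred. Qed.

Lemma constant_sign_favors U p t tau :
  constant_sign G U p t -> exists s, favors G s tau U p t.
Proof.
move=> cp; have [[a sa]|no] := classic (exists a, simple_walk G U p t a).
  exists (sgn a == tau) => b /(cp _ _ sa) <-.
  by case: (sgn a); case: tau.
by exists tau => a sa; case: no; exists a.
Qed.

(* The length recursion is [L n <= L (n - 1) + L (n - 2) + 2]: when the good
   vertex [p] of a minimal closed set has to be flipped, an out-neighbour of [p]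
   is forced by [p] either before the flip or after it. *)
Lemma favoring_run U K A t tau x : positive_cycle_free G ->
  run_ready U K A t tau x ->
  exists w, [/\ all (fun v => v \in A) w, size w <= len_bound K A x,
    hards w x <= hard_bound K A x &
    forall u, u \in A -> favors G (upds w x u) tau (U :\: A) u t].
Proof.
move=> pcf; move: {2}(#|A|).+1 (ltnSn #|A|) => n.
elim: n => // n IHn in U K A t tau x *; rewrite ltnS => leA rdy.
have [sAU cA tU KU fK oA gA iA] := rdy.
(* The common tail of all cases: freeze [u] at the favourable value reached by [w0] and recurse on
   [A :\ u]. *)
have cont u w0 : u \in A -> all (fun v => v \in A) w0 ->
    favors G (upds w0 x u) tau (U :\ u) u t ->
    exists w, [/\ all (fun v => v \in A) w,
      size w <= size w0 + len_bound (u |: K) (A :\ u) (upds w0 x),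
      hards w x <= hards w0 x + hard_bound (u |: K) (A :\ u) (upds w0 x) &
      forall v, v \in A -> favors G (upds w x v) tau (U :\: A) v t].
  move=> uA w0A fu.
  have rdy' : run_ready (U :\ u) (u |: K) (A :\ u) t tau (upds w0 x).
    by apply: run_ready_move rdy uA _ fu => v; apply: upds_out_set.
  have ltA : #|A :\ u| < n by move: leA; rewrite (cardsD1 u A) uA.
  have [w [wA sw hw fw]] := IHn _ _ _ _ _ _ ltA rdy'.
  exists (w0 ++ w); split.
  - rewrite all_cat w0A; apply: sub_all wA => v.
    by rewrite inE => /andP[].
  - by rewrite size_cat leq_add2l.
  - by rewrite hards_cat leq_add2l.
  move=> v vA; rewrite upds_cat; have [->|vu] := eqVneq v u.
    rewrite (upds_out_set _ wA) ?inE ?eqxx //.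
    by apply: favors_sub fu; apply: setDS; rewrite sub1set.
  have -> : U :\: A = (U :\ u) :\: (A :\ u).
    apply/setP=> z; rewrite !inE; have [->|] := eqVneq z u; rewrite ?uA //=.
  by apply: fw; rewrite !inE vu.
have [A0|A0] := eqVneq A set0.
  exists [::]; split=> // u; by rewrite A0 inE.
have cA1 u : u \in A -> #|A| = #|A :\ u|.+1 by move=> uA; rewrite (cardsD1 u A) uA.
(* A frozen vertex already forces a vertex of [A]. The forced value is favourable by [favors_step],
   and the letter is not hard. *)
have [/exists_inP[e eG /and3P[sK tA /eqP be]]|nforced] := boolP (starts_forced K A x).
  have hu := hit_arc eG be.
  have [||w [wA sw hw fw]] := cont (arc_tgt e) [:: arc_tgt e] tA.
  - by rewrite /= tA.
  - rewrite /= upd_val_hit //; apply: favors_step eG erefl erefl _ (KU _ sK) _ (fK _ sK).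
      exact: (subsetP sAU).
    by apply/eqP; rewrite -bad_matched be.
  have sf : starts_forced K A x by apply/exists_inP; exists e; rewrite // sK tA be eqxx.
  exists w; split=> //.
    rewrite /len_bound sf (cA1 _ tA) /=; apply: leq_trans sw _.
    by rewrite add1n ltnS len_bound_le.
  rewrite /hard_bound sf (cA1 _ tA) /=; apply: leq_trans hw _.
  by rewrite /= hu /= hard_bound_le.
have lenA : len_bound K A x = run_len #|A| by rewrite /len_bound (negPf nforced).
have hardA : hard_bound K A x = run_hard #|A| by rewrite /hard_bound (negPf nforced).
have neutral e : e \in G -> arc_tgt e \in A -> arc_src e \notin U ->
    x (arc_src e) != bad e.
  move=> eG tA sU; have [sK|sK] := boolP (arc_src e \in K); last exact: oA.
  by apply: contraNN nforced => be; apply/exists_inP; exists e; rewrite // sK tA.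
have [C [sCA C0 cC minC]] := minimal_closed A0 cA.
have [p pC cp] := gA _ sCA C0 cC.
have pA := subsetP sCA _ pC; have pU := subsetP sAU _ pA.
have short w : size w <= 1 + run_len #|A :\ p| -> size w <= len_bound K A x.
  by move=> sw; rewrite lenA (cA1 p pA); apply: leq_trans sw (run_lenS _).
have short' w : hards w x <= 1 + run_hard #|A :\ p| -> hards w x <= hard_bound K A x.
  by move=> sw; rewrite hardA (cA1 p pA); apply: leq_trans sw (run_hardS _).
(* Without in-neighbours in [C], the good vertex [p] sees only values that are not bad. Its update
   yields [~~ r p], and this is the value transmitted by a frozen in-neighbour. *)
have [/exists_inP[e0 e0G /andP[/eqP te0 se0]]|noin] :=
    boolP [exists e in G, (arc_tgt e == p) && (arc_src e \in C)]; last first.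
  have inU e : e \in G -> arc_tgt e = p -> arc_src e \notin U.
    move=> eG te; apply: contra noin => sU; apply/exists_inP; exists e => //.
    by rewrite te eqxx (closed_inP _ _ _ cC) ?te.
  have hp : hit x p = false.
    by apply: not_hit => e eG te; apply: neutral; rewrite ?te // inU.
  have [e [eG te]] := iA p pA; rewrite inE (negPf (inU _ eG te)) /= => sK.
  have [||w [wA sw hw fw]] := cont p [:: p] pA.
  - by rewrite /= pA.
  - rewrite /= upd_val_free //; apply: (favors_step eG erefl te pU (KU _ sK) _ (fK _ sK)).
    apply/eqP; have := neutral e eG; rewrite te not_bad_matched te; apply=> //.
    exact: inU.
  exists w; split=> //.
    by apply: short; apply: leq_trans sw _; rewrite leq_add2l len_bound_le.
  apply: short'; apply: leq_trans hw _; rewrite /= hp addn0.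
  by rewrite leq_add2l hard_bound_le.
have [want fp] := constant_sign_favors tau cp.
have [xp|xp] := eqVneq (x p) want.
  have [||w [wA sw hw fw]] := cont p [::] pA => //.
    by rewrite /= xp; apply: favors_sub fp; apply: subD1set.
  exists w; split=> //.
    apply: short; apply: leq_trans sw _; apply: leq_trans (len_bound_le _ _ _) _.
    exact: leq_addl.
  apply: short'; apply: leq_trans hw _; apply: leq_trans (hard_bound_le _ _ _) _.
  exact: leq_addl.
(* Here [p] has the wrong value, so the negative cycles through [p] push it towards [want]: the
   procedure is applied inside [C] with target [p], only [p] being frozen. *)
have fpp : favors G (x p) want (C :\ p) p p by apply: favors_cycle; rewrite ?inE ?eqxx.
(* By minimality of [C], whatever is closed in [C :\ p] is entered from [p]; this supplies the good
   vertices of the inner run. *)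
have exit D : D \subset C :\ p -> D != set0 -> closed_in G (C :\ p) D ->
    exists e, [/\ e \in G, arc_src e = p & arc_tgt e \in D].
  move=> sD D0 cD.
  have sDC : D \subset C by apply: subset_trans sD (subD1set _ _).
  have /closed_inPn[e [eG tD sU sD']] : ~~ closed_in G U D.
    apply/negP=> /(minC _ sDC D0) DC.
    by move/subsetP: sD => /(_ p); rewrite DC pC !inE eqxx => /(_ isT).
  exists e; split=> //; apply/eqP; apply: contraNT sD' => nsp.
  apply: (closed_inP _ _ _ cD) => //; rewrite !inE nsp /=.
  by apply: (closed_inP _ _ _ cC) => //; apply: (subsetP sDC).
have rdyC : run_ready (C :\ p) [set p] (C :\ p) p want x.
  split=> //.
  - by apply/closed_inP=> e eG _.
  - by rewrite !inE eqxx.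
  - by move=> k /set1P->; rewrite !inE eqxx.
  - by move=> k /set1P->.
  - move=> e eG; rewrite !inE => /andP[_ tC]; rewrite negb_and negbK => sC sp.
    apply: neutral => //; first exact: (subsetP sCA).
    apply: contraNN sp => sU; move: sC; rewrite (closed_inP _ _ _ cC e) // orbF.
    by [].
  - move=> D sD D0 cD; have [e [eG se tD]] := exit D sD D0 cD.
    exists (arc_tgt e) => //; apply: constant_sign_step eG se erefl _ _ fpp.
      exact: (subsetP sD).
    by rewrite !inE eqxx.
  - move=> u; rewrite !inE => /andP[up uC].
    have /closed_inPn[e [eG tu sU su]] : ~~ closed_in G U [set u].
      apply/negP=> cu; have h : [set u] = C.
        by apply: minC; rewrite ?sub1set //; apply/set0Pn; exists u; rewrite inE.
      by move: pC; rewrite -h inE eq_sym (negPf up).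
    move/set1P: tu => tu; exists e; split=> //; rewrite !inE.
    have -> : arc_src e \in C by apply: (closed_inP _ _ _ cC); rewrite ?tu.
    by case: (arc_src e == p).
have ltC : #|C :\ p| < n.
  apply: leq_trans leA; rewrite (cA1 p pA) ltnS; apply: subset_leq_card.
  exact: setSD.
have [w2 [w2C sw2 hw2 fw2]] := IHn _ _ _ _ _ _ ltC rdyC.
set x2 := upds w2 x in fw2.
have x2p : x2 p = x p by apply: (upds_out_set _ w2C); rewrite !inE eqxx.
have into e : e \in G -> arc_tgt e = p -> arc_src e \in C ->
    arc_sign e = (x2 (arc_src e) == want).
  move=> eG te sC; have sg : sgn [:: e] = arc_sign e by rewrite /sgn /=; case: arc_sign.
  rewrite -sg; have [se|se] := eqVneq (arc_src e) p.
    by rewrite se x2p; apply: fpp; apply: simple_walk1.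
  by apply: fw2; [rewrite !inE se | apply: simple_walk1].
have updp : upd p x2 p = want.
  have [rw|rw] := eqVneq (r p) want.
    rewrite upd_val_hit // -te0; apply: hit_arc => //.
    by apply/eqP; rewrite bad_matched te0 rw; apply/eqP; apply: into.
  have {}rw : want = ~~ r p by move: rw; case: (r p); case: (want).
  rewrite upd_val_free -?rw //; apply: not_hit => e eG te.
  have [sC|sC] := boolP (arc_src e \in C).
    by rewrite not_bad_matched te -rw; apply/eqP; apply: into.
  have sU : arc_src e \notin U.
    by apply: contra sC => sU; apply: (closed_inP _ _ _ cC); rewrite ?te.
  rewrite /x2 (upds_out_set _ w2C) ?neutral ?te //.
  by rewrite inE (negPf sC) andbF.
have [||w [wA sw hw fw]] := cont p (w2 ++ [:: p]) pA.
- apply/allP=> v; rewrite mem_cat inE => /orP[/(allP w2C)|/eqP-> //].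
  by rewrite inE => /andP[_ /(subsetP sCA)].
- by rewrite upds_cat /= updp; apply: favors_sub fp; apply: subD1set.
have leCA : #|C :\ p| <= #|A :\ p| by apply/subset_leq_card/setSD.
rewrite size_cat /= addn1 in sw; rewrite hards_cat /= addn0 in hw.
have hp1 := leq_b1 (~~ hit x2 p).
have lb2 := len_bound_le [set p] (C :\ p) x.
have hb2 := hard_bound_le [set p] (C :\ p) x.
have lb3 := len_bound_le (p |: K) (A :\ p) (upds (w2 ++ [:: p]) x).
have hb3 := hard_bound_le (p |: K) (A :\ p) (upds (w2 ++ [:: p]) x).
(* Here [C] is [p] alone, with a loop, and the inner run is empty. *)
have [D0|D0] := eqVneq (C :\ p) set0.
  have len0 : size w2 = 0.
    by apply/eqP; rewrite -leqn0 (leq_trans sw2) // (leq_trans lb2) // D0 cards0.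
  have hard0 : hards w2 x = 0.
    by apply/eqP; rewrite -leqn0 -len0 hards_size.
  exists w; split=> //; first by apply: short; apply: leq_trans sw _; rewrite len0 leq_add2l.
  by apply: short'; apply: leq_trans hw _; rewrite hard0 add0n -/x2 leq_add.
have [e [eG se tD]] : exists e, [/\ e \in G, arc_src e = p & arc_tgt e \in C :\ p].
  by apply: exit => //; apply/closed_inP.
have tA : arc_tgt e \in A :\ p by apply: subsetP tD; apply: setSD.
have [m Em] : exists m, #|A :\ p| = m.+1.
  by case Em: #|A :\ p| tA => [|m]; [move/eqP: Em; rewrite cards_eq0 => /eqP->; rewrite inE | exists m].
have Cm : #|C :\ p| <= m.+1 by rewrite -Em.
have forced2 : starts_forced [set p] (C :\ p) x || starts_forced (p |: K) (A :\ p) (upds (w2 ++ [:: p]) x).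
  have [be|nbe] := eqVneq (x p) (bad e).
    by apply/orP; left; apply/exists_inP; exists e; rewrite // se inE eqxx tD be /=.
  apply/orP; right; apply/exists_inP; exists e => //.
  rewrite se !inE eqxx /= -in_setD1 tA upds_cat /= updp.
  by move: xp nbe; clear; case: (x p); case: (bad e); case: (want).
suff [sz hz] : size w <= run_len m.+2 /\ hards w x <= run_hard m.+2.
  by exists w; split; rewrite ?lenA ?hardA ?(cA1 p pA) ?Em.
rewrite run_lenSS run_hardSS.
rewrite Em in lb3 hb3.
have lC := run_len_mono Cm; have hC := run_hard_mono Cm.
have pred_le : #|C :\ p|.-1 <= m by rewrite -ltnS (leq_trans _ Cm) // prednK // card_gt0.
have lC' := run_len_mono pred_le; have hC' := run_hard_mono pred_le.
rewrite -/x2 in hw.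
case/orP: forced2 => fo.
  have {}sw2 : size w2 <= (run_len m).+1 by apply: leq_trans sw2 _; rewrite /len_bound fo.
  have {}hw2 : hards w2 x <= run_hard m by apply: leq_trans hw2 _; rewrite /hard_bound fo.
  split.
    by clear -sw sw2 lb3; lia.
  by clear -hw hw2 hb3 hp1; lia.
rewrite /len_bound fo Em /= in sw; rewrite /hard_bound fo Em /= in hw.
have {}sw2 := leq_trans sw2 (leq_trans lb2 lC).
have {}hw2 := leq_trans hw2 (leq_trans hb2 hC).
split; first by clear -sw sw2; lia.
by clear -hw hw2 hp1; lia.
Qed.

End Updates.

(** * The game on pairs of configurations *)

Section Game.
Variables (V : finType) (r : V -> bool).
Implicit Types (G : sdigraph V) (U E A : {set V}) (u v k : V) (x y : config V).
Implicit Types (w : seq V) (e : V * V * bool) (Q : config V -> config V -> Prop).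

Lemma upd_out G v x k : k != v -> upd r G v x k = x k.
Proof. exact: set_at_neq. Qed.

Lemma force_out v x k : k != v -> force r v x k = x k.
Proof. exact: set_at_neq. Qed.

Lemma force_val v x : force r v x v = r v.
Proof. exact: set_at_eq. Qed.

Lemma eq_hit G x y v :
  (forall e, e \in G -> arc_tgt e = v -> x (arc_src e) = y (arc_src e)) ->
  hit r G x v = hit r G y v.
Proof.
move=> xy; apply/hitP/hitP=> -[e [eG te be]]; exists e; split=> //.
  by rewrite -xy.
by rewrite xy.
Qed.

Lemma upd_val G x v : upd r G v x v = (hit r G x v == r v).
Proof. exact: set_at_eq. Qed.

(* A game on pairs of configurations.  A hard letter (second cost) updates both.
   For a soft letter an adversary may instead force the vertex in both: this is
   what an upstream part of the network, identical in both configurations but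
   otherwise uncontrolled, can do. *)
Inductive win G A Q : nat -> nat -> config V -> config V -> Prop :=
| win_done a b x y of Q x y : win G A Q a b x y
| win_hard a b x y v of v \in A & win G A Q a b (upd r G v x) (upd r G v y) :
    win G A Q a.+1 b.+1 x y
| win_soft a b x y v of v \in A & win G A Q a b (upd r G v x) (upd r G v y)
    & win G A Q a b (force r v x) (force r v y) : win G A Q a.+1 b x y.

Lemma win_mono G A Q a b a' b' x y :
  a <= a' -> b <= b' -> win G A Q a b x y -> win G A Q a' b' x y.
Proof.
move=> la lb H; elim: H a' b' la lb => {a b x y}.
- by move=> *; apply: win_done.
- move=> a b x y v vA _ IH [|a'] // [|b'] // la lb.
  by apply: (win_hard vA); apply: IH.
- move=> a b x y v vA _ IH1 _ IH2 [|a'] // b' la lb.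
  by apply: (win_soft vA); [apply: IH1 | apply: IH2].
Qed.

Lemma win_bind G A Q Q' a b a' b' x y :
  win G A Q a b x y -> (forall x' y', Q x' y' -> win G A Q' a' b' x' y') ->
  win G A Q' (a + a') (b + b') x y.
Proof.
move=> H K; elim: H => {a b x y}.
- by move=> a b x y /K; apply: win_mono; rewrite leq_addl.
- by move=> a b x y v vA _ IH; rewrite !addSn; apply: win_hard vA IH.
- by move=> a b x y v vA _ IH1 _ IH2; rewrite addSn; apply: win_soft vA IH1 IH2.
Qed.

Lemma win_impl G A Q Q' a b x y :
  (forall x' y', Q x' y' -> Q' x' y') -> win G A Q a b x y -> win G A Q' a b x y.
Proof.
move=> QQ' H; rewrite -[a]addn0 -[b]addn0; apply: win_bind H _ => x' y' /QQ'.
exact: win_done.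
Qed.

Lemma win_subset G A A' Q a b x y :
  A \subset A' -> win G A Q a b x y -> win G A' Q a b x y.
Proof.
move=> sA; elim=> {a b x y} [a b x y q|a b x y v /(subsetP sA) vA _ IH|
  a b x y v /(subsetP sA) vA _ IH1 _ IH2].
- exact: win_done.
- exact: win_hard vA IH.
- exact: win_soft vA IH1 IH2.
Qed.

Definition same_off A x x' := forall k, k \notin A -> x' k = x k.

Lemma same_off_upd G A x v : v \in A -> same_off A x (upd r G v x).
Proof. by move=> vA k kA; rewrite upd_out //; apply: contraNneq kA => ->. Qed.

Lemma same_off_force A x v : v \in A -> same_off A x (force r v x).
Proof. by move=> vA k kA; rewrite force_out //; apply: contraNneq kA => ->. Qed.

Lemma win_frame G A Q a b x y : win G A Q a b x y ->
  win G A (fun x' y' => [/\ Q x' y', same_off A x x' & same_off A y y']) a b x y.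
Proof.
elim=> {a b x y} [a b x y q|a b x y v vA _ IH|a b x y v vA _ IH1 _ IH2].
- exact: win_done.
- apply: (win_hard vA); apply: win_impl IH => x' y' [q sx sy]; split=> // k kA.
    by rewrite sx // (same_off_upd G x vA).
  by rewrite sy // (same_off_upd G y vA).
- apply: (win_soft vA).
    apply: win_impl IH1 => x' y' [q sx sy]; split=> // k kA.
      by rewrite sx // (same_off_upd G x vA).
    by rewrite sy // (same_off_upd G y vA).
  apply: win_impl IH2 => x' y' [q sx sy]; split=> // k kA.
    by rewrite sx // (same_off_force x vA).
  by rewrite sy // (same_off_force y vA).
Qed.

Lemma win_sym G A Q a b x y :
  win G A Q a b x y -> win G A (fun x' y' => Q y' x') a b y x.
Proof.
elim=> {a b x y} [a b x y q|a b x y v vA _ IH|a b x y v vA _ IH1 _ IH2].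
- exact: win_done.
- exact: win_hard vA IH.
- exact: win_soft vA IH1 IH2.
Qed.

Lemma win_exists_word G A Q a b x y : win G A Q a b x y ->
  exists2 w, size w <= a & Q (upds r G w x) (upds r G w y).
Proof.
elim=> {a b x y} [a b x y q|a b x y v _ _ [w sw qw]|a b x y v _ _ [w sw qw] _ _].
- by exists [::].
- by exists (v :: w).
- by exists (v :: w).
Qed.

(** On a letter that hits [x], updating and forcing have the same effect on [x]. So [x] follows [w]
    exactly whatever the adversary does, only [y] branches, and just the letters not hitting [x] are
    hard. The invariant [I] keeps what is known of [y]. *)
Lemma win_word G A Q (I : config V -> config V -> Prop) w a b x y :
  (forall v x y, v \in w -> I x y -> I (upd r G v x) (upd r G v y)) ->
  (forall v x y, v \in w -> hit r G x v -> I x y -> I (force r v x) (force r v y)) ->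
  all (fun v => v \in A) w -> I x y ->
  (forall y', I (upds r G w x) y' -> win G A Q a b (upds r G w x) y') ->
  win G A Q (size w + a) (hards r G w x + b) x y.
Proof.
elim: w x y => [|v w IHw] x y Iu If /=; first by move=> _ Ixy; apply.
case/andP=> vA wA Ixy K.
have Iu' u z z' : u \in w -> I z z' -> I (upd r G u z) (upd r G u z').
  by move=> uw; apply: Iu; rewrite inE uw orbT.
have If' u z z' : u \in w -> hit r G z u -> I z z' -> I (force r u z) (force r u z').
  by move=> uw; apply: If; rewrite inE uw orbT.
have vw : v \in v :: w by rewrite inE eqxx.
case: (boolP (hit r G x v)) => hx /=; rewrite ?add0n ?addSn.
  apply: (win_soft vA).
    by apply: IHw => //; apply: Iu.
  by rewrite -(upd_hit hx); apply: IHw => //; rewrite (upd_hit hx); apply: If.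
by apply: (win_hard vA); apply: IHw => //; apply: Iu.
Qed.

Definition restrict G E : sdigraph V :=
  [set e in G | (arc_src e \in E) && (arc_tgt e \in E)].

Lemma in_restrict G E e :
  (e \in restrict G E) = [&& e \in G, arc_src e \in E & arc_tgt e \in E].
Proof. by rewrite inE. Qed.

Lemma restrict_sub G E e : e \in restrict G E -> e \in G.
Proof. by rewrite inE => /andP[]. Qed.

Definition agree A x y := forall k, k \in A -> x k = y k.

(* The game of the network induced on [E] is played inside that of [G] by first
   moving the external in-literals of a vertex to be updated away from their bad
   values, with [t] letters of which [h] are hard. *)
Lemma win_simulate G U E Q t h a b (X Y x0 y0 x y : config V) :
  [disjoint U & E] ->
  (forall e, e \in G -> arc_tgt e \in U -> arc_src e \notin U ->
     arc_src e \notin E /\ X (arc_src e) = Y (arc_src e)) ->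
  (forall e, e \in G -> arc_tgt e \in E -> arc_src e \notin U ->
     arc_src e \notin E -> X (arc_src e) != bad r e /\ Y (arc_src e) != bad r e) ->
  (forall v z, v \in E -> same_off (U :|: E) X z ->
     exists w, [/\ all (fun k => k \in U) w, size w <= t, hards r G w z <= h &
       forall e, e \in G -> arc_tgt e = v -> arc_src e \in U ->
         upds r G w z (arc_src e) != bad r e]) ->
  win (restrict G E) E Q a b x0 y0 ->
  agree E x0 x -> agree E y0 y -> agree U x y ->
  same_off (U :|: E) X x -> same_off (U :|: E) Y y ->
  win G (U :|: E)
    (fun x' y' => [/\ exists x1 y1, [/\ Q x1 y1, agree E x1 x' & agree E y1 y'],
       agree U x' y', same_off (U :|: E) X x' & same_off (U :|: E) Y y'])
    (a + b * t) (b * h.+1) x y.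
Proof.
move=> dUE inU inE neut H.
have notE v : v \in U -> v \notin E by move=> vU; rewrite (disjointFr dUE).
have notU v : v \in E -> v \notin U by move=> vE; rewrite (disjointFl dUE).
have UE v : v \in U -> v \in U :|: E by rewrite in_setU => ->.
have EU v : v \in E -> v \in U :|: E by rewrite in_setU => ->; rewrite orbT.
have out v : v \notin U -> v \notin E -> v \notin U :|: E.
  by rewrite in_setU negb_or => -> ->.
have neE k v : k \in E -> v \in U -> k != v.
  by move=> kE vU; apply: contraTneq kE => ->; apply: notE.
have neU k v : k \in U -> v \in E -> k != v.
  by move=> kU vE; apply: contraTneq kU => ->; apply: notU.
have stepE v z z0 : v \in E -> agree E z0 z ->
    (forall e, e \in G -> arc_tgt e = v -> arc_src e \notin E -> z (arc_src e) != bad r e) ->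
    agree E (upd r (restrict G E) v z0) (upd r G v z).
  move=> vE ag nb k kE; rewrite /upd /set_at !ffunE; case: eqP => // _; last exact: ag.
  congr (_ == _); apply/hitP/hitP=> -[e [eG te be]]; exists e; split=> //.
  - exact: restrict_sub eG.
  - by rewrite -ag //; move: eG; rewrite in_restrict => /and3P[].
  - rewrite in_restrict eG te vE andbT; apply: contraT => sE.
    by move: (nb e eG te sE); rewrite be eqxx.
  - rewrite ag //; apply: contraT => sE.
    by move: (nb e eG te sE); rewrite be eqxx.
have forceE v z z0 : agree E z0 z -> agree E (force r v z0) (force r v z).
  by move=> ag k kE; rewrite /force /set_at !ffunE; case: eqP => // _; apply: ag.
elim: H x y => {a b x0 y0} [a b x0 y0 q|a b x0 y0 v vE _ IH|a b x0 y0 v vE _ IH1 _ IH2]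
  x y xE yE xyU Xx Yy.
- by apply: win_done; split=> //; exists x0, y0.
- have [w [wU sw hw nw]] := neut v x vE Xx.
  pose I (x' y' : config V) := [/\ agree E x0 x', agree E y0 y', agree U x' y',
    same_off (U :|: E) X x' & same_off (U :|: E) Y y'].
  have : win G (U :|: E)
    (fun x' y' => [/\ exists x1 y1, [/\ Q x1 y1, agree E x1 x' & agree E y1 y'],
       agree U x' y', same_off (U :|: E) X x' & same_off (U :|: E) Y y'])
    (size w + (a + b * t).+1) (hards r G w x + (b * h.+1).+1) x y.
    apply: (@win_word G _ _ I).
    + move=> u x' y' /(allP wU) uU [xE' yE' xyU' Xx' Yy'].
      have hh : hit r G x' u = hit r G y' u.
        apply: eq_hit => e eG te; have [sU|sU] := boolP (arc_src e \in U); first exact: xyU'.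
        have [|sE XY] := inU e eG _ sU; first by rewrite te.
        by rewrite Xx' ?Yy' ?out.
      split=> k; [| | | |].
      * by move=> kE; rewrite upd_out ?xE' // neE.
      * by move=> kE; rewrite upd_out ?yE' // neE.
      * move=> kU; have [->|ku] := eqVneq k u; first by rewrite !upd_val hh.
        by rewrite !upd_out ?xyU'.
      * by move=> kUE; rewrite (same_off_upd _ _ (UE _ uU)) ?Xx'.
      * by move=> kUE; rewrite (same_off_upd _ _ (UE _ uU)) ?Yy'.
    + move=> u x' y' /(allP wU) uU _ [xE' yE' xyU' Xx' Yy']; split=> k; [| | | |].
      * by move=> kE; rewrite force_out ?xE' // neE.
      * by move=> kE; rewrite force_out ?yE' // neE.
      * move=> kU; have [->|ku] := eqVneq k u; first by rewrite !force_val.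
        by rewrite !force_out ?xyU'.
      * by move=> kUE; rewrite (same_off_force _ (UE _ uU)) ?Xx'.
      * by move=> kUE; rewrite (same_off_force _ (UE _ uU)) ?Yy'.
    + by apply/allP=> k /(allP wU)/UE.
    + by split.
    move=> y' [xE' yE' xyU' Xx' Yy']; apply: (win_hard (EU _ vE)); apply: IH.
    + apply: stepE => // e eG te sE; have [sU|sU] := boolP (arc_src e \in U); first exact: nw.
      by rewrite Xx' ?out //; have [|] := inE e eG _ sU sE; rewrite ?te.
    + apply: stepE => // e eG te sE; have [sU|sU] := boolP (arc_src e \in U).
        by rewrite -xyU' // nw.
      by rewrite Yy' ?out //; have [|] := inE e eG _ sU sE; rewrite ?te.
    + by move=> k kU; rewrite !upd_out ?xyU' ?neU.
    + by move=> k kUE; rewrite (same_off_upd _ _ (EU _ vE)) ?Xx'.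
    + by move=> k kUE; rewrite (same_off_upd _ _ (EU _ vE)) ?Yy'.
  apply: win_mono; rewrite !mulSn; clear -sw hw; lia.
have fXY : win G (U :|: E)
    (fun x' y' => [/\ exists x1 y1, [/\ Q x1 y1, agree E x1 x' & agree E y1 y'],
       agree U x' y', same_off (U :|: E) X x' & same_off (U :|: E) Y y'])
    (a + b * t) (b * h.+1) (force r v x) (force r v y).
  apply: IH2; [exact: forceE | exact: forceE | | |].
  - by move=> k kU; rewrite !force_out ?xyU ?neU.
  - by move=> k kUE; rewrite (same_off_force _ (EU _ vE)) ?Xx.
  - by move=> k kUE; rewrite (same_off_force _ (EU _ vE)) ?Yy.
rewrite addSn; apply: (win_soft (EU _ vE) _ fXY).
(* A soft letter is played without steering. If an external value is bad for [v], it comes from [U],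
   hence is bad in both configurations, and both updates are the forced ones. Otherwise the update
   is that of the induced network. *)
have [/exists_inP[e eG /and3P[/eqP te sE /eqP be]]|nb] :=
  boolP [exists e in G, [&& arc_tgt e == v, arc_src e \notin E & x (arc_src e) == bad r e]].
- have sU : arc_src e \in U.
    apply: contraT => sU; have [|] := inE e eG _ sU sE; rewrite ?te //.
    by rewrite -Xx ?out // be eqxx.
  rewrite !upd_hit; first exact: fXY.
    by rewrite -te; apply: hit_arc => //; rewrite -xyU.
  by rewrite -te; apply: hit_arc.
have nbx e : e \in G -> arc_tgt e = v -> arc_src e \notin E -> x (arc_src e) != bad r e.
  move=> eG te sE; apply: contraNN nb => be; apply/exists_inP; exists e => //.
  by rewrite te eqxx sE.
apply: IH1.
- exact: stepE.
- apply: stepE => // e eG te sE; have [sU|sU] := boolP (arc_src e \in U).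
    by rewrite -xyU // nbx.
  by rewrite Yy ?out //; have [|] := inE e eG _ sU sE; rewrite ?te.
- by move=> k kU; rewrite !upd_out ?xyU ?neU.
- by move=> k kUE; rewrite (same_off_upd _ _ (EU _ vE)) ?Xx.
- by move=> k kUE; rewrite (same_off_upd _ _ (EU _ vE)) ?Yy.
Qed.

End Game.

(** * Strong sets, cycles and spanning trees in them *)

Section StrongSets.
Variables (V : finType) (G : sdigraph V).
Implicit Types (E D C N : {set V}) (u v k : V) (e : V * V * bool).
Implicit Types (a s : seq (V * V * bool)) (z : config V).

(* Strong connectedness of [E]: every nonempty part is entered from the rest of [E]. *)
Definition strong E :=
  forall D, D \subset E -> D != set0 -> closed_in G E D -> D = E.

Lemma strong_entry E C : strong E -> C \subset E -> C != set0 -> C != E ->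
  exists e, [/\ e \in G, arc_tgt e \in C, arc_src e \in E & arc_src e \notin C].
Proof.
move=> sE sC C0 CE; apply/closed_inPn; apply: contra CE => cC.
by apply/eqP; apply: sE.
Qed.

Lemma strong_exit E D : strong E -> D \subset E -> D != set0 -> D != E ->
  exists e, [/\ e \in G, arc_src e \in D, arc_tgt e \in E & arc_tgt e \notin D].
Proof.
move=> sE sD D0 DE; have [|||e [eG]] := @strong_entry E (E :\: D) sE.
- exact: subsetDl.
- by rewrite setD_eq0; apply: contra DE => ED; rewrite eqEsubset sD.
- apply: contraNneq D0 => h; apply/eqP/setP=> u; rewrite inE; apply/negP=> uD.
  by move: (subsetP sD _ uD); rewrite -h inE uD.
rewrite !inE => /andP[tD tE] sE'; rewrite sE' andbT negbK => sD'.
by exists e.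
Qed.

Lemma ancestor_closed E C u v : closed_in G E C -> E = setT -> connect (adj G) u v ->
  v \in C -> u \in C.
Proof.
move=> cC ET /connectP[p]; elim: p u => [|w p IHp] u /=; first by move=> _ ->.
case/andP=> /existsP[b eG] pw lw vC; have {}IHp := IHp _ pw lw vC.
by apply: (closed_inP _ _ _ cC) eG _ _ => //; rewrite ET inE.
Qed.

Lemma connect_walk u v : connect (adj G) u v ->
  exists a, [/\ is_walk G u a, last u (tgts a) = v & uniq (u :: tgts a)].
Proof.
case/connectP=> p0 pp0 ->; case/shortenP: pp0 => p pp up _ {p0}.
suff [a wa ta] : exists2 a, is_walk G u a & tgts a = p by exists a; rewrite ta.
elim: p u pp {up} => [|w p IHp] u /=; first by exists [::].
case/andP=> /existsP[b eG] pw; have [a wa ta] := IHp w pw.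
exists ((u, w, b) :: a); last by rewrite /= ta.
by rewrite /= eqxx eG.
Qed.

Lemma strong_connect E u v : strong E -> u \in E -> v \in E ->
  connect (adj (restrict G E)) u v.
Proof.
move=> sE uE vE; pose D := [set w in E | connect (adj (restrict G E)) w v].
suff DE : D = E.
  by have uD : u \in D; [rewrite DE | move: uD; rewrite inE => /andP[]].
apply: sE; first by apply/subsetP=> w; rewrite inE => /andP[].
  by apply/set0Pn; exists v; rewrite inE vE connect0.
apply/closed_inP=> -[[k w] b] eG; rewrite !inE /= => /andP[wE cw] kE.
rewrite kE; apply: connect_trans cw; apply: connect1; apply/existsP; exists b.
by rewrite in_restrict eG kE.
Qed.

(** Iterating [arc_tgt (g v)] must revisit a vertex; taking the least period makes the vertices on
    the cycle distinct. *)
Lemma function_cycle (g : V -> V * V * bool) N : N != set0 ->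
  (forall v, v \in N -> [/\ g v \in G, arc_src (g v) = v & arc_tgt (g v) \in N]) ->
  exists u a, [/\ u \in N, is_cycle G u a & forall e, e \in a -> arc_src e \in N /\ e = g (arc_src e)].
Proof.
move=> /set0Pn[x0 x0N] gN; pose nxt v := arc_tgt (g v).
have itN n v : v \in N -> iter n nxt v \in N.
  by move=> vN; elim: n => // n /gN[].
have walk n v : v \in N -> is_walk G v (map g (traject nxt v n)) /\
    last v (tgts (map g (traject nxt v n))) = iter n nxt v.
  elim: n v => // n IHn v vN; have [gG sg tg] := gN _ vN.
  by rewrite iterSr /= sg eqxx gG; apply: IHn.
have : ~~ uniq (traject nxt x0 #|V|.+1).
  by apply/negP=> /card_uniqP; rewrite size_traject => h; have := max_card [in traject nxt x0 #|V|.+1]; rewrite h ltnn.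
rewrite looping_uniq negbK => /trajectP[i lti eqi].
pose y := iter i nxt x0; have yN : y \in N by apply: itN.
have per : exists m, (0 < m) && (iter m nxt y == y).
  by exists (#|V| - i); rewrite subn_gt0 lti /y -iterD subnK ?(ltnW lti) // eqi eqxx.
case: (ex_minnP per) => -[//|k] /andP[_ /eqP ky] mink.
have un : uniq (traject nxt y k.+1).
  rewrite looping_uniq; apply/negP=> /trajectP[j ltj ej].
  have := mink j.+1; rewrite ltn0Sn /= -ej -iterS ky eqxx => /(_ isT).
  by rewrite ltnS leqNgt ltj.
exists y, (map g (traject nxt y k.+1)); have [wy ly] := walk k.+1 y yN.
split=> //; last first.
  move=> e /mapP[v /trajectP[j _ ->] ->]; have [_ -> _] := gN _ (itN j _ yN).
  by split=> //; apply: itN.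
rewrite /is_cycle wy ly ky eqxx /=.
rewrite -map_comp -[map _ _]/(map nxt (traject nxt (nxt y) k)).
have -> : map nxt (traject nxt (nxt y) k) = traject nxt (nxt (nxt y)) k.
  by elim: k (nxt y) {ky mink un wy ly} => //= k IHk v; rewrite IHk.
have : uniq (traject nxt (nxt y) k.+1).
  by rewrite trajectSr rcons_uniq -iterSr ky; move: un; rewrite trajectS.
by [].
Qed.

Definition matched z e := arc_sign e == (z (arc_src e) == z (arc_tgt e)).

Lemma sgn_matched z u a : is_walk G u a -> all (matched z) a ->
  sgn a = (z u == z (last u (tgts a))).
Proof.
elim: a u => [|e a IHa] u; first by rewrite /= eqxx.
move=> /= /andP[/andP[/eqP <- _] wa] /andP[/eqP me ma].
rewrite sgn_cons (IHa _ wa ma) me.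
by case: (z _); case: (z _); case: (z _).
Qed.

(** If every vertex of [N] had a matched out-arc into [N], following these arcs would close a cycle,
    and it would be positive because signs of matched arcs telescope. *)
Lemma matched_positive_cycle z N : positive_cycle_free G -> N != set0 ->
  exists2 v, v \in N & forall e, e \in G -> arc_src e = v -> arc_tgt e \in N ->
    ~~ matched z e.
Proof.
move=> pcf N0; apply: NNPP => no.
have out v : v \in N -> exists e, [&& e \in G, arc_src e == v, arc_tgt e \in N & matched z e].
  move=> vN; apply: NNPP => no'; apply: no; exists v => // e eG se te.
  by apply/negP=> me; apply: no'; exists e; rewrite eG se eqxx te.
pose g v := odflt (v, v, true)
  [pick e | [&& e \in G, arc_src e == v, arc_tgt e \in N & matched z e]].
have gP v : v \in N -> [&& g v \in G, arc_src (g v) == v, arc_tgt (g v) \in N & matched z (g v)].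
  by move/out=> [e eP]; rewrite /g; case: pickP => [//|/(_ e)]; rewrite eP.
have [|u [a [uN ca ga]]] := function_cycle (g := g) N0.
  by move=> v /gP/and4P[-> /eqP -> ->].
apply: pcf; exists u, a; rewrite ca /=; case/and4P: ca => _ wa /eqP la _.
rewrite (sgn_matched wa (z := z)) ?la ?eqxx //.
by apply/allP=> e /ga[/gP/and4P[_ _ _ ?] ->].
Qed.

(** An out-forest with roots [D], its arcs listed in order of growth: playing their targets in turn
    propagates values away from [D]. *)
Fixpoint tree E D s : bool :=
  if s is e :: s' then
    [&& e \in G, arc_src e \in D, arc_tgt e \in E, arc_tgt e \notin D &
        tree E (arc_tgt e |: D) s']
  else true.

Lemma tree_exists E D : strong E -> D \subset E -> D != set0 ->
  exists s, [/\ tree E D s, size s = #|E :\: D| &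
    forall v, v \in E -> (v \in D) || (v \in tgts s)].
Proof.
move=> sE; move: {2}#|E :\: D| (erefl #|E :\: D|) => n; elim: n D => [|n IHn] D En sD D0.
  exists [::]; split=> // v vE; apply/orP; left.
  by move/eqP: En; rewrite cards_eq0 setD_eq0 => /subsetP; apply.
have DE : D != E by apply: contra_eq_neq En => ->; rewrite setDv cards0.
have [e [eG sD' tE tD]] := strong_exit sE sD D0 DE.
have [| | |s [ts ss cs]] := IHn (arc_tgt e |: D).
- apply/eqP; rewrite -eqSS -En (cardsD1 (arc_tgt e) (E :\: D)) !inE tE tD /= eqSS.
  by apply/eqP; congr #|pred_of_set _|; apply/setP=> v; rewrite !inE negb_or andbA.
- by apply/subsetP=> v /setU1P[->//|/(subsetP sD)].
- by apply/set0Pn; exists (arc_tgt e); rewrite !inE eqxx.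
exists (e :: s); split.
- by rewrite /= eG sD' tE tD.
- rewrite /= ss (cardsD1 (arc_tgt e) (E :\: D)) !inE tE tD /= add1n; congr _.+1.
  by congr #|pred_of_set _|; apply/setP=> v; rewrite !inE negb_or andbA.
move=> v /cs; rewrite !inE => /orP[/orP[->|->]|->]; rewrite ?orbT //.
Qed.

Lemma strong_in E u : strong E -> u \in E -> E != [set u] ->
  exists e, [/\ e \in G, arc_tgt e = u, arc_src e \in E & arc_src e != u].
Proof.
move=> sE uE Eu; have [|||e [eG]] := @strong_entry E [set u] sE.
- by rewrite sub1set.
- by apply/set0Pn; exists u; rewrite inE.
- by rewrite eq_sym.
by rewrite !inE => /eqP te sE' se; exists e.
Qed.

(** Follow out-arcs inside [E] until a cycle closes. In-arcs being unique, the vertices of this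
    cycle form a closed set, which is all of [E] by strength. *)
Lemma strong_induces_cycle E : strong E -> E != set0 ->
  (forall v, v \in E -> exists e, [/\ e \in G, arc_tgt e = v & arc_src e \in E]) ->
  (forall e e', e \in G -> e' \in G -> arc_src e \in E -> arc_src e' \in E ->
     arc_tgt e \in E -> arc_tgt e = arc_tgt e' -> e = e') ->
  induces_cycle G E.
Proof.
move=> sE E0 inE1 unE.
have out v : v \in E -> exists e, [&& e \in G, arc_src e == v & arc_tgt e \in E].
  move=> vE; have [Ev|Ev] := eqVneq E [set v].
    have [e [eG te se]] := inE1 _ vE; exists e; rewrite eG te vE andbT /=.
    by move: se; rewrite Ev inE.
  have [|||e [eG]] := @strong_exit E [set v] sE.
  - by rewrite sub1set.
  - by apply/set0Pn; exists v; rewrite inE.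
  - by rewrite eq_sym.
  by rewrite inE => /eqP se tE _; exists e; rewrite eG se eqxx.
pose g v := odflt (v, v, true) [pick e | [&& e \in G, arc_src e == v & arc_tgt e \in E]].
have gP v : v \in E -> [&& g v \in G, arc_src (g v) == v & arc_tgt (g v) \in E].
  by move/out=> [e eP]; rewrite /g; case: pickP => [//|/(_ e)]; rewrite eP.
have [|u [a [uE ca ga]]] := function_cycle (g := g) E0.
  by move=> v /gP/and3P[-> /eqP -> ->].
have aE e : e \in a -> [/\ e \in G, arc_src e \in E & arc_tgt e \in E].
  by case/ga=> sE' ee; have := gP _ sE'; rewrite -ee => /and3P[].
have srcin e : e \in a -> arc_src e \in tgts a.
  case/and4P: ca => an wa /eqP la _ ea.
  have : arc_src e \in u :: tgts a by rewrite (walk_sources wa) mem_rcons inE map_f ?orbT.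
  rewrite inE => /predU1P[->|//]; rewrite -{1}la.
  by case: (a) an => // e' a' _; exact: (mem_last (arc_tgt e') (tgts a')).
have cE : [set arc_tgt e | e in a] = E.
  apply: sE.
  - by apply/subsetP=> v /imsetP[e /aE[_ _ ?] ->].
  - case/and4P: ca; case: (a) => // e a' _ _ _ _; apply/set0Pn; exists (arc_tgt e).
    by apply: imset_f; rewrite inE eqxx.
  apply/closed_inP=> e eG /imsetP[e' e'a te] sE'.
  have [e'G se' te'] := aE _ e'a.
  have {e'a}ea : e \in a by rewrite (unE e e') // te.
  by have /mapP[e2 e2a ->] := srcin _ ea; apply: imset_f.
exists u, a; split=> // e eG sE' tE.
move: tE; rewrite -cE => /imsetP[e' e'a te].
have [e'G se' te'] := aE _ e'a.
by rewrite (unE e e') // te.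
Qed.

Lemma strong_component E : strong E -> E != set0 -> closed_in G setT E ->
  is_strong_component G E.
Proof.
move=> sE /set0Pn[v vE] cE; exists v; apply/setP=> u; rewrite inE.
have sub k1 k2 : connect (adj (restrict G E)) k1 k2 -> connect (adj G) k1 k2.
  apply: connect_sub => k k' /existsP[c]; rewrite in_restrict => /and3P[kG _ _].
  by apply: connect1; apply/existsP; exists c.
apply/idP/andP=> [uE|[uv _]]; last exact: ancestor_closed cE erefl uv vE.
by split; apply: sub; apply: strong_connect.
Qed.

End StrongSets.

(** * A vertex with a value that is bad for none of its out-neighbours *)

Section SpecialVertex.
Variables (V : finType) (r : V -> bool) (G : sdigraph V) (E : {set V}).
Implicit Types (D : {set V}) (u v i c : V) (e : V * V * bool).
Implicit Types (es : seq (V * V * bool)) (z : config V).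

Definition multi v := [exists e1 in G, exists e2 in G,
  [&& arc_tgt e1 == v, arc_tgt e2 == v & arc_src e1 != arc_src e2]].

Lemma multiP v : reflect (exists e1 e2, [/\ e1 \in G, e2 \in G, arc_tgt e1 = v,
   arc_tgt e2 = v & arc_src e1 != arc_src e2]) (multi v).
Proof.
apply: (iffP exists_inP) => [[e1 e1G /exists_inP[e2 e2G /and3P[/eqP ? /eqP ? ?]]]|].
  by exists e1, e2.
case=> e1 [e2 [? ? t1 t2 ne]]; exists e1 => //; apply/exists_inP; exists e2 => //.
by rewrite t1 t2 !eqxx.
Qed.

Definition simple_arcs := forall e e', e \in G -> e' \in G ->
  arc_src e = arc_src e' -> arc_tgt e = arc_tgt e' -> e = e'.

Lemma single_in e e' : simple_arcs -> e \in G -> e' \in G -> ~~ multi (arc_tgt e) ->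
  arc_tgt e' = arc_tgt e -> e' = e.
Proof.
move=> sG eG e'G nm te; apply: sG => //; apply/eqP; apply: contraNT nm => ne.
by apply/multiP; exists e', e.
Qed.

Hypotheses (pcf : positive_cycle_free G) (sG : simple_arcs) (sE : strong G E).
Hypothesis inE1 : forall e, e \in G -> (arc_src e \in E) && (arc_tgt e \in E).

Definition chain i c es := [/\ is_walk G i es, last i (tgts es) = c,
  uniq (i :: tgts es) & forall e, e \in es -> ~~ multi (arc_tgt e)].

(** A partial valuation: a vertex with several in-neighbours gets the value that can be forced on
    it, any other one copies what its only in-arc transmits. The last clause keeps a chain back to a
    vertex of the first kind. *)
Definition grown D z :=
  [/\ D \subset E,
      forall v, v \in E -> multi v -> v \in D /\ z v = r v,
      forall e, e \in G -> arc_tgt e \in D -> ~~ multi (arc_tgt e) ->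
        arc_src e \in D /\ matched z e &
      forall v, v \in D -> exists i es, [/\ multi i, i \in D, chain i v es &
        forall e, e \in es -> arc_tgt e \in D]].

Lemma grown_total D z : D != set0 -> grown D z -> exists z', grown E z'.
Proof.
move: {2}#|E :\: D| (erefl #|E :\: D|) => n; elim: n D z => [|n IHn] D z En D0.
  move/eqP: En; rewrite cards_eq0 setD_eq0 => sED gD; exists z.
  suff -> : E = D by [].
  by apply/eqP; rewrite eqEsubset sED; case: gD.
case=> sD mD wD cD.
have DE : D != E by apply: contra_eq_neq En => ->; rewrite setDv cards0.
have [e [eG sD' tE tD]] := strong_exit sE sD D0 DE.
set v := arc_tgt e in tE tD.
have nv : ~~ multi v by apply: contra tD => mv; case: (mD v tE mv).
have Dv u : u \in D -> u != v by move=> uD; apply: contraNneq tD => <-.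
pose z' := set_at z v (arc_sign e == z (arc_src e)).
have zD u : u \in D -> z' u = z u by move=> /Dv; apply: set_at_neq.
apply: (IHn (v |: D) z').
- apply/eqP; rewrite -eqSS -En (cardsD1 v (E :\: D)) !inE tE tD /= eqSS.
  by apply/eqP; congr #|pred_of_set _|; apply/setP=> u; rewrite !inE negb_or andbA.
- by apply/set0Pn; exists v; rewrite !inE eqxx.
split.
- by apply/subsetP=> u /setU1P[->//|/(subsetP sD)].
- move=> u uE mu; have [uD zu] := mD u uE mu.
  by rewrite zD // !inE uD orbT.
- move=> e' e'G; rewrite in_setU1 => /predU1P[te|te] ne.
    have -> : e' = e by apply: single_in.
    split; first by rewrite !inE sD' orbT.
    rewrite /matched zD // set_at_eq; case: (arc_sign e); by case: (z _).
  have [se me] := wD e' e'G te ne; split; first by rewrite !inE se orbT.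
  by rewrite /matched !zD.
move=> u /setU1P[->|uD].
  have [i [es [mi iD [wes les ues nes] esD]]] := cD _ sD'.
  exists i, (rcons es e); split=> //.
  - by rewrite !inE iD orbT.
  - split.
    + by rewrite -cats1 is_walk_cat wes les /= eqxx eG.
    + by rewrite map_rcons last_rcons.
    + rewrite map_rcons -rcons_cons rcons_uniq ues andbT inE negb_or -/v.
      rewrite eq_sym Dv //=; apply/mapP=> -[e' /esD e'D ev].
      by rewrite -ev (negPf tD) in e'D.
    + by move=> e'; rewrite mem_rcons inE => /predU1P[->//|/nes].
  - move=> e'; rewrite mem_rcons inE => /predU1P[->|/esD e'D].
      by rewrite !inE eqxx.
    by rewrite !inE e'D orbT.
have [i [es [mi iD ch esD]]] := cD _ uD.
exists i, es; split=> //; first by rewrite !inE iD orbT.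
by move=> e' /esD e'D; rewrite !inE e'D orbT.
Qed.

(** Take for [c] a vertex without matched out-arcs for a total valuation [z], and [s = z c]. Arcs
    into vertices with one in-neighbour are matched, so all out-neighbours of [c] have several;
    there [z] equals [r], and unmatched means not bad. *)
Lemma special_vertex : (exists2 v, v \in E & multi v) ->
  exists c s i es, [/\ c \in E, i \in E, multi i, chain i c es & sgn es = (r i == s)] /\
    (forall e, e \in G -> arc_src e = c -> multi (arc_tgt e) /\ s != bad r e).
Proof.
case=> v0 v0E mv0; pose D := [set v in E | multi v].
have D0 : D != set0 by apply/set0Pn; exists v0; rewrite inE v0E.
have [|z [_ mE wE cE]] := @grown_total D [ffun v => r v] D0.
  split.
  - by apply/subsetP=> u; rewrite inE => /andP[].
  - by move=> u uE mu; rewrite ffunE inE uE.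
  - by move=> e _; rewrite inE => /andP[_ ->].
  - move=> u uD; exists u, [::]; split=> //; move: uD; rewrite inE => /andP[//].
have E0 : E != set0 by apply/set0Pn; exists v0.
have [c cin nc] := matched_positive_cycle z pcf E0.
have [i [es [mi iE ch esE]]] := cE _ cin.
exists c, (z c), i, es; split; last first.
  move=> e eG se; have /andP[_ tE] := inE1 eG; have nm := nc e eG se tE.
  have mt : multi (arc_tgt e).
    by apply: contraT => nmt; have [_] := wE e eG tE nmt; rewrite (negPf nm).
  split=> //; have [_ zt] := mE _ tE mt.
  by rewrite bad_matched -zt -se.
split=> //; case: ch => wes les _ nes; have [_ <-] := mE _ iE mi.
rewrite -les; apply: (sgn_matched wes); apply/allP=> e ee.
by have [] := wE e (walk_arcs wes ee) (esE _ ee) (nes _ ee).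
Qed.

End SpecialVertex.

(* Costs (letters, hard letters) of merging two configurations on [n] vertices:
   [hom] in a homogenous net, [strong] in a strong net that is not a cycle. *)
Definition hom_len n := 13 * fib n.+1 + 8 * fib n - 13.
Definition hom_hard n := 8 * fib n.+1 + 4 * fib n - 8.
Definition strong_len n := 2 * run_len n.-1 + 4 + hom_len n.-1.
Definition strong_hard n := 2 * run_hard n.-1 + 4 + hom_hard n.-1.

(** * Inequalities between the costs *)

Lemma fib_add m n : fib (m + n.+1) = fib m.+1 * fib n.+1 + fib m * fib n.
Proof.
elim: n m => [|n IHn] m; first by rewrite addn1 /= muln0 addn0 muln1.
rewrite addnS -addSn IHn fibSS (fibSS n); nia.
Qed.

Lemma run_lenE n : run_len n + 2 = 2 * fib n.+1 + fib n.
Proof.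
rewrite /run_len addn3 (fibSS n.+1) (fibSS n); have := fib_gt0 n; lia.
Qed.

Lemma run_hardE n : run_hard n + 1 = fib n.+1 + fib n.
Proof. by rewrite /run_hard addn2 (fibSS n); have := fib_gt0 n; lia. Qed.

Lemma hom_lenE n : hom_len n + 13 = 13 * fib n.+1 + 8 * fib n.
Proof. by rewrite /hom_len; have := fib_gt0 n; lia. Qed.

Lemma hom_hardE n : hom_hard n + 8 = 8 * fib n.+1 + 4 * fib n.
Proof. by rewrite /hom_hard; have := fib_gt0 n; lia. Qed.

Lemma strong_lenE n : strong_len n.+1 + 13 = 17 * fib n.+1 + 10 * fib n.
Proof. by have := run_lenE n; have := hom_lenE n; rewrite /strong_len /=; lia. Qed.

Lemma strong_hardE n : strong_hard n.+1 + 6 = 10 * fib n.+1 + 6 * fib n.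
Proof. by have := run_hardE n; have := hom_hardE n; rewrite /strong_hard /=; lia. Qed.

Lemma fib_leS n : fib n <= fib n.+1.
Proof. by case: n => // n; rewrite fibSS leq_addr. Qed.

(** With p = F(u), q = F(u+1), s = F(e-1), t = F(e), the quadratic part of the left side is 20qt +
    12qs + 10pt + 6ps and that of the right side 21qt + 13qs + 13pt + 8ps. The constants 13 and 8
    thus win coefficient by coefficient, and the surplus absorbs the linear terms. *)
Lemma hom_len_strong u e : 2 <= e ->
  hom_len u + (strong_len e + strong_hard e * run_len u) <= hom_len (u + e).
Proof.
case: e => [|[|e]] // _; have := strong_lenE e.+1; have := strong_hardE e.+1.
have := run_lenE u; have := hom_lenE u; have := hom_lenE (u + e.+2).
rewrite -addSn !fib_add (fibSS u).
have := fib_gt0 u; have := fib_gt0 e; have := fib_gt0 e.+1; have := fib_leS u.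
move: (fib u) (fib u.+1) (fib e.+1) (fib e.+2) (hom_len _) (hom_len _)
  (strong_len _) (strong_hard _) (run_len _) => p q s t L Lu A B T pq t0 s0 q0.
move=> EL ELu ET EB EA.
have BT : (B + 6) * (T + 2) = (10 * t + 6 * s) * (2 * q + p) by rewrite EB ET.
have h1 : q <= q * s by rewrite leq_pmulr.
have h2 : p <= p * s by rewrite leq_pmulr.
have h3 : p <= p * t by rewrite leq_pmulr.
have h4 : q <= q * t by rewrite leq_pmulr.
nia.
Qed.

Lemma hom_hard_strong u e : 2 <= e ->
  hom_hard u + strong_hard e * (run_hard u).+1 <= hom_hard (u + e).
Proof.
case: e => [|[|e]] // _; have := strong_hardE e.+1.
have := run_hardE u; have := hom_hardE u; have := hom_hardE (u + e.+2).
rewrite -addSn !fib_add (fibSS u).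
have := fib_gt0 u; have := fib_gt0 e; have := fib_gt0 e.+1; have := fib_leS u.
move: (fib u) (fib u.+1) (fib e.+1) (fib e.+2) (hom_hard _) (hom_hard _)
  (strong_hard _) (run_hard _) => p q s t L Lu B T pq t0 s0 q0 EL ELu ET EB.
have BT : (B + 6) * T.+1 = (10 * t + 6 * s) * (q + p) by rewrite EB -ET addn1.
(* The quadratic parts are now 10qt + 10pt + 6qs + 6ps and 12qt + 8pt + 8qs + 4ps: the deficit in
   [p] is covered by the surplus in [q], because [p <= q]. *)
have h : p * (t + s) + q <= q * (t + s) + p by clear -pq t0 s0; nia.
clear -EL ELu ET EB BT h; nia.
Qed.

Lemma leq_fib_sum e : e.+1 <= 2 * fib e.+1 + fib e - 1.
Proof.
suff : e.+2 <= 2 * fib e.+1 + fib e by have := fib_gt0 e; lia.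
by elim: e => // e IHe; rewrite (fibSS e); have := fib_gt0 e; lia.
Qed.

(** Budget for a cycle of [e] vertices: at most [e] letters, each preceded by a run through the [u]
    vertices upstream. *)
Lemma hom_len_cycle u e : 1 <= e ->
  hom_len u + e * (run_len u).+1 <= hom_len (u + e).
Proof.
case: e => // e _; have := leq_fib_sum e.
have := run_lenE u; have := hom_lenE u; have := hom_lenE (u + e.+1).
rewrite -addSn !fib_add (fibSS u).
have := fib_gt0 u; have := fib_gt0 e.
move: (fib u) (fib u.+1) (fib e) (fib e.+1) (hom_len _) (hom_len _) (run_len _)
  => p q s t L Lu T t0 q0 EL ELu ET le.
have h : e.+1 * (T + 2) <= (2 * t + s - 1) * (2 * q + p) by rewrite ET leq_mul2r le orbT.
have h3 : p <= p * t by rewrite leq_pmulr.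
have h4 : q <= q * t by rewrite leq_pmulr.
have : (2 * t + s - 1) * (2 * q + p) + (2 * q + p) = (2 * t + s) * (2 * q + p).
  by rewrite -mulSnr; congr (_ * _); lia.
clear -EL ELu ET h h3 h4; nia.
Qed.

Lemma hom_hard_cycle u e : 1 <= e ->
  hom_hard u + e * (run_hard u).+1 <= hom_hard (u + e).
Proof.
case: e => // e _; have := leq_fib_sum e.
have := run_hardE u; have := hom_hardE u; have := hom_hardE (u + e.+1).
rewrite -addSn !fib_add (fibSS u).
have := fib_gt0 u; have := fib_gt0 e.
move: (fib u) (fib u.+1) (fib e) (fib e.+1) (hom_hard _) (hom_hard _) (run_hard _)
  => p q s t L Lu T t0 q0 EL ELu ET le.
have h : e.+1 * T.+1 <= (2 * t + s - 1) * (q + p) by rewrite -ET addn1 leq_mul2r le orbT.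
have h3 : p <= p * t by rewrite leq_pmulr.
have h4 : q <= q * t by rewrite leq_pmulr.
have : (2 * t + s - 1) * (q + p) + (q + p) = (2 * t + s) * (q + p).
  by rewrite -mulSnr; congr (_ * _); lia.
clear -EL ELu ET h h3 h4; nia.
Qed.

Lemma hom_len_mono m n : m <= n -> hom_len m <= hom_len n.
Proof.
move=> /subnKC <-; case: (n - m) => [|k]; first by rewrite addn0.
by apply: leq_trans (hom_len_cycle _ _) => //; rewrite leq_addr.
Qed.

Lemma hom_hard_mono m n : m <= n -> hom_hard m <= hom_hard n.
Proof.
move=> /subnKC <-; case: (n - m) => [|k]; first by rewrite addn0.
by apply: leq_trans (hom_hard_cycle _ _) => //; rewrite leq_addr.
Qed.

Lemma run_len_add k m : 0 < k -> run_len k + 2 * m <= run_len (k + m).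
Proof.
move=> k0; elim: m => [|m IHm]; first by rewrite muln0 !addn0.
rewrite addnS; case: k k0 IHm => // k _ IHm.
by have := run_lenSS (k + m); rewrite -!addSn; lia.
Qed.

Lemma run_len_ge m : 3 * m <= 2 * run_len m + 2.
Proof.
by elim: m => // -[|m] IHm //; rewrite run_lenSS; have := run_lenS m; lia.
Qed.

Lemma run_hard_ge m : 2 * m <= run_hard m.+1.
Proof.
elim: m => // -[|m] IHm //; rewrite run_hardSS.
by have := run_hardS m; lia.
Qed.

Lemma run_hard_ge' m : 3 * m <= 2 * run_hard m + 3.
Proof.
elim: m => // -[|[|m]] IHm //; rewrite run_hardSS.
by have := run_hardS m; lia.
Qed.

Lemma run_hard_add k m : 1 < k -> run_hard k + 2 * m <= run_hard (k + m).
Proof.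
move=> k1; elim: m => [|m IHm]; first by rewrite muln0 !addn0.
rewrite addnS; case: k k1 IHm => [|[|k]] // _ IHm.
have -> : run_hard (k.+2 + m).+1 = run_hard (k.+2 + m) + run_hard (k.+1 + m) + 1.
  by rewrite addSn run_hardSS.
by have := run_hardS (k + m); rewrite -addSn; lia.
Qed.

(* [m] is the length of the chain from [i] to [c], [k] the number of vertices off
   the chain, and [b] the total size of the initial cycles of the net without [c]. *)
Lemma strong_len_plain k m : 3 * m + 2 * run_len k + 2 <= 2 * run_len (k + m) + 4.
Proof.
case: k => [|k]; first by rewrite add0n (_ : run_len 0 = 0) //; have := run_len_ge m; lia.
by have := @run_len_add k.+1 m isT; lia.
Qed.

Lemma strong_hard_plain k m : 3 * m + 2 * run_hard k + 1 <= 2 * run_hard (k + m) + 4.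
Proof.
case: k => [|[|k]]; first by rewrite add0n (_ : run_hard 0 = 0) //; have := run_hard_ge' m; lia.
  by have := run_hard_ge m; rewrite add1n; have : run_hard 1 = 1 by []; lia.
by have := @run_hard_add k.+2 m isT; lia.
Qed.

(** The last merging starts with the initial cycles, of total size [b], already merged, which saves
    [hom_len b]. The saving pays for three runs through them and three letters per vertex. *)
Lemma hom_len_run b : 3 * run_len b + 3 * b <= hom_len b.
Proof.
have : 3 * b + 7 <= 7 * fib b.+1 + 5 * fib b.
  by elim: b => // b IHb; rewrite (fibSS b); have := fib_gt0 b; have := fib_leS b; lia.
by have := run_lenE b; have := hom_lenE b; lia.
Qed.

Lemma hom_hard_run b : 3 * run_hard b + 3 * b <= hom_hard b + 2.
Proof.
have : 3 * b + 3 <= 5 * fib b.+1 + fib b.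
  by elim: b => // -[|b] IHb //; rewrite (fibSS b.+1); have := fib_gt0 b; have := fib_gt0 b.+1; lia.
by have := run_hardE b; have := hom_hardE b; lia.
Qed.

(** Three runs avoiding at least one vertex cost less than two full ones; this is where treating the
    initial cycles separately pays. *)
Lemma run_len_pred k : 3 * run_len k + 2 <= 2 * run_len k.+1.
Proof.
by case: k => // k; have := run_lenE k.+1; have := run_lenE k.+2; rewrite !fibSS;
  have := fib_leS k; have := fib_gt0 k; lia.
Qed.

Lemma run_hard_pred k : 3 * run_hard k + 1 <= 2 * run_hard k.+1.
Proof.
by case: k => // k; have := run_hardE k.+1; have := run_hardE k.+2; rewrite !fibSS;
  have := fib_leS k; have := fib_gt0 k; lia.
Qed.

Lemma strong_len_cycles k m b : 0 < b -> b <= k ->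
  4 * m + 3 * (run_len b + run_len (k - b)) + 3 + 3 * b <=
  2 * run_len (k + m) + 4 + hom_len b.
Proof.
move=> b0 bk; have k0 := leq_trans b0 bk; have := @run_len_add k m k0.
have := hom_len_run b; case: k bk k0 => // k bk _; have := run_len_pred k.
have : run_len (k.+1 - b) <= run_len k by apply: run_len_mono; lia.
lia.
Qed.

Lemma strong_hard_cycles k m b : 0 < b -> b <= k ->
  4 * m + 3 * (run_hard b + run_hard (k - b)) + 2 + 3 * b <=
  2 * run_hard (k + m) + 4 + hom_hard b.
Proof.
move=> b0 bk; have [k1|k1] := leqP k 1.
  have -> : k = 1 by lia.
  have -> : b = 1 by lia.
  by rewrite add1n subnn (_ : run_hard 0 = 0) // (_ : run_hard 1 = 1) //
    (_ : hom_hard 1 = 4) //; have := run_hard_ge m; lia.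
have := @run_hard_add k m k1.
have := hom_hard_run b; case: k bk k1 => // k bk _; have := run_hard_pred k.
have : run_hard (k.+1 - b) <= run_hard k by apply: run_hard_mono; lia.
lia.
Qed.

(** * Merging one component at a time *)

Section Components.
Variables (V : finType) (r : V -> bool) (G : sdigraph V) (H : {set V}).
Implicit Types (U E B C D : {set V}) (u v k p : V) (x y z : config V).
Implicit Types (e : V * V * bool) (s : seq (V * V * bool)).

Definition cyclic_in E := [forall v in E, ~~ multi (restrict G E) v].

Lemma cyclic_inP E : reflect (forall v, v \in E -> ~~ multi (restrict G E) v) (cyclic_in E).
Proof. exact: forall_inP. Qed.

Lemma simple_arcs_restrict E : simple_arcs G -> simple_arcs (restrict G E).
Proof. by move=> sG e e' /restrict_sub eG /restrict_sub; apply: sG. Qed.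

Lemma agreeU U E x y : agree U x y -> agree E x y -> agree (U :|: E) x y.
Proof. by move=> aU aE k; rewrite in_setU => /orP[/aU|/aE]. Qed.

Lemma rotate_tree E D s x y : simple_arcs G -> cyclic_in E ->
  tree (restrict G E) E D s -> agree D x y ->
  win r (restrict G E) E
    (fun x' y' => forall k, (k \in D) || (k \in tgts s) -> x' k = y' k)
    (size s) (size s) x y.
Proof.
move=> sG /cyclic_inP cE; elim: s D x y => [|e s IHs] D x y /=.
  by move=> _ aD; apply: win_done => k; rewrite orbF; apply: aD.
case/and5P=> eG sD tE tD ts aD; apply: (win_hard tE).
apply: win_impl (IHs _ _ _ ts _) => [x' y' h k kD|k].
  by apply: h; move: kD; rewrite !inE; case: (k \in D); case: eqP; rewrite ?orbT.
have [->|kt] := eqVneq k (arc_tgt e).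
  move=> _; rewrite !upd_val (@eq_hit _ _ _ x y) // => e' e'G te.
  by rewrite (single_in (simple_arcs_restrict sG) eG e'G) ?cE // aD.
by rewrite !inE (negPf kt) /= => kD; rewrite !upd_out // aD.
Qed.

Lemma strong_restrict E : strong G E -> strong (restrict G E) E.
Proof.
move=> stE D sD D0 cD; apply: stE => //; apply/closed_inP=> e eG tD sE'.
by apply: (closed_inP _ _ _ cD); rewrite // in_restrict eG sE' (subsetP sD).
Qed.

(** Agreement spreads from [p] along a tree, each further vertex copying its only in-neighbour. *)
Lemma cyclic_merge E p x y : simple_arcs G -> strong G E -> cyclic_in E ->
  p \in E -> x p = y p ->
  win r (restrict G E) E (agree E) #|E|.-1 #|E|.-1 x y.
Proof.
move=> sG stE cyc pE xyp.
have [|||s [ts ss cs]] := @tree_exists _ (restrict G E) E [set p].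
- exact: strong_restrict.
- by rewrite sub1set.
- by apply/set0Pn; exists p; rewrite inE.
have Es : #|E|.-1 = size s.
  by rewrite ss (cardsD1 p E) pE /=; congr #|pred_of_set _|; apply/setP=> k; rewrite !inE.
rewrite Es; apply: win_impl (rotate_tree sG cyc ts _) => [x1 y1 h k kE|k /set1P->//].
exact/h/cs.
Qed.

(** For the whole network [H] is [setT]. In a strong net [H] is [E :\ c], and [c] has the neutral
    value [s] in both configurations. *)
Definition merged_outside x y := forall e, e \in G -> arc_tgt e \in H ->
  arc_src e \notin H -> x (arc_src e) = y (arc_src e) /\ x (arc_src e) != bad r e.

(** A cycle that nothing enters can only be merged from a vertex of agreement; anchors replace the
    absence of initial cycles. *)
Definition anchored B x y := exists2 p, p \in B & x p = y p.

Definition initial_cyclic B :=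
  [/\ B \subset H, B != set0, closed_in G H B, strong G B & cyclic_in B].

Hypotheses (pcf : positive_cycle_free G) (sG : simple_arcs G).
Hypothesis in_arc : forall u, u \in H ->
  exists e, [/\ e \in G, arc_tgt e = u & arc_src e \in H].
(** Homogeneity in the form that runs require. It comes from [homogenous] for the whole net, and
    from negative cycles through [c] in a strong net. *)
Hypothesis good : forall U v C, U \subset H -> closed_in G H U -> v \in H ->
  v \notin U -> C \subset U -> C != set0 -> closed_in G U C ->
  exists2 p, p \in C & constant_sign G U p v.
Hypothesis strong_merge : forall E, E \subset H -> strong G E -> ~~ cyclic_in E ->
  forall x y, win r (restrict G E) E (agree E) (strong_len #|E|) (strong_hard #|E|) x y.

(** A run starting with nothing frozen, whose signs come from [good]. With [tau = ~~ r v] the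
    in-literals of [v] in [U] become neutral, with [tau = r v] they become bad. *)
Lemma upstream_run U v tau x y z : U \subset H -> closed_in G H U -> v \in H ->
  v \notin U -> merged_outside x y -> (forall k, k \notin H -> z k = x k) ->
  exists w, [/\ all (fun k => k \in U) w, size w <= run_len #|U|,
    hards r G w z <= run_hard #|U| &
    forall e, e \in G -> arc_tgt e = v -> arc_src e \in U ->
      arc_sign e = (upds r G w z (arc_src e) == tau)].
Proof.
move=> sU cU vH vU mo zx.
have rdy : run_ready r G U set0 U v tau z.
  split=> //.
  - by apply/closed_inP.
  - by move=> k; rewrite inE.
  - by move=> k; rewrite inE.
  - move=> e eG tU sU' _.
    have sH : arc_src e \notin H.
      by apply: contra sU' => sH; apply: (closed_inP _ _ _ cU).
    by rewrite zx //; have [] := mo e eG (subsetP sU _ tU) sH.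
  - by move=> C; apply: good.
  - move=> u uU; have [e [eG te se]] := in_arc (subsetP sU _ uU).
    exists e; split=> //; rewrite setU0.
    by apply: (closed_inP _ _ _ cU); rewrite ?te.
have [w [wU sw hw fw]] := favoring_run pcf rdy.
exists w; split=> //.
- exact: leq_trans sw (len_bound_le _ _ _ _ _).
- exact: leq_trans hw (hard_bound_le _ _ _ _ _).
move=> e eG te se; rewrite -(fw _ se [:: e]) ?simple_walk1 //.
by rewrite /sgn /=; case: arc_sign.
Qed.

Lemma component_simulate U E a b t h x y :
  U \subset H -> closed_in G H U -> E \subset H -> [disjoint U & E] ->
  closed_in G (H :\: U) E ->
  (forall v z, v \in E -> same_off (U :|: E) x z ->
     exists w, [/\ all (fun k => k \in U) w, size w <= t, hards r G w z <= h &
       forall e, e \in G -> arc_tgt e = v -> arc_src e \in U ->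
         upds r G w z (arc_src e) != bad r e]) ->
  merged_outside x y -> agree U x y ->
  win r (restrict G E) E (agree E) a b x y ->
  win r G (U :|: E) (agree (U :|: E)) (a + b * t) (b * h.+1) x y.
Proof.
move=> sU cU sE dUE cE neut mo aU wE.
have srcH e : e \in G -> arc_tgt e \in E -> arc_src e \notin U -> arc_src e \notin E ->
    arc_src e \notin H.
  move=> eG tE nU nE; apply: contra nE => sH; apply: (closed_inP _ _ _ cE) => //.
  by rewrite inE nU.
apply: win_impl (win_simulate dUE _ _ neut wE _ _ aU _ _) => //.
- move=> x' y' [[x1 [y1 [q ex ey]]] a' _ _]; apply: agreeU => // k kE.
  by rewrite -ex // -ey // q.
- move=> e eG tU sU'; have sH : arc_src e \notin H.
    by apply: contra sU' => sH; apply: (closed_inP _ _ _ cU).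
  split; first by apply: contra sH; apply: (subsetP sE).
  by have [] := mo e eG (subsetP sU _ tU) sH.
- move=> e eG tE nU nE.
  have [xy nb] := mo e eG (subsetP sE _ tE) (srcH e eG tE nU nE).
  by rewrite -xy.
Qed.

Lemma card_disjointU U E : [disjoint U & E] -> #|U :|: E| = #|U| + #|E|.
Proof. by move=> d; rewrite cardsU disjoint_setI0 // cards0 subn0. Qed.

Lemma component_merge U E x y :
  U \subset H -> closed_in G H U -> E \subset H -> [disjoint U & E] -> E != set0 ->
  closed_in G (H :\: U) E -> strong G E ->
  merged_outside x y -> agree U x y ->
  (initial_cyclic E -> anchored E x y) ->
  win r G (U :|: E) (agree (U :|: E)) (hom_len #|U :|: E| - hom_len #|U|)
    (hom_hard #|U :|: E| - hom_hard #|U|) x y.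
Proof.
move=> sU cU sE dUE E0 cE stE mo aU anch.
have e0 : 0 < #|E| by rewrite card_gt0.
have nUE v : v \in E -> v \notin U by move=> vE; rewrite (disjointFl dUE).
have fromUE e : e \in G -> arc_tgt e \in E -> arc_src e \in H ->
    (arc_src e \in U) || (arc_src e \in E).
  move=> eG tE sH; case: (boolP (arc_src e \in U)) => //= nU.
  by apply: (closed_inP _ _ _ cE) => //; rewrite inE nU.
have neut v z : v \in E -> same_off (U :|: E) x z ->
     exists w, [/\ all (fun k => k \in U) w, size w <= run_len #|U|,
       hards r G w z <= run_hard #|U| &
       forall e, e \in G -> arc_tgt e = v -> arc_src e \in U ->
         upds r G w z (arc_src e) != bad r e].
  move=> vE zx.
  have [k kH|w [wU sw hw fw]] := @upstream_run U v (~~ r v) x y z sU cU (subsetP sE _ vE) (nUE _ vE) mo.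
    apply: zx; apply: contra kH; apply: subsetP; by rewrite subUset sU.
  exists w; split=> // e eG te se.
  by rewrite not_bad_matched te; apply/eqP/fw.
rewrite card_disjointU //.
have lenc : #|E| * (run_len #|U|).+1 <= hom_len (#|U| + #|E|) - hom_len #|U|.
  by rewrite leq_subRL ?hom_len_mono ?leq_addr // hom_len_cycle.
have hardc : #|E| * (run_hard #|U|).+1 <= hom_hard (#|U| + #|E|) - hom_hard #|U|.
  by rewrite leq_subRL ?hom_hard_mono ?leq_addr // hom_hard_cycle.
(* A lone vertex without a loop: its in-literals already agree, so a single soft letter merges
   it. *)
have [/existsP[v /andP[/eqP Ev /forall_inP nin]]|nsingle] :=
    boolP [exists v, (E == [set v]) && [forall e in G, (arc_tgt e == v) ==> (arc_src e \notin E)]].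
  have vE : v \in E by rewrite Ev inE.
  have vUE : v \in U :|: E by rewrite inE vE orbT.
  have fin x' y' : (forall k, k != v -> x' k = x k) -> (forall k, k != v -> y' k = y k) ->
      x' v = y' v -> agree (U :|: E) x' y'.
    move=> ex ey ev; apply: agreeU => k; last by rewrite Ev => /set1P->.
    move=> kU; have kv : k != v by apply: contraTneq kU => ->; apply: nUE.
    by rewrite ex // ey // aU.
  apply: (@win_mono _ _ _ _ _ 1 0) => //.
    by apply: leq_trans lenc; rewrite muln_gt0 e0.
  apply: (win_soft vUE); apply: win_done; apply: fin.
  - by move=> k; apply: upd_out.
  - by move=> k; apply: upd_out.
  - rewrite !upd_val (@eq_hit _ _ _ x y) // => e eG te.
    have [sH|sH] := boolP (arc_src e \in H).
      have nE : arc_src e \notin E by have := nin e eG; rewrite te eqxx.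
      by have := fromUE e eG; rewrite te (negPf nE) orbF => /(_ vE sH)/aU.
    by have [] := mo e eG _ sH; rewrite ?te ?(subsetP sE).
  - by move=> k; apply: force_out.
  - by move=> k; apply: force_out.
  by rewrite !force_val.
(* A component that is not a cycle: its own strategy is simulated, with upstream runs before hard
   letters. *)
have [cyc|ncyc] := boolP (cyclic_in E); last first.
  have [v vE mv] : exists2 v, v \in E & multi (restrict G E) v.
    by move: ncyc; rewrite negb_forall_in => /exists_inP[v vE]; rewrite negbK; exists v.
  have e2 : 1 < #|E|.
    have /multiP[e1 [e3 [e1G e3G _ _ ne]]] := mv.
    apply/card_gt1P; exists (arc_src e1), (arc_src e3); split=> //.
      by move: e1G; rewrite in_restrict => /and3P[].
    by move: e3G; rewrite in_restrict => /and3P[].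
  apply: win_mono (component_simulate sU cU sE dUE cE neut mo aU (strong_merge sE stE ncyc x y)).
    by rewrite leq_subRL ?hom_len_mono ?leq_addr // hom_len_strong.
  by rewrite leq_subRL ?hom_hard_mono ?leq_addr // hom_hard_strong.
have rotate p x' y' := @cyclic_merge E p x' y' sG stE cyc.
have inE1 v : v \in E -> exists e, [/\ e \in G, arc_tgt e = v & arc_src e \in E].
  move=> vE; have [Ev|Ev] := eqVneq E [set v]; last first.
    by have [e [? ? ? _]] := strong_in stE vE Ev; exists e.
  apply: NNPP => no; case/negP: nsingle; apply/existsP; exists v; rewrite Ev eqxx /=.
  apply/forall_inP=> e eG; apply/implyP=> /eqP te; apply/negP=> se.
  by apply: no; exists e; rewrite Ev.
have lenE1 : #|E|.-1 <= #|E| by rewrite leq_pred.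
(* A cycle entered from [U]: making the in-literals of [v] in [U] bad forces [v] in both
   configurations, and agreement then rotates around the cycle. *)
have [/existsP[e1 /and3P[e1G sU1 tE1]]|noU] :=
    boolP [exists e, [&& e \in G, arc_src e \in U & arc_tgt e \in E]].
  set v := arc_tgt e1 in tE1.
  have vUE : v \in U :|: E by rewrite inE tE1 orbT.
  have [//|w [wU sw hw fw]] := @upstream_run U v (r v) x y x sU cU (subsetP sE _ tE1) (nUE _ tE1) mo.
  pose I (x' y' : config V) := [/\ agree U x' y', same_off U x x' & same_off U y y'].
  have hitU x' y' u : u \in U -> I x' y' -> hit r G x' u = hit r G y' u.
    move=> uU [a' ox oy]; apply: eq_hit => e eG te.
    have [sU'|sU'] := boolP (arc_src e \in U); first exact: a'.
    rewrite ox // oy //.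
    have sH : arc_src e \notin H.
      by apply: contra sU' => sH; apply: (closed_inP _ _ _ cU); rewrite ?te.
    by have [] := mo e eG _ sH; rewrite ?te ?(subsetP sU).
  have : win r G (U :|: E) (agree (U :|: E)) (size w + (1 + (#|E|.-1 + #|E|.-1 * run_len #|U|)))
      (hards r G w x + #|E|.-1 * (run_hard #|U|).+1) x y.
    apply: (@win_word _ _ _ _ _ I).
    - move=> u x' y' /(allP wU) uU Ixy; have hh := hitU _ _ _ uU Ixy.
      case: Ixy => a' ox oy; split.
      + move=> k kU; have [->|ku] := eqVneq k u; first by rewrite !upd_val hh.
        by rewrite !upd_out ?a'.
      + by move=> k kU; rewrite (same_off_upd _ _ _ uU) ?ox.
      + by move=> k kU; rewrite (same_off_upd _ _ _ uU) ?oy.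
    - move=> u x' y' /(allP wU) uU _ [a' ox oy]; split.
      + move=> k kU; have [->|ku] := eqVneq k u; first by rewrite !force_val.
        by rewrite !force_out ?a'.
      + by move=> k kU; rewrite (same_off_force _ _ uU) ?ox.
      + by move=> k kU; rewrite (same_off_force _ _ uU) ?oy.
    - by apply/allP=> k /(allP wU) kU; rewrite inE kU.
    - by split.
    move=> y' [a' ox oy]; set x' := upds r G w x in a' ox fw *.
    have bx : x' (arc_src e1) = bad r e1.
      by apply/eqP; rewrite bad_matched; apply/eqP/fw.
    have hx : hit r G x' v by apply: hit_arc.
    have hy : hit r G y' v by apply: hit_arc; rewrite // -a'.
    have go : win r G (U :|: E) (agree (U :|: E)) (#|E|.-1 + #|E|.-1 * run_len #|U|)
        (#|E|.-1 * (run_hard #|U|).+1) (force r v x') (force r v y').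
      have off z z' : same_off U z z' -> same_off (U :|: E) z (force r v z').
        move=> oz k kUE; rewrite (same_off_force _ _ vUE) // oz //.
        by apply: contra kUE; rewrite inE => ->.
      have ox' := off _ _ ox; have oy' := off _ _ oy.
      have UEH k : k \notin H -> k \notin U :|: E.
        by apply: contra; apply: subsetP; rewrite subUset sU.
      apply: component_simulate => //.
      + move=> u z uE oz; apply: neut => // k kUE; by rewrite oz // ox'.
      + move=> e eG tH sH; rewrite ox' ?oy' ?UEH //; exact: mo.
      + move=> k kU; have kv : k != v by apply: contraTneq kU => ->; apply: nUE.
        by rewrite !force_out // a'.
      by apply: (rotate v _ _ tE1); rewrite !force_val.
    by rewrite add1n; apply: (win_soft vUE) => //; rewrite !upd_hit.
  have e1P : #|E|.-1.+1 = #|E| by rewrite prednK.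
  apply: win_mono.
    apply: leq_trans lenc; clear -sw e1P; move: (#|E|.-1) e1P => m <-.
    by rewrite mulSn mulnS; lia.
  apply: leq_trans hardc; clear -hw e1P; move: (#|E|.-1) e1P => m <-.
  by rewrite mulSn; lia.
(* A cycle entered by nothing in [H]: rotation starts from the anchor, with empty steering words. *)
have ini : initial_cyclic E.
  split=> //; apply/closed_inP=> e eG tE sH.
  have /orP[sU'|//] := fromUE e eG tE sH.
  by case/negP: noU; apply/existsP; exists e; rewrite eG sU'.
have [p pE xyp] := anch ini.
have neut0 v z : v \in E -> same_off (U :|: E) x z ->
     exists w, [/\ all (fun k => k \in U) w, size w <= 0,
       hards r G w z <= 0 & forall e, e \in G -> arc_tgt e = v -> arc_src e \in U ->
         upds r G w z (arc_src e) != bad r e].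
  move=> vE _; exists [::]; split=> // e eG te sU'.
  by case/negP: noU; apply/existsP; exists e; rewrite eG sU' te.
apply: win_mono (component_simulate sU cU sE dUE cE neut0 mo aU (rotate _ _ _ pE xyp)).
  rewrite muln0 addn0; apply: leq_trans lenc; apply: leq_trans lenE1 _.
  by rewrite leq_pmulr.
rewrite muln1; apply: leq_trans hardc; apply: leq_trans lenE1 _.
by rewrite leq_pmulr.
Qed.

(** The next component is a minimal closed part of [H :\: U]; minimality makes it strong. The costs
    telescope. *)
Lemma homogenous_merge U x y : U \subset H -> closed_in G H U ->
  merged_outside x y -> agree U x y ->
  (forall B, initial_cyclic B -> [disjoint U & B] -> anchored B x y) ->
  win r G H (agree H) (hom_len #|H| - hom_len #|U|) (hom_hard #|H| - hom_hard #|U|) x y.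
Proof.
move: {2}#|H :\: U| (leqnn #|H :\: U|) => n; elim: n U x y => [|n IHn] U x y len sU cU mo aU anch.
  have -> : H = U.
    by apply/eqP; rewrite eqEsubset sU andbT -setD_eq0 -cards_eq0 -leqn0.
  exact: win_done.
have [HU|HU] := eqVneq (H :\: U) set0.
  have -> : H = U by apply/eqP; rewrite eqEsubset sU andbT -setD_eq0 HU.
  exact: win_done.
have cHU : closed_in G (H :\: U) (H :\: U) by apply/closed_inP.
have [E [sEHU E0 cE minE]] := minimal_closed HU cHU.
have sE : E \subset H by apply: subset_trans sEHU (subsetDl _ _).
have dUE : [disjoint U & E].
  rewrite disjoint_sym; apply: disjointWl sEHU _.
  by rewrite -setI_eq0 setIDAC setDIl setDv setI0.
have stE : strong G E.
  move=> D sD D0 cD; apply: minE => //; apply/closed_inP=> e eG tD sHU.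
  apply: (closed_inP _ _ _ cD) => //; apply: (closed_inP _ _ _ cE) => //.
  exact: (subsetP sD).
have sUE : U :|: E \subset H by rewrite subUset sU.
have cUE : closed_in G H (U :|: E).
  apply/closed_inP=> e eG; rewrite !inE => /orP[tU|tE] sH.
    by rewrite (closed_inP _ _ _ cU).
  case: (boolP (arc_src e \in U)) => //= nU.
  by apply: (closed_inP _ _ _ cE) => //; rewrite inE nU.
have mono : #|U| <= #|U :|: E| /\ #|U :|: E| <= #|H|.
  by split; apply: subset_leq_card; rewrite // subsetUl.
have step := component_merge sU cU sE dUE E0 cE stE mo aU
  (fun i => anch _ i dUE).
have -> : hom_len #|H| - hom_len #|U| =
    (hom_len #|U :|: E| - hom_len #|U|) + (hom_len #|H| - hom_len #|U :|: E|).
  by have [/hom_len_mono a1 /hom_len_mono a2] := mono; clear -a1 a2; lia.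
have -> : hom_hard #|H| - hom_hard #|U| =
    (hom_hard #|U :|: E| - hom_hard #|U|) + (hom_hard #|H| - hom_hard #|U :|: E|).
  by have [/hom_hard_mono a1 /hom_hard_mono a2] := mono; clear -a1 a2; lia.
apply: win_bind (win_subset sUE (win_frame step)) _ => x' y' [a' ox oy].
apply: IHn => //.
- rewrite -ltnS; apply: leq_trans len; apply: proper_card; apply/properP; split.
    by apply: setDS; apply: subsetUl.
  have /set0Pn[v vE] := E0; exists v; first exact: (subsetP sEHU).
  by rewrite !inE vE orbT.
- move=> e eG tH sH; have nUE : arc_src e \notin U :|: E.
    by apply: contra sH; apply: (subsetP sUE).
  by rewrite ox // oy //; apply: mo.
move=> B iB dB.
have dU : [disjoint U & B] by apply: disjointWl dB; apply: subsetUl.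
have [p pB xyp] := anch B iB dU; exists p => //.
have pn : p \notin U :|: E by rewrite (disjointFl dB).
by rewrite ox // oy.
Qed.

End Components.

(** * Propagation along chains of vertices with one in-neighbour *)

Section Chains.
Variables (V : finType) (r : V -> bool) (G : sdigraph V).
Implicit Types (U E : {set V}) (u v k t : V) (x y : config V).
Implicit Types (e : V * V * bool) (es : seq (V * V * bool)).

Lemma sgn1 e : sgn [:: e] = arc_sign e.
Proof. by rewrite /sgn /=; case: arc_sign. Qed.

Lemma favors_arc s tau U k t e : e \in G -> arc_src e = k -> arc_tgt e = t ->
  favors G s tau U k t -> arc_sign e = (s == tau).
Proof. by move=> eG se te fa; rewrite -sgn1; apply: fa; apply: simple_walk1. Qed.

Lemma matched_upd x e : e \in G ->
  (forall e', e' \in G -> arc_tgt e' = arc_tgt e -> e' = e) ->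
  arc_sign e = (x (arc_src e) == upd r G (arc_tgt e) x (arc_tgt e)).
Proof.
move=> eG un; have [be|nbe] := boolP (x (arc_src e) == bad r e).
  rewrite upd_val_hit; last exact: hit_arc (eqP be).
  by apply/eqP; rewrite -bad_matched.
rewrite upd_val_free; first by apply/eqP; rewrite -not_bad_matched.
by apply: not_hit => e' e'G te; rewrite (un e').
Qed.

(** Each vertex copies its only in-neighbour, which is not changed later because the vertices of the
    chain are distinct. *)
Lemma upds_chain_matched u es x : simple_arcs G -> is_walk G u es ->
  uniq (u :: tgts es) -> (forall e, e \in es -> ~~ multi G (arc_tgt e)) ->
  forall e, e \in es -> matched (upds r G (tgts es) x) e.
Proof.
move=> sG; elim: es u x => [|e es IHes] u x //= /andP[/andP[/eqP se eG] wes] ues nes e'.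
have [nu ues'] : (u \notin arc_tgt e :: tgts es) /\ uniq (arc_tgt e :: tgts es).
  by move: ues => /andP[? ?].
rewrite inE => /predU1P[->|e'es]; last first.
  by apply: IHes wes _ _ _ e'es => // e2 e2es; apply: nes; rewrite inE e2es orbT.
move: nu; rewrite inE negb_or => /andP[nue nu].
have nt : arc_tgt e \notin tgts es by case/andP: ues'.
rewrite /matched (upds_out _ _ _ nt) upds_out ?se // upd_out // -se.
apply/eqP/matched_upd => // e2 e2G te2; apply: (single_in sG eG) => //.
by apply: nes; rewrite inE eqxx.
Qed.

Lemma chain_favors tau u es x U U' t : is_walk G u es -> uniq (u :: tgts es) ->
  (forall e, e \in es -> matched x e) -> (forall k, k \in tgts es -> k \in U) ->
  u \notin U -> U' \subset U -> (forall k, k \in tgts es -> k \notin U') ->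
  favors G (x u) tau U u t ->
  forall k, k \in u :: tgts es -> favors G (x k) tau U' k t.
Proof.
elim: es u U => [|e es IHes] u U /=.
  by move=> _ _ _ _ _ sU _ fu k; rewrite inE => /eqP->; apply: favors_sub fu.
move=> /andP[/andP[/eqP se eG] wes] ues me tU uU sU tU' fu k.
rewrite inE => /predU1P[->|kt]; first exact: favors_sub fu.
have ues' : uniq (arc_tgt e :: tgts es) by case/andP: ues.
have nt : arc_tgt e \notin tgts es by case/andP: ues'.
apply: (IHes (arc_tgt e) (U :\ arc_tgt e)) => //.
- by move=> e' e'es; apply: me; rewrite inE e'es orbT.
- move=> k' k't; rewrite !inE tU ?inE ?k't ?orbT // andbT.
  by apply: contraNneq nt => <-.
- by rewrite !inE eqxx.
- apply/subsetP=> k' k'U; rewrite !inE (subsetP sU _ k'U) andbT.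
  by apply: contraTneq k'U => ->; apply: tU'; rewrite inE eqxx.
- by move=> k' k't; apply: tU'; rewrite inE k't orbT.
apply: (favors_step eG se erefl) fu => //; first by rewrite tU // inE eqxx.
by rewrite -se; apply/eqP/me; rewrite inE eqxx.
Qed.

Lemma win_hards (A : {set V}) Q w a b x y : all (fun v => v \in A) w ->
  win r G A Q a b (upds r G w x) (upds r G w y) ->
  win r G A Q (size w + a) (size w + b) x y.
Proof.
elim: w x y => //= v w IHw x y /andP[vA wA] H; rewrite !addSn.
by apply: (win_hard vA); apply: IHw.
Qed.

End Chains.

(** * Merging in a strong net that is not a cycle *)

Section StrongMerge.
Variables (V : finType) (r : V -> bool) (G : sdigraph V) (E : {set V}).
Implicit Types (A U B C D : {set V}) (u v k p q t : V) (x y z o : config V).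
Implicit Types (e : V * V * bool) (w : seq V).

Hypotheses (pcf : positive_cycle_free G) (sG : simple_arcs G) (sE : strong G E).
Hypothesis inside : forall e, e \in G -> (arc_src e \in E) && (arc_tgt e \in E).
Hypothesis merge_smaller : forall D, D \subset E -> D != E -> strong G D ->
  ~~ cyclic_in G D ->
  forall x y, win r (restrict G D) D (agree D) (strong_len #|D|) (strong_hard #|D|) x y.

Variables (c i : V) (s : bool) (es : seq (V * V * bool)).
Hypotheses (cE : c \in E) (iE : i \in E) (mi : multi G i) (ch : chain G i c es).
Hypothesis sgn_es : sgn es = (r i == s).
Hypothesis special : forall e, e \in G -> arc_src e = c ->
  multi G (arc_tgt e) /\ s != bad r e.

Let W := tgts es.
Let H := E :\ c.
Let U0 := [set k in E | k \notin i :: W].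

Let inS e : e \in G -> arc_src e \in E. Proof. by move/inside/andP=> []. Qed.
Let inT e : e \in G -> arc_tgt e \in E. Proof. by move/inside/andP=> []. Qed.

Lemma W_sub : forall k, k \in i :: W -> k \in E.
Proof.
move=> k; rewrite inE => /predU1P[->//|/mapP[e ees ->]]; apply: inT.
by case: ch => wes _ _ _; apply: walk_arcs wes ees.
Qed.

Lemma c_in_chain : c \in i :: W.
Proof. by case: ch => _ <- _ _; apply: mem_last. Qed.

Lemma uniq_chain : uniq (i :: W). Proof. by case: ch. Qed.

Lemma U0_H : U0 \subset H.
Proof.
apply/subsetP=> k; rewrite !inE => /andP[kE nk]; rewrite kE andbT.
by apply: contraNneq nk => ->; have := c_in_chain; rewrite inE.
Qed.

Lemma card_U0 : #|E|.-1 = #|U0| + size es.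
Proof.
have := uniq_chain => /card_uniqP; rewrite /= size_map => cw.
have -> : U0 = E :\: [set k in i :: W] by apply/setP=> k; rewrite in_setD !in_set andbC.
have sW : [set k in i :: W] \subset E by apply/subsetP=> k; rewrite in_set => /W_sub.
have := cardsDS sW; have := subset_leq_card sW; rewrite cardsE cw => h1 ->.
by clear -h1; lia.
Qed.

Lemma multi_other v : multi G v -> forall k,
  exists e, [/\ e \in G, arc_tgt e = v & arc_src e != k].
Proof.
case/multiP=> e1 [e2 [e1G e2G t1 t2 ne]] k.
have [e1k|] := eqVneq (arc_src e1) k; last by exists e1.
by exists e2; rewrite -e1k eq_sym.
Qed.

Lemma in_arcE u : u \in E -> exists2 e, e \in G & arc_tgt e = u.
Proof.
move=> uE; have [Eu|Eu] := eqVneq E [set u].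
  move: iE; rewrite Eu inE => /eqP <-.
  by have [e [eG te _]] := multi_other mi c; exists e.
by have [e [eG te _ _]] := strong_in sE uE Eu; exists e.
Qed.

(** Removing [c] creates no source, as every out-neighbour of [c] has a second in-neighbour. *)
Lemma in_arcH u : u \in H -> exists e, [/\ e \in G, arc_tgt e = u & arc_src e \in H].
Proof.
rewrite !inE => /andP[uc uE]; have [e eG te] := in_arcE uE.
have [se|se] := eqVneq (arc_src e) c; last by exists e; rewrite !inE se inS.
have [mt _] := special eG se; rewrite te in mt.
by have [e' [e'G te' se']] := multi_other mt c; exists e'; rewrite !inE se' inS.
Qed.

Lemma entry_from_c C : C \subset H -> C != set0 -> closed_in G H C ->
  exists e, [/\ e \in G, arc_tgt e \in C & arc_src e = c].
Proof.
move=> sC C0 cC; have [|||e [eG tC sE' nC]] := @strong_entry _ G E C sE.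
- by apply: subset_trans sC (subsetDl _ _).
- by [].
- by apply: contraTneq cE => CE; apply/negP=> _; have := subsetP sC c; rewrite CE !inE cE eqxx => /(_ isT).
exists e; split=> //; apply/eqP; apply: contraNT nC => nc.
by apply: (closed_inP _ _ _ cC); rewrite // !inE nc.
Qed.

(** By strength [C] is entered from [c] by an arc [e]. A walk from its target to [v] is completed by
    [e] and a fixed path [R] from [v] to [c]; since [U] is closed in [H], [R] cannot enter [U], so
    the result is a cycle. It is negative, which fixes the sign of the walk. *)
Lemma goodH U v C : U \subset H -> closed_in G H U -> v \in H -> v \notin U ->
  C \subset U -> C != set0 -> closed_in G U C ->
  exists2 p, p \in C & constant_sign G U p v.
Proof.
move=> sU cU vH vU sC C0 cC.
have cHC : closed_in G H C.
  apply/closed_inP=> e eG tC sH; apply: (closed_inP _ _ _ cC) => //.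
  by apply: (closed_inP _ _ _ cU) => //; apply: (subsetP sC).
have [e [eG tC se]] := entry_from_c (subset_trans sC sU) C0 cHC.
exists (arc_tgt e) => //; have pU := subsetP sC _ tC.
have vE : v \in E by move: vH; rewrite inE => /andP[].
have [R [wR lR uR]] := connect_walk (strong_connect sE vE cE).
have {}wR : is_walk G v R.
  elim: (R) (v) wR => //= e' R' IHR v' /andP[/andP[-> e'G] wR].
  by rewrite (restrict_sub e'G); apply: IHR.
have uRc : uniq (rcons (srcs R) c) by rewrite -lR -(walk_sources wR).
have [cR uR'] : c \notin srcs R /\ uniq (srcs R) by apply/andP; rewrite -rcons_uniq.
have RU k : k \in srcs R -> k \notin U /\ k \in E.
  elim: (R) (v) vU wR cR {lR uR uRc uR' vH vE} => [//|e' R' IHR] v' v'U wR cR kR.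
  have /= /andP[/andP[/eqP se' e'G] {}wR] := wR.
  move: cR; rewrite map_cons inE negb_or => /andP[ce' cR].
  move: kR; rewrite map_cons inE => /predU1P[->|]; first by rewrite se' v'U -se' inS.
  apply: IHR wR cR; apply: contra v'U => tU; rewrite -se'.
  by apply: (closed_inP _ _ _ cU) => //; rewrite !inE eq_sym ce' inS.
have H_c k : k \in U -> k \in E :\ c by apply: (subsetP sU).
suff neg a : simple_walk G U (arc_tgt e) v a -> sgn a = (arc_sign e != sgn R).
  by move=> a b /neg-> /neg->.
case: a => // e1 a sa; have /and5P[_ wa /eqP la inU ua] := sa.
have s1 : arc_src e1 = arc_tgt e by move: wa => /= /andP[/andP[/eqP]].
have srcU k : k \in srcs (e1 :: a) -> k \in U.
  by rewrite inE => /predU1P[->|/(allP inU)//]; rewrite s1.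
have : sgn ((e :: e1 :: a) ++ R) = false.
  have cn : c \notin E :\ c by rewrite !inE eqxx.
  apply: (negative_cycle pcf cn).
  apply/and5P; split=> //.
  - rewrite is_walk_cat.
    have -> : last c (tgts (e :: e1 :: a)) = last (arc_tgt e) (tgts (e1 :: a)) by [].
    rewrite la wR andbT -[is_walk _ _ _]/((arc_src e == c) && (e \in G) && is_walk G (arc_tgt e) (e1 :: a)).
    by rewrite se eqxx eG wa.
  - rewrite map_cat last_cat.
    have -> : last c (tgts (e :: e1 :: a)) = last (arc_tgt e) (tgts (e1 :: a)) by [].
    by rewrite la lR.
  - have -> : behead (srcs ((e :: e1 :: a) ++ R)) = srcs (e1 :: a) ++ srcs R.
      by rewrite map_cat.
    apply/allP=> k; rewrite mem_cat => /orP[/srcU/H_c//|kR].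
    have [kU kE] := RU k kR; rewrite !inE kE andbT.
    by apply: contraNneq cR => <-.
  rewrite map_cat cat_uniq uR' andbT [srcs (e :: _)]/= cons_uniq -/(srcs (e1 :: a)) ua andbT.
  rewrite se; apply/andP; split.
    by apply/negP=> /srcU/H_c; rewrite !inE eqxx.
  apply/hasPn=> k kR; rewrite /= inE negb_or; apply/andP; split.
    by apply: contraNneq cR => <-.
  by apply/negP=> /srcU; have [/negPf->] := RU k kR.
rewrite sgn_cat sgn_cons; case: (sgn R); case: (sgn (e1 :: a)); by case: (arc_sign e).
Qed.

(** * Initial cycles of the net without [c] *)

(** Those through [i] are left out: they are anchored at [i] as soon as [i] is forced in both
    configurations. *)
Definition initial_cycles : {set {set V}} := [set B : {set V} |
  [&& B \subset H, B != set0, closed_in G H B, cyclic_in G B, i \notin B &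
   [forall D : {set V}, (D \subset B) ==> (D != set0) ==> closed_in G B D ==> (D == B)]]].

Let P := initial_cycles.
Let BB := cover P.

Lemma initial_cyclesP B : reflect (initial_cyclic G H B /\ i \notin B) (B \in P).
Proof.
rewrite inE; apply: (iffP and5P) => [[sB B0 cB cyc /andP[iB /forallP st]]|[[sB B0 cB st cyc] iB]].
  split=> //; split=> // D sD D0 cD.
  by apply/eqP; have := st D; rewrite sD D0 cD.
split=> //; rewrite iB; apply/forallP=> D; apply/implyP=> sD; apply/implyP=> D0.
by apply/implyP=> cD; apply/eqP; apply: st.
Qed.

Lemma initial_cycle_in_arc B q e : initial_cyclic G H B -> q \in B -> e \in G ->
  arc_tgt e = q -> arc_src e != c -> arc_src e \in B.
Proof.
case=> sB _ cB _ _ qB eG te sc; apply: (closed_inP _ _ _ cB); rewrite ?te //.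
by rewrite !inE sc inS.
Qed.

Lemma initial_cycle_single B e e' : initial_cyclic G H B -> e \in G -> e' \in G ->
  arc_tgt e \in B -> arc_tgt e' = arc_tgt e -> arc_src e \in B -> arc_src e' \in B ->
  e' = e.
Proof.
case=> _ _ _ _ /cyclic_inP cyc eG e'G tB te sB sB'.
have in1 : e \in restrict G B by rewrite in_restrict eG sB tB.
have in2 : e' \in restrict G B by rewrite in_restrict e'G sB' te tB.
exact: (single_in (simple_arcs_restrict sG) in1 in2 (cyc _ tB) te).
Qed.

Lemma initial_cycle_pred B q : initial_cyclic G H B -> q \in B ->
  exists e, [/\ e \in G, arc_tgt e = q & arc_src e \in B].
Proof.
move=> iB qB; have [sB _ _ _ _] := iB.
have [e [eG te]] := in_arcH (subsetP sB _ qB); rewrite !inE => /andP[sc _].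
by exists e; split=> //; apply: initial_cycle_in_arc iB qB eG te sc.
Qed.

(** Going back along only in-arcs from a chain vertex in [B], one would stay in [B] and reach
    [i]. *)
Lemma initial_cycle_chain B : B \in P -> forall k, k \in i :: W -> k \notin B.
Proof.
case/initial_cyclesP=> iB niB; have [wes _ _ nes] := ch.
rewrite /W; move: (i) niB wes nes; elim: (es) => [|e es' IHes] u uB /=.
  by move=> _ _ k; rewrite inE => /eqP->.
move=> /andP[/andP[/eqP se eG] wes] nes k.
rewrite inE => /predU1P[->//|]; apply: (IHes (arc_tgt e)) => //.
  apply: contra uB => tB; have [e' [e'G te' se']] := initial_cycle_pred iB tB.
  by rewrite -se -(single_in sG eG e'G (nes _ _) te') // inE eqxx.
by move=> e2 e2es; apply: nes; rewrite inE e2es orbT.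
Qed.

Lemma initial_cycle_U0 B : B \in P -> B \subset U0.
Proof.
move=> BP; apply/subsetP=> k kB; rewrite inE; apply/andP; split.
  case/initial_cyclesP: BP => -[sB _ _ _ _] _.
  by have := subsetP sB _ kB; rewrite !inE => /andP[].
by apply/negP=> /(initial_cycle_chain BP); rewrite kB.
Qed.

Lemma BB_U0 : BB \subset U0.
Proof. by apply/bigcupsP=> B; apply: initial_cycle_U0. Qed.

Lemma BB_closed : closed_in G H BB.
Proof.
apply/closed_inP=> e eG /bigcupP[B BP tB] sH; apply/bigcupP; exists B => //.
by case/initial_cyclesP: BP => -[_ _ cB _ _] _; apply: (closed_inP _ _ _ cB).
Qed.

Lemma initial_cycles_trivIset : trivIset P.
Proof.
apply/trivIsetP=> A B AP BP; apply: contraNT => nd.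
have key (A' B' : {set V}) : A' \in P -> B' \in P -> A' :&: B' != set0 -> A' :&: B' = A'.
  move=> /initial_cyclesP[[sA _ cA stA _] _] /initial_cyclesP[[_ _ cB _ _] _] AB0.
  apply: stA => //; first exact: subsetIl.
  apply/closed_inP=> e eG; rewrite !inE => /andP[tA tB] sA'; rewrite sA' /=.
  by apply: (closed_inP _ _ _ cB) => //; apply: (subsetP sA).
have AB0 : A :&: B != set0 by rewrite setI_eq0.
by rewrite -(key _ _ AP BP AB0) setIC (key _ _ BP AP) // setIC.
Qed.

(** When everything outside [U] is favourable, goodness follows from strength: each closed part has
    an entry, whose target is good by [constant_sign_step]. *)
Lemma ready_of_favors U A t tau x : U \subset E -> A \subset U -> closed_in G U A ->
  t \notin U -> U != E ->
  (forall k, k \in E :\: U -> favors G (x k) tau U k t) ->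
  run_ready r G U (E :\: U) A t tau x.
Proof.
move=> sU sA cA tU UE fK; split=> //.
- by move=> k; rewrite inE => /andP[].
- by move=> e eG _ sU'; rewrite inE sU' inS.
- move=> C sC C0 cC; have sCU := subset_trans sC sA.
  have [|||e [eG tC sE' nC]] := @strong_entry _ G E C sE.
  + exact: subset_trans sU.
  + by [].
  + by apply: contraNneq UE => CE; rewrite eqEsubset sU -CE.
  exists (arc_tgt e) => //.
  have sU' : arc_src e \notin U by apply: contra nC; apply: (closed_inP _ _ _ cC).
  apply: (constant_sign_step eG erefl erefl) (fK (arc_src e) _) => //.
    exact: (subsetP sCU).
  by rewrite inE sU'.
- move=> u uA; have uE := subsetP sU _ (subsetP sA _ uA).
  have [e eG te] := in_arcE uE; exists e; split=> //.
  by rewrite !inE inS // andbT orbN.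
Qed.

(** The run through [U0] is split into two because up to three such runs are played in the presence
    of initial cycles, while [strong_len] has room for two full ones. *)
Definition run2_len := run_len #|BB| + run_len #|U0 :\: BB|.
Definition run2_hard := run_hard #|BB| + run_hard #|U0 :\: BB|.

Lemma target_run x : (forall e, e \in es -> matched x e) ->
  exists w, [/\ all (fun k => k \in U0) w, size w <= run2_len, hards r G w x <= run2_hard &
    forall e, e \in G -> arc_tgt e = i ->
      arc_sign e = (upds r G w x (arc_src e) == ~~ x i)].
Proof.
move=> mx; have [wes les ues _] := ch.
have iU0 : i \notin U0 by rewrite !inE eqxx andbF.
have sU0 : U0 \subset E by apply/subsetP=> k; rewrite inE => /andP[].
have chain_out k : k \in E -> k \notin U0 -> k \in i :: W by move=> kE; rewrite inE kE negbK.
have fK k : k \in E :\: U0 -> favors G (x k) (~~ x i) U0 k i.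
  rewrite in_setD => /andP[nk kE]; move: (chain_out k kE nk).
  apply: (@chain_favors _ _ _ _ es _ (E :\ i) _ _ wes ues mx).
  - move=> k' k'W; rewrite !inE W_sub ?inE ?k'W ?orbT // andbT.
    by apply: contraTneq k'W => ->; case/andP: ues.
  - by rewrite !inE eqxx.
  - apply/subsetP=> k' k'U; rewrite !inE (subsetP sU0 _ k'U) andbT.
    by apply: contraTneq k'U => ->.
  - by move=> k' k'W; rewrite !inE k'W orbT andbF.
  by apply: favors_cycle => //; rewrite ?inE ?eqxx //; case: (x i).
have UE : U0 != E by apply: contraNneq iU0 => ->.
have cBB : closed_in G U0 BB.
  apply/closed_inP=> e eG tB sU; apply: (closed_inP _ _ _ BB_closed) => //.
  exact: (subsetP U0_H).
have rdy1 := ready_of_favors sU0 BB_U0 cBB iU0 UE fK.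
have [w1 [w1B sw1 hw1 fw1]] := favoring_run pcf rdy1.
set x1 := upds r G w1 x in fw1.
pose U1 := U0 :\: BB.
have sU1 : U1 \subset U0 by apply: subsetDl.
have fK1 k : k \in E :\: U1 -> favors G (x1 k) (~~ x i) U1 k i.
  rewrite in_setD in_setD negb_and negbK => /andP[/orP[kB|kU] kE]; first exact: fw1.
  rewrite /x1 (upds_out_set _ _ _ w1B).
    by apply: favors_sub sU1 _; apply: fK; rewrite in_setD kU.
  by apply: contra kU; apply: (subsetP BB_U0).
have rdy2 : run_ready r G U1 (E :\: U1) U1 i (~~ x i) x1.
  apply: ready_of_favors => //.
  - exact: subset_trans sU0.
  - by apply/closed_inP.
  - by apply: contra iU0; apply: (subsetP sU1).
  by apply: contraNneq iU0 => U1E; apply: (subsetP sU1); rewrite U1E.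
have [w2 [w2U sw2 hw2 fw2]] := favoring_run pcf rdy2.
exists (w1 ++ w2); split.
- rewrite all_cat; apply/andP; split; apply/allP=> k.
    by move/(allP w1B)/(subsetP BB_U0).
  by move/(allP w2U)/(subsetP sU1).
- rewrite size_cat leq_add //.
    exact: leq_trans sw1 (len_bound_le _ _ _ _ _).
  exact: leq_trans sw2 (len_bound_le _ _ _ _ _).
- rewrite hards_cat leq_add //.
    exact: leq_trans hw1 (hard_bound_le _ _ _ _ _).
  exact: leq_trans hw2 (hard_bound_le _ _ _ _ _).
move=> e eG te; rewrite upds_cat -/x1.
have [sU|sU] := boolP (arc_src e \in U1).
  exact: favors_arc eG erefl te (fw2 _ sU).
rewrite (upds_out_set _ _ _ w2U) //; apply: (favors_arc eG erefl te); apply: fK1.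
by rewrite in_setD sU inS.
Qed.

Lemma chain_value x : (forall e, e \in es -> matched x e) -> (x c == s) = (x i == r i).
Proof.
move=> mx; have [wes les _ _] := ch.
have := sgn_matched wes (introT allP mx); rewrite les sgn_es.
by case: (x i); case: (x c); case: (r i); case: (s).
Qed.

Lemma chain_play x :
  (forall e, e \in es -> matched (upds r G W x) e) /\ upds r G W x i = x i.
Proof.
have [wes _ ues nes] := ch; split; first by apply: upds_chain_matched sG wes ues nes.
by apply: upds_out; have := uniq_chain; rewrite cons_uniq => /andP[].
Qed.

Lemma c_nonbad e : e \in G -> arc_src e = c -> bad r e = ~~ s.
Proof. by move=> eG se; have [_] := special eG se; case: (bad r e); case: (s). Qed.

Lemma tree_tgts B D ts : tree G B D ts -> forall k, k \in tgts ts -> k \in B /\ k \notin D.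
Proof.
elim: ts D => //= e ts IHts D /and5P[_ _ tB tD tts] k.
rewrite inE => /predU1P[->//|/(IHts _ tts)[kB]]; rewrite inE negb_or => /andP[_].
by [].
Qed.

(** A vertex of [B] has one in-neighbour in [B] and possibly [c]. Unless forced by [c] it takes what
    the tree arc transmits; if forced by [c], it inherits the favour assumed for [c]. *)
Lemma tree_favors B D ts o t tau U U' : initial_cyclic G H B -> tree G B D ts ->
  D \subset B -> (forall k, k \in D -> k \notin U) ->
  (forall k, k \in B -> k \notin D -> k \in U) -> c \notin U ->
  (forall k, k \in D -> favors G (o k) tau U k t) ->
  (forall e, e \in G -> arc_src e = c -> o c = bad r e -> favors G (o c) tau U c t) ->
  U' \subset U -> (forall k, k \in tgts ts -> k \notin U') ->
  forall k, (k \in D) || (k \in tgts ts) ->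
    favors G (upds r G (tgts ts) o k) tau U' k t.
Proof.
move=> iB; have cB : c \notin B.
  by case: iB => sB _ _ _ _; apply: contra (subsetP sB c) _; rewrite !inE eqxx.
elim: ts D o U => [|e ts IHts] D o U /=.
  by move=> _ _ _ _ _ fD _ sU _ k; rewrite orbF => /fD; apply: favors_sub.
case/and5P=> eG sD tB tD tts sDB DU BU cU fD fc sU' tU'.
set q := arc_tgt e in tB tD tts *.
have qU : q \in U by apply: BU.
have cq : c != q by apply: contraNneq cB => ->.
have oc : upd r G q o c = o c by apply: upd_out.
have fq : favors G (upd r G q o q) tau (U :\ q) q t.
  have [/hitP[e' [e'G te' be']]|nh] := boolP (hit r G o q); last first.
    rewrite upd_val_free; last exact: negbTE.
    apply: (favors_step eG erefl erefl qU (DU _ sD) _ (fD _ sD)).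
    apply/eqP; rewrite -not_bad_matched; apply: contra nh => /eqP be; exact: hit_arc.
  rewrite upd_val_hit; last by apply/hitP; exists e'.
  have mm : arc_sign e' = (o (arc_src e') == r q).
    by apply/eqP; rewrite -te' -bad_matched be'.
  have [sc|sc] := eqVneq (arc_src e') c.
    apply: (favors_step e'G sc te' qU cU); first by rewrite mm sc.
    by apply: (fc e') => //; rewrite -sc.
  have sB' := initial_cycle_in_arc iB tB e'G te' sc.
  have ee : e' = e by apply: (initial_cycle_single iB eG) => //; apply: (subsetP sDB).
  by rewrite ee in mm; apply: (favors_step eG erefl erefl qU (DU _ sD) mm (fD _ sD)).
move=> k kD; apply: (IHts (q |: D) _ (U :\ q)) => //.
- by apply/subsetP=> l /setU1P[->//|/(subsetP sDB)].
- by move=> l /setU1P[->|/DU lU]; rewrite !inE ?eqxx // (negPf lU) andbF.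
- by move=> l lB; rewrite !inE negb_or => /andP[-> /(BU _ lB)->].
- by rewrite !inE (negPf cU) andbF.
- move=> l /setU1P[->//|lD]; rewrite upd_out; last by apply: contraNneq tD => <-.
  by apply: favors_sub (fD _ lD); apply: subD1set.
- move=> e' e'G se'; rewrite oc => be'.
  by apply: favors_sub (fc e' e'G se' be'); apply: subD1set.
- apply/subsetP=> l lU'; rewrite !inE (subsetP sU' _ lU') andbT.
  by apply: contraTneq lU' => ->; apply: tU'; rewrite inE eqxx.
- by move=> l lt; apply: tU'; rewrite inE lt orbT.
by move: kD; rewrite !inE orbCA orbA.
Qed.

Lemma favors_c o e U : e \in G -> arc_src e = c -> o c = bad r e -> c \notin U ->
  favors G (o c) s U c c.
Proof.
move=> eG se -> cU; rewrite (c_nonbad eG se).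
by apply: favors_cycle => //; case: (s).
Qed.

(* Closing the cycle through [c], [B], [i] and the chain shows that the in-literals
   of [i] in [B] are bad once [p] has been clamped by [c]. *)
Lemma anchored_round B p e0 ts o : B \in P -> p \in B -> e0 \in G ->
  arc_src e0 = c -> arc_tgt e0 = p -> tree G B [set p] ts ->
  (forall k, k \in B -> (k \in [set p]) || (k \in tgts ts)) -> o p = r p ->
  upds r G (tgts ts) o p = r p /\
  forall e, e \in G -> arc_src e \in B -> arc_tgt e = i ->
    upds r G (tgts ts) o (arc_src e) = bad r e.
Proof.
move=> BP pB e0G se0 te0 tts cov op; have [iB _] := initial_cyclesP _ BP.
have [sB _ _ _ _] := iB; have [wes les ues _] := ch.
split.
  rewrite upds_out //; apply/negP=> /(tree_tgts tts)[_].
  by rewrite inE eqxx.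
move=> e eG seB te; have cn : c \notin E :\ c by rewrite !inE eqxx.
have pc : p != c by have := subsetP sB _ pB; rewrite !inE => /andP[].
have fk : forall k, k \in B -> favors G (upds r G (tgts ts) o k) s (H :\: B) k c.
  move=> k /cov; apply: (@tree_favors B [set p] ts o c s ((E :\ c) :\ p)) => //.
  - by rewrite sub1set.
  - by move=> k' /set1P->; rewrite !inE eqxx.
  - by move=> k' k'B; rewrite inE => k'p; rewrite in_setD1 k'p (subsetP sB).
  - by rewrite !inE eqxx andbF.
  - move=> k' /set1P->; rewrite op.
    have fc : favors G (~~ s) s (E :\ c) c c by apply: favors_cycle => //; case: (s).
    apply: (favors_step e0G se0 te0 (subsetP sB _ pB) cn _ fc).
    by apply/eqP; rewrite -te0 -bad_matched (c_nonbad e0G se0).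
  - by move=> e' e'G se' be'; apply: (favors_c e'G se' be'); rewrite !inE eqxx andbF.
  - apply/subsetP=> k' ; rewrite in_setD => /andP[k'B k'H]; rewrite in_setD1 k'H andbT.
    by apply: contraNneq k'B => ->.
  - by move=> k' /(tree_tgts tts)[k'B _]; rewrite in_setD k'B.
have eqs : rcons (srcs es) c = i :: W by rewrite (walk_sources wes) les.
have uesc : uniq (rcons (srcs es) c) by rewrite eqs.
rewrite rcons_uniq in uesc; case/andP: uesc => ces ues'.
have srcW k : k \in srcs es -> k \in i :: W by move=> ks; rewrite -eqs mem_rcons inE ks orbT.
have := fk _ seB (e :: es) _; rewrite sgn_cons sgn_es => h.
have {}h : (r i == s) == arc_sign e = (upds r G (tgts ts) o (arc_src e) == s).
  apply: h; apply/and5P; split=> //.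
  - by rewrite /= eqxx eG te wes.
  - by rewrite /= te les.
  - apply/allP=> k ks; rewrite in_setD !inE (initial_cycle_chain BP (srcW _ ks)) /=.
    rewrite W_sub ?srcW // andbT; by apply: contraNneq ces => <-.
  rewrite /= ues' andbT; apply/negP=> /srcW/(initial_cycle_chain BP).
  by rewrite seB.
apply/eqP; rewrite bad_matched te; move: h.
by case: (upds _ _ _ _ _); case: (r i); case: (s); case: (arc_sign e).
Qed.

Lemma hit_keep B o o' : same_off B o o' ->
  (forall e, e \in G -> arc_src e \in B -> arc_tgt e = i -> o' (arc_src e) = bad r e) ->
  hit r G o i -> hit r G o' i.
Proof.
move=> so bB /hitP[e [eG te be]]; apply/hitP; exists e; split=> //.
by have [sB|sB] := boolP (arc_src e \in B); [apply: bB | rewrite so].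
Qed.

(** With [x c = ~~ s] every update of the entry [p] forces it in [x]. If [p] does not follow in [y],
    then [y c = s], and one round of [B] makes the negative cycle through [p] flip it. A final round
    makes the in-literals of [i] in [B] bad, which keeps [i] hit. *)
Lemma anchor_one B x y : B \in P -> hit r G x i -> hit r G y i -> x c = ~~ s ->
  win r G B (fun x' y' => [/\ hit r G x' i, hit r G y' i & anchored B x' y'])
    (2 * #|B|) (2 * #|B|) x y.
Proof.
move=> BP hx hy xc; have [iB _] := initial_cyclesP _ BP.
have [sB B0 cB stB cycB] := iB.
have [e0 [e0G te0 se0]] := entry_from_c sB B0 cB.
set p := arc_tgt e0 in te0.
have cnB : c \notin B by apply/negP=> /(subsetP sB); rewrite !inE eqxx.
have [||ts [tts sts cov]] := @tree_exists _ G B [set p] stB.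
- by rewrite sub1set.
- by apply/set0Pn; exists p; rewrite inE.
have szt : size (tgts ts) = #|B|.-1.
  rewrite size_map sts (cardsD1 p B) te0 /=.
  by congr #|pred_of_set _|; apply/setP=> k; rewrite !inE.
have B1 : 0 < #|B| by rewrite card_gt0.
have tB : all (fun k => k \in B) (tgts ts) by apply/allP=> k /(tree_tgts tts)[].
have tp : p \notin tgts ts by apply/negP=> /(tree_tgts tts)[_]; rewrite inE eqxx.
have fin a b o1 o2 : same_off B x o1 -> same_off B y o2 -> o1 p = r p -> o2 p = r p ->
    #|B|.-1 <= a -> #|B|.-1 <= b ->
    win r G B (fun x' y' => [/\ hit r G x' i, hit r G y' i & anchored B x' y']) a b o1 o2.
  move=> so1 so2 o1p o2p la lb.
  rewrite -(subnKC la) -(subnKC lb) -szt; apply: (win_hards tB); apply: win_done.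
  have [r1 b1] := anchored_round BP te0 e0G se0 erefl tts cov o1p.
  have [r2 b2] := anchored_round BP te0 e0G se0 erefl tts cov o2p.
  split; last by exists p; rewrite ?r1 ?r2.
    apply: hit_keep b1 hx => k kB; rewrite (upds_out_set _ _ _ tB) //.
    exact: so1.
  apply: hit_keep b2 hy => k kB; rewrite (upds_out_set _ _ _ tB) //.
  exact: so2.
have hitp o : o c = ~~ s -> hit r G o p.
  by move=> oc; apply: hit_arc => //; rewrite se0 oc (c_nonbad e0G se0).
have keep1 o : same_off B o (upd r G p o) by apply: same_off_upd.
have x1p : upd r G p x p = r p by apply/upd_val_hit/hitp.
(* Two updates of [p] and two rounds through the other [#|B|.-1] vertices. *)
have -> : 2 * #|B| = (#|B|.-1 + (#|B|.-1).+1).+1 by clear -B1; lia.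
apply: (win_hard te0).
have [y1p|y1p] := eqVneq (upd r G p y p) (r p).
  by apply: fin => //; rewrite leq_addr.
have nhy : hit r G y p = false.
  by apply: contraNF y1p => h; rewrite upd_val_hit.
have y1r : upd r G p y p = ~~ r p by rewrite upd_val_free.
have yc : y c = s.
  have : y c != bad r e0 by apply: contraFneq nhy => be; apply: hit_arc; rewrite ?se0.
  by rewrite (c_nonbad e0G se0); case: (y c); case: (s).
rewrite -{1 3}szt; apply: (win_hards tB); apply: (win_hard te0).
set x2 := upds r G (tgts ts) _; set y2 := upds r G (tgts ts) _.
have same2 o : same_off B o (upds r G (tgts ts) (upd r G p o)).
  by move=> k kB; rewrite (upds_out_set _ _ _ tB) // keep1.
apply: fin => //.
- by move=> k kB; rewrite keep1 // same2.
- by move=> k kB; rewrite keep1 // same2.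
- by apply/upd_val_hit/hitp; rewrite same2.
have pn : p \notin B :\ p by rewrite !inE eqxx.
have cn : c \notin B :\ p by rewrite !inE (negPf cnB) andbF.
have [e1 [e1G te1 se1]] := initial_cycle_pred iB te0.
have := @tree_favors B [set p] ts (upd r G p y) p (r p) (B :\ p) set0 iB tts.
move=> /(_ _ _ _ cn _ _ (sub0set _) _ (arc_src e1)) fe1.
apply: upd_val_hit; rewrite -te1; apply: hit_arc => //.
apply/eqP; rewrite bad_matched te1; apply/eqP; apply: (favors_arc e1G erefl te1); apply: fe1.
- by rewrite sub1set.
- by move=> k /set1P->.
- by move=> k kB; rewrite !inE kB andbT.
- move=> k /set1P->; rewrite y1r; apply: favors_cycle => //; by case: (r p).
- move=> e eG se; rewrite keep1 // yc (c_nonbad eG se) => ss.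
  by exfalso; move: ss; case: (s).
- by move=> k _; rewrite inE.
exact: cov.
Qed.

Lemma bigcup_disjoint B (Ps : seq {set V}) k : B \in P -> {subset Ps <= P} ->
  B \notin Ps -> k \in B -> k \notin \bigcup_(D <- Ps) D.
Proof.
move=> BP sP nB kB; elim: Ps sP nB => [|D Ps IHPs] sP; first by rewrite big_nil inE.
rewrite big_cons inE negb_or => /andP[BD nB]; rewrite inE negb_or IHPs //; last first.
  by move=> D' D'P; apply: sP; rewrite inE D'P orbT.
rewrite andbT; have DP : D \in P by apply: sP; rewrite inE eqxx.
by have /trivIsetP/(_ _ _ BP DP BD)/disjointFr-> := initial_cycles_trivIset.
Qed.

Lemma anchor_all (Ps : seq {set V}) x y : uniq Ps -> {subset Ps <= P} ->
  hit r G x i -> hit r G y i -> x c = ~~ s ->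
  win r G (\bigcup_(D <- Ps) D)
    (fun x' y' => [/\ hit r G x' i, hit r G y' i & forall B, B \in Ps -> anchored B x' y'])
    (2 * \sum_(D <- Ps) #|D|) (2 * \sum_(D <- Ps) #|D|) x y.
Proof.
elim: Ps x y => [|B Ps IHPs] x y; first by move=> *; apply: win_done; split.
rewrite cons_uniq => /andP[nB uP] sP hx hy xc; rewrite !big_cons !mulnDr.
have BP : B \in P by apply: sP; rewrite inE eqxx.
have sP' : {subset Ps <= P} by move=> D DP; apply: sP; rewrite inE DP orbT.
apply: win_bind (win_subset (subsetUl _ _) (win_frame (anchor_one BP hx hy xc))) _.
move=> x1 y1 [[hx1 hy1 [p pB xyp]] ox oy].
have cB : c \notin B.
  by apply/negP=> /(subsetP (subset_trans (initial_cycle_U0 BP) U0_H)); rewrite !inE eqxx.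
have x1c : x1 c = ~~ s by rewrite ox.
apply: win_impl (win_subset (subsetUr _ _) (win_frame (IHPs _ _ uP sP' hx1 hy1 x1c))).
move=> x2 y2 [[hx2 hy2 an] ox2 oy2]; split=> // D; rewrite inE => /predU1P[->|/an//].
have pn := bigcup_disjoint BP sP' nB pB.
by exists p; rewrite ?ox2 ?oy2.
Qed.

Lemma merged_outside_c x y : x c = s -> y c = s -> merged_outside r G H x y.
Proof.
move=> xc yc e eG tH sH; have se : arc_src e = c.
  by apply/eqP; apply: contraNT sH => sc; rewrite !inE sc inS.
by rewrite se xc yc; have [] := special eG se.
Qed.

Lemma rotate_all (Ps : seq {set V}) x y : uniq Ps -> {subset Ps <= P} ->
  x c = s -> y c = s -> (forall B, B \in Ps -> anchored B x y) ->
  win r G (\bigcup_(D <- Ps) D) (agree (\bigcup_(D <- Ps) D))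
    (\sum_(D <- Ps) #|D|) (\sum_(D <- Ps) #|D|) x y.
Proof.
elim: Ps x y => [|B Ps IHPs] x y.
  by move=> _ _ _ _ _; apply: win_done => k; rewrite big_nil inE.
rewrite cons_uniq => /andP[nB uP] sP xc yc an; rewrite !big_cons.
have BP : B \in P by apply: sP; rewrite inE eqxx.
have sP' : {subset Ps <= P} by move=> D DP; apply: sP; rewrite inE DP orbT.
have [[sB B0 cB stB cycB] _] := initial_cyclesP _ BP.
have cnB : c \notin B by apply/negP=> /(subsetP sB); rewrite !inE eqxx.
have step : win r G B (agree B) #|B| #|B| x y.
  have [|p pB xyp] := an B; first by rewrite inE eqxx.
  have := @component_simulate _ r G H set0 B #|B|.-1 #|B|.-1 0 0 x y _ _ sB _ _ _
    (merged_outside_c xc yc) _ (cyclic_merge r sG stB cycB pB xyp).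
  rewrite set0U muln0 addn0 muln1 => h; apply: win_mono (leq_pred _) (leq_pred _) _.
  apply: h.
  - exact: sub0set.
  - by apply/closed_inP=> e _; rewrite inE.
  - by rewrite disjoints_subset sub0set.
  - by rewrite setD0.
  - by move=> v z _ _; exists [::]; split=> // e _ _; rewrite inE.
  - by move=> k; rewrite inE.
apply: win_bind (win_subset (subsetUl _ _) (win_frame step)) _ => x1 y1 [aB ox oy].
have an1 D : D \in Ps -> anchored D x1 y1.
  move=> DP; have [|p pD xyp] := an D; first by rewrite inE DP orbT.
  have pB : p \notin B.
    have BD : D != B by apply: contraNneq nB => <-.
    have /trivIsetP/(_ _ _ (sP' _ DP) BP BD) d := initial_cycles_trivIset.
    by rewrite (disjointFr d).
  by exists p; rewrite ?ox ?oy.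
have := IHPs x1 y1 uP sP' _ _ an1; rewrite ox ?oy // => /(_ xc yc) IH.
apply: win_impl (win_subset (subsetUr _ _) (win_frame IH)) => x2 y2 [a2 ox2 oy2].
apply: agreeU => // k kB; have kn := bigcup_disjoint BP sP' nB kB.
by rewrite ox2 // oy2 // aB.
Qed.

Lemma bigcup_enumP : \bigcup_(D <- enum P) D = BB.
Proof. by rewrite big_enum_cond /=; apply: eq_bigl => D; rewrite andbT. Qed.

Lemma sum_enumP : \sum_(D <- enum P) #|D| = #|BB|.
Proof.
have := initial_cycles_trivIset; rewrite /trivIset => /eqP <-.
by rewrite big_enum_cond /=; apply: eq_bigl => D; rewrite andbT.
Qed.

Lemma subset_enumP : {subset enum P <= P}.
Proof. by move=> D; rewrite mem_enum. Qed.

Lemma BB_H : BB \subset H. Proof. exact: subset_trans BB_U0 U0_H. Qed.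

Lemma H_E : H \subset E. Proof. exact: subsetDl. Qed.

Lemma smaller_H D : D \subset H -> strong G D -> ~~ cyclic_in G D ->
  forall x y, win r (restrict G D) D (agree D) (strong_len #|D|) (strong_hard #|D|) x y.
Proof.
move=> sD stD ncD; apply: merge_smaller => //; first exact: subset_trans H_E.
by apply: contraTneq cE => DE; apply/negP=> _; have := subsetP sD c; rewrite DE cE !inE eqxx => /(_ isT).
Qed.

Definition final_len := size es + #|BB| + (hom_len #|H| - hom_len #|BB|).
Definition final_hard := size es + #|BB| + (hom_hard #|H| - hom_hard #|BB|).

(** With [i] forced in both, the chain brings [c] to [s] in both. Then [E :\ c] merges like a
    homogenous net, its anchored initial cycles first. *)
Lemma final_stage x y : x i = r i -> y i = r i ->
  (forall B, B \in P -> anchored B x y) -> win r G E (agree E) final_len final_hard x y.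
Proof.
move=> xi yi an; rewrite /final_len /final_hard -!addnA -(size_map (@arc_tgt _) es).
have allW : all (fun v => v \in E) W.
  by apply/allP=> k kW; apply: W_sub; rewrite inE kW orbT.
apply: (win_hards allW).
have [mx x'i] := chain_play x; have [my y'i] := chain_play y.
set x' := upds r G W x in mx x'i *; set y' := upds r G W y in my y'i *.
have xc : x' c = s by apply/eqP; rewrite chain_value // x'i xi.
have yc : y' c = s by apply/eqP; rewrite chain_value // y'i yi.
have an' B : B \in enum P -> anchored B x' y'.
  rewrite mem_enum => BP; have [p pB xyp] := an B BP.
  have pW : p \notin W.
    by apply/negP=> pW; have := initial_cycle_chain BP (k := p); rewrite inE pW orbT pB => /(_ isT).
  by exists p; rewrite // /x' /y' !upds_out.
have := rotate_all (enum_uniq _) subset_enumP xc yc an'.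
rewrite bigcup_enumP sum_enumP => rot.
have sBE := subset_trans BB_H H_E.
apply: win_bind (win_subset sBE (win_frame rot)) _ => x1 y1 [a1 ox oy].
have iBB : i \notin BB.
  by apply/bigcupP=> -[B BP]; have [_ /negPf->] := initial_cyclesP _ BP.
have cBB : c \notin BB by apply/negP=> /(subsetP BB_H); rewrite !inE eqxx.
have x1c : x1 c = s by rewrite ox.
have y1c : y1 c = s by rewrite oy.
have hm : win r G H (agree H) (hom_len #|H| - hom_len #|BB|) (hom_hard #|H| - hom_hard #|BB|) x1 y1.
  apply: (homogenous_merge pcf sG in_arcH goodH smaller_H BB_H BB_closed) => //.
    exact: merged_outside_c.
  move=> B iB dB; have [iB'|iB'] := boolP (i \in B).
    by exists i; rewrite // ox // oy // x'i y'i xi yi.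
  have BP : B \in P by apply/initial_cyclesP.
  have [_ /set0Pn[k kB] _ _ _] := iB.
  have kBB : k \in BB by apply/bigcupP; exists B.
  by move: (disjointFr dB kBB); rewrite kB.
apply: win_impl (win_subset H_E (win_frame hm)) => x2 y2 [a2 ox2 oy2] k kE.
have [->|kc] := eqVneq k c; last by apply: a2; rewrite !inE kc.
by rewrite ox2 ?oy2 ?inE ?eqxx // x1c y1c.
Qed.

(** Anchoring has to precede the letter [i], since the chain played afterwards makes [c] neutral;
    meanwhile [anchor_one] keeps [i] hit in both. *)
Lemma end_stage x y : hit r G x i -> hit r G y i -> x c = ~~ s ->
  win r G E (agree E) (2 * #|BB| + final_len.+1) (2 * #|BB| + final_hard) x y.
Proof.
move=> hx hy xc; have := anchor_all (enum_uniq _) subset_enumP hx hy xc.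
rewrite bigcup_enumP sum_enumP => an.
apply: win_bind (win_subset (subset_trans BB_H H_E) an) _ => x1 y1 [hx1 hy1 an1].
have fs : win r G E (agree E) final_len final_hard (force r i x1) (force r i y1).
  apply: final_stage; rewrite ?force_val // => B BP.
  have [|p pB xyp] := an1 B; first by rewrite mem_enum.
  have [_ niB] := initial_cyclesP _ BP.
  have pi : p != i by apply: contraNneq niB => <-.
  by exists p; rewrite // !force_out.
by apply: (win_soft iE); rewrite ?upd_hit.
Qed.

(** * Making [i] forced in both configurations *)

(** Here [y] is the configuration followed: forcing and updating coincide on it when it is hit, and
    of [x] only the value at [v] becomes unknown. *)
Lemma win_letter Q a b v x y : v \in E ->
  (forall x', same_off [set v] x x' -> win r G E Q a b x' (upd r G v y)) ->
  win r G E Q a.+1 (~~ hit r G y v + b) x y.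
Proof.
move=> vE K; have v1 : v \in [set v] by rewrite inE.
case: (boolP (hit r G y v)) => hy /=; rewrite ?add0n ?add1n.
  apply: (win_soft vE); first by apply: K; apply: same_off_upd.
  by rewrite -(upd_hit hy); apply: K; apply: same_off_force.
by apply: (win_hard vE); apply: K; apply: same_off_upd.
Qed.

Definition ended x y := [/\ hit r G x i, hit r G y i & (x c == ~~ s) || (y c == ~~ s)].

(* Follow a word [w] that makes [y] hit, but skip the letters on in-neighbours of
   [i] that leave [y] unhit: they do not change [y], and skipping them protects
   the bad in-literals of [x].  The last letter spoils at most one of these. *)
Lemma stop_run w x y : all (fun v => v \in E) w ->
  (forall e, e \in G -> arc_tgt e = i -> x (arc_src e) = bad r e) ->
  hit r G y i = false -> hit r G (upds r G w y) i -> count_mem c w <= 1 ->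
  (c \in w -> x c = ~~ s) -> upds r G w y c = ~~ s ->
  win r G E ended (size w) (hards r G w y) x y.
Proof.
elim: w x y => [|v w IHw] x y /=; first by move=> _ _ ->.
case/andP=> vE wE bx nhy hw cw xc yc.
have cw' : count_mem c w <= 1 by apply: leq_trans cw; rewrite leq_addl.
have nocw : v = c -> c \notin w.
  move=> vc; apply/count_memPn/eqP; move: cw; rewrite vc eqxx add1n ltnS leqn0.
  by [].
have xc' x' : same_off [set v] x x' -> c \in w -> x' c = ~~ s.
  move=> so cw0; rewrite so; first by apply: xc; rewrite inE cw0 orbT.
  by rewrite inE; apply/eqP=> cv; move: (nocw (esym cv)); rewrite cw0.
have xyc x' : same_off [set v] x x' -> (x' c == ~~ s) || (upd r G v y c == ~~ s).
  move=> so; case: (boolP (c \in w)) => cw0; first by rewrite (xc' _ so cw0) eqxx.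
  by rewrite -yc upds_out // eqxx orbT.
have [/exists_inP[e eG /andP[/eqP se /eqP te]]|nn] :=
  boolP [exists e in G, (arc_src e == v) && (arc_tgt e == i)].
  have [by1|nby1] := eqVneq (upd r G v y v) (bad r e).
    apply: win_mono (leqnn _) (leqnn _) _; rewrite -[size w]add0n -[hards r G w _]add0n.
    apply: (@win_mono _ _ _ _ _ 1 (~~ hit r G y v + 0)).
    - by [].
    - by rewrite addn0 leq_addr.
    apply: (win_letter vE) => x' so; apply: win_done; split.
    - have [e2 [e2G te2 se2]] := multi_other mi v.
      rewrite -te2; apply: hit_arc => //; rewrite so ?inE //; exact: bx.
    - by rewrite -te; apply: hit_arc; rewrite // se.
    - exact: xyc.
  have yy : upd r G v y = y.
    apply/ffunP=> k; have [->|kv] := eqVneq k v; last exact: upd_out.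
    have : y v != bad r e.
      by apply: contraFneq nhy => be; rewrite -te; apply: hit_arc; rewrite // se.
    by move: nby1; case: (upd _ _ _ _ _); case: (y v); case: (bad r e).
  rewrite yy in hw yc *.
  apply: win_mono (leqnSn _) (leq_addl _ _) _; apply: IHw => //.
  by move=> cw0; apply: xc; rewrite inE cw0 orbT.
have nv e : e \in G -> arc_tgt e = i -> arc_src e != v.
  by move=> eG te; apply: contraNneq nn => sv; apply/exists_inP; exists e; rewrite // sv te !eqxx.
apply: (win_letter vE) => x' so; apply: IHw => //.
- by move=> e eG te; rewrite so ?inE ?nv //; apply: bx.
- rewrite -nhy; apply: eq_hit => e eG te; apply: upd_out; exact: nv.
- exact: xc'.
Qed.

Lemma iW : i \notin W.
Proof. by have := uniq_chain; rewrite cons_uniq => /andP[]. Qed.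

Lemma iU0 : i \notin U0.
Proof. by rewrite !inE eqxx andbF. Qed.

Lemma cU0 : c \notin U0.
Proof. by apply/negP=> /(subsetP U0_H); rewrite !inE eqxx. Qed.

Lemma W_E : all (fun v => v \in E) W.
Proof. by apply/allP=> k kW; apply: W_sub; rewrite inE kW orbT. Qed.

Lemma U0_E w : all (fun v => v \in U0) w -> all (fun v => v \in E) w.
Proof. by move=> wU; apply/allP=> k /(allP wU); rewrite inE => /andP[]. Qed.

(** If [y] is not hit, the letter [i] yields [r i] in [x] and [~~ r i] in [y]. Then [target_run] for
    [y] gives a word after which [y] is hit, and [stop_run] breaks it off in time. *)
Lemma posture_stage x y : x i = ~~ r i -> x c = ~~ s ->
  (forall e, e \in G -> arc_tgt e = i -> x (arc_src e) = bad r e) ->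
  win r G E ended (size es + run2_len).+1 (size es + run2_hard).+1 x y.
Proof.
move=> xi xc bx; have [e0 e0G te0] := in_arcE iE.
have hx : hit r G x i by rewrite -te0; apply: hit_arc; rewrite // bx.
have [hy|nhy] := boolP (hit r G y i).
  by apply: win_done; split; rewrite // xc eqxx.
apply: (win_hard iE); set x1 := upd r G i x; set y1 := upd r G i y.
have x1i : x1 i = r i by apply: upd_val_hit.
have y1i : y1 i = ~~ r i by apply: upd_val_free; apply: negbTE.
have [wes les _ _] := ch.
have es0 : c = i -> es = [::].
  move=> ci; apply/eqP; rewrite -size_eq0 -(size_map (@arc_tgt _)) size_eq0.
  apply: contraT => W0; case/negP: iW; rewrite -ci -les -/W.
  by move: W0; rewrite -/W; case: (W) => // v w _; exact: (mem_last v w).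
(* If [c = i], the chain is empty and [s = r i], so it is now [y] that has [c] at [~~ s]. *)
have c1 : (x1 c == ~~ s) || (y1 c == ~~ s).
  have [ci|ci] := eqVneq c i; last by rewrite /x1 upd_out // xc eqxx.
  move: sgn_es; rewrite es0 // ci y1i => /esym/eqP->.
  by rewrite eqxx orbT.
(* A loop at [i] is negative, so the value [~~ r i] in [y] is bad for it. *)
have [/exists_inP[e eG /andP[/eqP se /eqP te]]|nl] :=
  boolP [exists e in G, (arc_src e == i) && (arc_tgt e == i)].
  apply: win_done; split=> //.
    have [e2 [e2G te2 se2]] := multi_other mi i.
    by rewrite -te2; apply: hit_arc => //; rewrite /x1 upd_out // bx.
  have sgf : arc_sign e = false.
    have n0 : i \notin (set0 : {set V}) by rewrite inE.
    by rewrite -sgn1; apply: (negative_cycle pcf n0); apply: simple_walk1.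
  by rewrite -te; apply: hit_arc => //; rewrite se y1i /bad sgf te; case: (r i).
have nloop e : e \in G -> arc_tgt e = i -> arc_src e != i.
  by move=> eG te; apply: contraNneq nl => si; apply/exists_inP; exists e; rewrite // si te !eqxx.
have [my y2i] := chain_play y1.
have [w [wU sw hw fw]] := target_run my.
apply: (@win_mono _ _ _ _ _ (size (W ++ w)) (hards r G (W ++ w) y1)).
- by rewrite size_cat size_map leq_add2l.
- rewrite hards_cat leq_add // -(size_map (@arc_tgt _) es); exact: hards_size.
apply: stop_run.
- by rewrite all_cat W_E U0_E.
- by move=> e eG te; rewrite /x1 upd_out ?nloop // bx.
- apply: not_hit => e eG te; rewrite /y1 upd_out ?nloop //.
  by apply: contraNneq nhy => be; rewrite -te; apply: hit_arc.
- rewrite upds_cat -te0; apply: hit_arc => //.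
  apply/eqP; rewrite bad_matched te0; apply/eqP.
  by rewrite (fw e0) // y2i y1i negbK.
- rewrite count_cat (count_memPn (_ : c \notin w)) ?addn0; last first.
    by apply: contra cU0 => /(allP wU).
  have := uniq_chain; rewrite cons_uniq => /andP[_ uW].
  by rewrite (count_uniq_mem _ uW) leq_b1.
- rewrite mem_cat => /orP[cW|/(allP wU)]; last by rewrite (negPf cU0).
  rewrite /x1 upd_out //; apply: contraNneq iW => <-; exact: cW.
rewrite upds_cat (upds_out_set _ _ _ wU) ?cU0 //.
have := chain_value my; rewrite y2i y1i.
by case: (upds _ _ _ _ _); case: (s); case: (r i).
Qed.

Definition free_len := size es + (run2_len +
  ((size es + run2_len).+1 + (2 * #|BB| + final_len.+1))).
Definition free_hard := size es + (run2_hard +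
  ((size es + run2_hard).+1 + (2 * #|BB| + final_hard))).

(** Since [i] lacks its forced value, the run pushing it to the opposite one makes all its
    in-literals bad in [x], while the chain sets [c] to [~~ s]. *)
Lemma free_merge x y : x i = ~~ r i -> win r G E (agree E) free_len free_hard x y.
Proof.
move=> xi; rewrite /free_len /free_hard -{1 3}(size_map (@arc_tgt _) es).
apply: (win_hards W_E); have [mx x1i] := chain_play x.
set x1 := upds r G (tgts es) x in mx x1i *; set y1 := upds r G (tgts es) y.
have [w [wU sw hw fw]] := target_run mx.
have post y2 : win r G E (agree E) ((size es + run2_len).+1 + (2 * #|BB| + final_len.+1))
    ((size es + run2_hard).+1 + (2 * #|BB| + final_hard)) (upds r G w x1) y2.
  apply: win_bind (posture_stage y2 _ _ _) _.
  - by rewrite (upds_out_set _ _ _ wU) ?iU0 // x1i.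
  - rewrite (upds_out_set _ _ _ wU) ?cU0 //.
    have := chain_value mx; rewrite -/x1 x1i xi.
    by case: (x1 c); case: (s); case: (r i).
  - move=> e eG te; apply/eqP; rewrite bad_matched te; apply/eqP.
    by rewrite (fw e) // x1i xi negbK.
  move=> x' y' [hx hy /orP[/eqP xc|/eqP yc]]; first exact: end_stage.
  apply: win_impl (win_sym (end_stage hy hx yc)) => x2 y3 ag k kE.
  by rewrite ag.
apply: (win_mono (leq_add sw (leqnn _)) (leq_add hw (leqnn _))).
by apply: (@win_word _ _ _ _ _ (fun _ _ => True)) => //; apply: U0_E.
Qed.

Lemma card_H : #|H| = #|E|.-1.
Proof. by rewrite (cardsD1 c E) cE. Qed.

Lemma card_U0BB : #|U0 :\: BB| = #|U0| - #|BB|.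
Proof. exact: cardsDS BB_U0. Qed.

Lemma strong_pair_merge x y :
  win r G E (agree E) (strong_len #|E|) (strong_hard #|E|) x y.
Proof.
have bk : #|BB| <= #|U0| by apply: subset_leq_card BB_U0.
have bH : #|BB| <= #|H| by apply: subset_leq_card BB_H.
have hE : #|H| = #|U0| + size es by rewrite card_H card_U0.
have lb := hom_len_mono bH; have hb := hom_hard_mono bH.
have free_bound : free_len <= strong_len #|E| /\ free_hard <= strong_hard #|E|.
  rewrite /free_len /free_hard /final_len /final_hard /run2_len /run2_hard card_U0BB.
  rewrite /strong_len /strong_hard -card_H hE; rewrite hE in lb hb.
  have [b0|b0] := posnP #|BB|.
    rewrite b0 subn0.
    have := strong_len_plain #|U0| (size es); have := strong_hard_plain #|U0| (size es).
    rewrite (_ : run_len 0 = 0) // (_ : run_hard 0 = 0) // (_ : hom_len 0 = 0) //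
      (_ : hom_hard 0 = 0) //.
    by clear; lia.
  have := strong_len_cycles (size es) b0 bk; have := strong_hard_cycles (size es) b0 bk.
  by clear -lb hb; lia.
have [fl fh] := free_bound.
have [xi|xi] := eqVneq (x i) (r i); last first.
  apply: win_mono fl fh (free_merge _ _).
  by move: xi; case: (x i); case: (r i).
have [yi|yi] := eqVneq (y i) (r i); last first.
  have yf : y i = ~~ r i by move: yi; case: (y i); case: (r i).
  apply: win_impl (win_sym (win_mono fl fh (free_merge x yf))) => x' y' ag k kE.
  by rewrite ag.
(* With [i] at [r i] in both configurations and no cycles to anchor, the final stage applies at
   once. *)
have [P0|P0] := eqVneq P set0.
  have BB0 : #|BB| = 0 by rewrite /BB P0 /cover big_set0 cards0.
  apply: (@win_mono _ _ _ _ _ final_len final_hard).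
  - rewrite /final_len BB0 /strong_len -card_H hE (_ : hom_len 0 = 0) //.
    by have := strong_len_plain #|U0| (size es); clear; lia.
  - rewrite /final_hard BB0 /strong_hard -card_H hE (_ : hom_hard 0 = 0) //.
    by have := strong_hard_plain #|U0| (size es); clear; lia.
  by apply: final_stage => // B; rewrite P0 inE.
have b0 : 0 < #|BB|.
  have [B BP] := set0Pn _ P0; have [[_ /set0Pn[k kB] _ _ _] _] := initial_cyclesP _ BP.
  by apply/card_gt0P; exists k; apply/bigcupP; exists B.
(* Anchors are still missing: a third run makes all in-literals of [i] neutral in [x], and one
   letter sends [i] to [~~ r i], the case already treated. *)
apply: (@win_mono _ _ _ _ _ (size es + (run2_len + free_len.+1))
   (size es + (run2_hard + free_hard.+1))).
- rewrite /free_len /final_len /run2_len card_U0BB /strong_len -card_H hE.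
  rewrite hE in lb.
  by have := strong_len_cycles (size es) b0 bk; clear -lb; lia.
- rewrite /free_hard /final_hard /run2_hard card_U0BB /strong_hard -card_H hE.
  rewrite hE in hb.
  by have := strong_hard_cycles (size es) b0 bk; clear -hb; lia.
rewrite -{1 2}(size_map (@arc_tgt _) es); apply: (win_hards W_E).
have [mx x1i] := chain_play x.
set x1 := upds r G (tgts es) x in mx x1i *; set y1 := upds r G (tgts es) y.
have [w [wU sw hw fw]] := target_run mx.
apply: (win_mono (leq_add sw (leqnn _)) (leq_add hw (leqnn _))).
apply: (@win_word _ _ _ _ _ (fun _ _ => True)) => //; first exact: U0_E.
move=> y2 _; apply: (win_hard iE); apply: free_merge; apply: upd_val_free.
apply: not_hit => e eG te; rewrite not_bad_matched te; apply/eqP.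
by rewrite (fw e) // x1i xi.
Qed.

End StrongMerge.

(** * Recursion over strong sets *)

Section StrongRecursion.
Variables (V : finType) (r : V -> bool).

Lemma positive_cycle_free_sub (G G' : sdigraph V) :
  G' \subset G -> positive_cycle_free G -> positive_cycle_free G'.
Proof.
move=> sG pcf [u [a /andP[/and4P[an wa la ua] sa]]]; apply: pcf; exists u, a.
rewrite sa andbT; apply/and4P; split=> //.
elim: (a) (u) wa => //= e a' IHa v /andP[/andP[-> /(subsetP sG) ->] /IHa].
by [].
Qed.

(** Induction on [#|E|]: the components met after removing [c] are proper subsets of [E]. *)
Lemma strong_merge (G : sdigraph V) (E : {set V}) : positive_cycle_free G ->
  simple_arcs G -> strong G E -> ~~ cyclic_in G E ->
  forall x y, win r (restrict G E) E (agree E) (strong_len #|E|) (strong_hard #|E|) x y.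
Proof.
move: {2}(#|E|).+1 (ltnSn #|E|) => n; elim: n => // n IHn in G E *.
rewrite ltnS => leE pcf sG stE ncE x y.
have [v0 v0E mv] : exists2 v, v \in E & multi (restrict G E) v.
  by move: ncE; rewrite negb_forall_in => /exists_inP[v vE]; rewrite negbK; exists v.
have sGE : restrict G E \subset G by apply/subsetP=> e; apply: restrict_sub.
have pcf' := positive_cycle_free_sub sGE pcf.
have sG' := simple_arcs_restrict (E := E) sG.
have st' := strong_restrict stE.
have ins e : e \in restrict G E -> (arc_src e \in E) && (arc_tgt e \in E).
  by rewrite in_restrict => /and3P[_ -> ->].
have [c [s [i [es [[cE iE mi ch sg] sp]]]]] := special_vertex r pcf' sG' st' ins (ex_intro2 _ _ v0 v0E mv).
apply: (strong_pair_merge pcf' sG' st' ins _ cE iE mi ch sg sp) => D sD DE stD ncD.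
apply: IHn => //; apply: leq_trans leE; apply: proper_card.
by rewrite properEneq DE.
Qed.

End StrongRecursion.

Delimit Scope R_scope with stdR.

(** [2 ^ m * g m] and the powers of [q] obey the same recurrence, since [q * q = 2 * q + 4]. So the
    cases 39 <= 40 and 126 <= 40q suffice. *)
Lemma hom_len_real n :
  (INR (3 * (2 ^ n * hom_len n)) <= INR 40 * (sqrt (INR 5) + 1) ^ n)%stdR.
Proof.
pose g m := 13 * fib m.+1 + 8 * fib m.
have gS m : 2 ^ m.+2 * g m.+2 = 2 * (2 ^ m.+1 * g m.+1) + 4 * (2 ^ m * g m).
  by rewrite /g !expnS (fibSS m.+1) (fibSS m); nia.
set q := (sqrt (INR 5) + 1)%stdR.
have q5 : (sqrt (INR 5) * sqrt (INR 5) = 5)%stdR.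
  by rewrite sqrt_sqrt; [rewrite /=; lra | apply: pos_INR].
have q0 : (0 <= sqrt (INR 5))%stdR by apply: sqrt_pos.
have qlo : (2.2 <= sqrt (INR 5))%stdR by nra.
have q2 : (q * q = 2 * q + 4)%stdR by rewrite /q; nra.
have main m : (INR (3 * (2 ^ m * g m)) <= 40 * q ^ m)%stdR /\
    (INR (3 * (2 ^ m.+1 * g m.+1)) <= 40 * q ^ m.+1)%stdR.
  elim: m => [|m [IH1 IH2]].
    have -> : 3 * (2 ^ 0 * g 0) = 39 by [].
    have -> : 3 * (2 ^ 1 * g 1) = 126 by [].
    by rewrite pow_O pow_1 !INR_IZR_INZ /q; split; simpl IZR; lra.
  split=> //.
  have -> : 3 * (2 ^ m.+2 * g m.+2) = 2 * (3 * (2 ^ m.+1 * g m.+1)) + 4 * (3 * (2 ^ m * g m)).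
    by rewrite gS; lia.
  have E : (INR (2 * (3 * (2 ^ m.+1 * g m.+1)) + 4 * (3 * (2 ^ m * g m))) =
    2 * INR (3 * (2 ^ m.+1 * g m.+1)) + 4 * INR (3 * (2 ^ m * g m)))%stdR.
    by rewrite plus_INR (mult_INR 2) (mult_INR 4) (INR_IZR_INZ 2) (INR_IZR_INZ 4).
  rewrite E; have -> : (q ^ m.+2 = 2 * q ^ m.+1 + 4 * q ^ m)%stdR.
    have -> : (q ^ m.+2 = q * q * q ^ m)%stdR by rewrite /=; ring.
    by rewrite q2 /=; ring.
  lra.
have [h _] := main n; apply: Rle_trans (_ : INR (3 * (2 ^ n * g n)) <= _)%stdR.
  by apply: le_INR; apply/leP; rewrite !leq_mul // /hom_len leq_subr.
by have -> : (INR 40 = 40)%stdR; [rewrite /=; lra | exact: h].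
Qed.

(** * And-or-nets and the final count *)

Section Nets.
Variables (V : finType) (G : sdigraph V) (f : BN V).
Implicit Types (u v i : V) (x y : config V) (e : V * V * bool) (U B C : {set V}).

Lemma net_forced_values : and_or_net G f ->
  exists r : V -> bool, forall x v, f x v = (hit r G x v == r v).
Proof.
case=> _ ao.
have [v|r rP] := @fin_all_exists V (fun _ => bool) (fun v b => forall x,
  f x v = ([exists e in G, (arc_tgt e == v) && (x (arc_src e) == (arc_sign e == b))] == b)).
  have [cj|dj] := ao v; [exists false | exists true] => x.
    rewrite cj eqbF_neg negb_exists_in; apply/forallP/forall_inP=> h.
      move=> [[j i] []] eG; rewrite negb_and /arc_tgt /arc_src /=.
        have [ei|//] := eqVneq i v; have := h j; rewrite -ei eG /= => /andP[-> _].
        by [].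
      have [ei|//] := eqVneq i v; have := h j; rewrite -ei eG /= => /andP[_].
      by case: (x j).
    move=> j; apply/andP; split; apply/implyP=> eG; have := h _ eG;
      rewrite negb_and /arc_tgt /arc_src /= eqxx /=; by case: (x j).
  rewrite dj eqb_id negb_forall; apply/existsP/exists_inP=> [[j]|[[[j i] b] eG]].
    rewrite negb_and !negb_imply => /orP[/andP[eG xj]|/andP[eG xj]].
      by exists (j, v, true); rewrite // /arc_tgt /arc_src /= eqxx -[_ == _]negbK; move: xj; case: (x j).
    by exists (j, v, false); rewrite // /arc_tgt /arc_src /= eqxx; move: xj; case: (x j).
  rewrite /arc_tgt /arc_src /= => /andP[/eqP ei]; rewrite ei in eG.
  by case: b eG => eG xj; exists j; rewrite eG /=; move: xj; case: (x j); rewrite ?andbF ?orbT.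
exists r => x v; rewrite rP /hit; congr (_ == _); apply: eq_existsb => e.
by rewrite /bad; have [->|] := eqVneq (arc_tgt e) v; rewrite ?andbF.
Qed.

Variable r : V -> bool.
Hypothesis fE : forall x v, f x v = (hit r G x v == r v).
Hypothesis dG : interaction_digraph f = G.

Lemma apply_word_upds w x : apply_word f w x = upds r G w x.
Proof.
elim: w x => //= v w IHw x; rewrite -IHw; congr (apply_word f w _).
by apply/ffunP=> k; rewrite /update /upd /set_at !ffunE fE.
Qed.

(** With two arcs of opposite signs from [j] to [i], one in-literal of [i] would always be bad; the
    component of [f] at [i] would be constant and [i] would have no in-arc. *)
Lemma net_simple_arcs : simple_arcs G.
Proof.
move=> [[j i] b] [[j' i'] b'] eG e'G; rewrite /arc_src /arc_tgt /= => ej ei.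
rewrite -{}ej -{}ei in e'G *; have [->//|nb] := eqVneq b b'.
have both b0 : (j, i, b0) \in G by move: nb eG e'G; case: b; case: b'; case: b0.
have const x : f x i = r i.
  rewrite fE; suff -> : hit r G x i by case: (r i).
  apply/hitP; exists (j, i, x j == r i); split=> //.
  by rewrite /bad /arc_src /arc_sign /arc_tgt /=; case: (x j); case: (r i).
move: eG; rewrite -dG inE => /existsP[x /andP[_]].
rewrite /arc_src /arc_sign /arc_tgt /= !const; case: (b); by case: (r i).
Qed.

Hypotheses (hom : homogenous G) (pcf : positive_cycle_free G).
Hypothesis nosource : forall i, ~~ source G i.
Hypothesis noinitial : forall C, ~ initial_cycle G C.

Lemma net_in_arc u : exists2 e, e \in G & arc_tgt e = u.
Proof.
have := nosource u; rewrite negb_forall_in => /exists_inP[e eG].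
by rewrite negbK => /eqP te; exists e.
Qed.

(** The walk ends with an arc leaving [U], which is closed under ancestors. Its ends lie in distinct
    strong components, so the walk is a forward path. *)
Lemma net_good U v C : closed_in G setT U -> v \notin U -> C \subset U -> C != set0 ->
  closed_in G U C -> exists2 p, p \in C & constant_sign G U p v.
Proof.
move=> cU vU sC /set0Pn[u0 u0C] cC.
have cC' : closed_in G setT C.
  apply/closed_inP=> e eG tC _; apply: (closed_inP _ _ _ cC) => //.
  by apply: (closed_inP _ _ _ cU); rewrite ?inE // (subsetP sC).
have [|j jC hj] := hom v (C := scc G u0); first by exists u0.
have {jC}jC : j \in C.
  move: jC; rewrite inE => /andP[cj _].
  exact: ancestor_closed cC' erefl cj u0C.
have jU := subsetP sC _ jC.
exists j => //; suff fw a : simple_walk G U j v a -> forward_path G j v a.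
  by move=> a b /fw fa /fw; apply: hj.
move=> sa; have /and5P[an wa /eqP la inU ua] := sa.
have srcU k : k \in srcs a -> k \in U.
  case: (a) an wa inU => // e a' _ /= /andP[/andP[/eqP se _] _] /allP inU.
  by rewrite inE => /predU1P[->|/inU//]; rewrite se.
have uv : uniq (walk_vertices j a).
  rewrite /walk_vertices (walk_sources wa) la rcons_uniq ua andbT.
  by apply: contra vU => /srcU.
rewrite /forward_path /is_path wa uv la eqxx an /=.
case/lastP: a an wa la srcU {sa inU ua uv} => // a e _ wa la srcU.
rewrite last_rcons; move: la; rewrite map_rcons last_rcons => te.
have sU : arc_src e \in U by apply: srcU; rewrite map_rcons mem_rcons inE eqxx.
apply: contra vU => /eqP/setP/(_ (arc_tgt e)); rewrite [RHS]inE connect0 inE => /andP[cts _].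
by rewrite -te; apply: ancestor_closed cU erefl cts sU.
Qed.

Lemma net_no_initial_cyclic B : ~ initial_cyclic G setT B.
Proof.
case=> _ B0 cB stB cycB; apply: (noinitial (C := B)).
have src e : e \in G -> arc_tgt e \in B -> arc_src e \in B.
  by move=> eG tB; apply: (closed_inP _ _ _ cB); rewrite ?inE.
split.
- exact: strong_component.
- by apply/forall_inP=> e eG; apply/implyP; apply: src.
apply: strong_induces_cycle => //.
  move=> v vB; have [e eG te] := net_in_arc v; exists e; split=> //.
  by apply: src; rewrite ?te.
move=> e e' eG e'G sB sB' tB te.
have e1 : e \in restrict G B by rewrite in_restrict eG sB tB.
have e2 : e' \in restrict G B by rewrite in_restrict e'G sB' -te tB.
apply: (single_in (simple_arcs_restrict net_simple_arcs) e2 e1 _ te).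
by rewrite -te; apply: (cyclic_inP _ _ cycB).
Qed.

Lemma net_merging : merging_within f (hom_len #|V|).
Proof.
move=> x y; have sG := net_simple_arcs.
have : win r G setT (agree setT) (hom_len #|[set: V]| - hom_len #|(set0 : {set V})|)
    (hom_hard #|[set: V]| - hom_hard #|(set0 : {set V})|) x y.
  apply: (homogenous_merge pcf sG) => //.
  - by move=> u _; have [e eG te] := net_in_arc u; exists e; rewrite inE.
  - by move=> U v C _ cU _; apply: net_good.
  - by move=> D _ stD ncD; apply: strong_merge.
  - by apply/closed_inP=> e _; rewrite inE.
  - by move=> e _ _; rewrite inE.
  - by move=> k; rewrite inE.
  by move=> B /net_no_initial_cyclic.
case/win_exists_word=> w sw ag; exists w.
  by apply: leq_trans sw _; rewrite cardsT leq_subr.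
by rewrite !apply_word_upds; apply/ffunP=> k; apply: ag; rewrite inE.
Qed.

(** If all arcs were loops, each single vertex would be an initial cycle. *)
Lemma net_proper_arc (v0 : V) : exists2 e, e \in G & arc_src e != arc_tgt e.
Proof.
apply: NNPP => no.
have loop e : e \in G -> arc_src e = arc_tgt e.
  by move=> eG; apply/eqP; apply: contraT => ne; case: no; exists e.
apply: (@net_no_initial_cyclic [set v0]); split.
- by [].
- by apply/set0Pn; exists v0; rewrite inE.
- by apply/closed_inP=> e eG; rewrite (loop e eG).
- move=> D sD D0 _; apply/eqP; rewrite eqEsubset sD sub1set.
  by have /set0Pn[k kD] := D0; have := subsetP sD _ kD; rewrite inE => /eqP <-.
apply/cyclic_inP=> v _; apply/negP=> /multiP[e1 [e2 [/restrict_sub e1G /restrict_sub e2G t1 t2]]].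
by rewrite (loop e1 e1G) (loop e2 e2G) t1 t2 eqxx.
Qed.

Lemma card_fixed_pair u v (a b : bool) : u != v ->
  2 ^ #|V| <= 4 * #|[set z : config V | (z u == a) && (z v == b)]|.
Proof.
move=> uv; set S := [set z | _].
pose h (z : config V) := (set_at (set_at z u a) v b, (z u, z v)).
have inj : injective h.
  move=> z z' [ezz eu ev]; apply/ffunP=> k.
  have [->//|ku] := eqVneq k u; have [->//|kv] := eqVneq k v.
  by have /ffunP/(_ k) := ezz; rewrite !ffunE (negPf ku) (negPf kv).
have sub : h @: [set: config V] \subset setX S [set: bool * bool].
  apply/subsetP=> _ /imsetP[z _ ->]; rewrite !inE /= andbT.
  by rewrite set_at_neq // !set_at_eq !eqxx.
have := subset_leq_card sub; rewrite card_imset // cardsX !cardsT card_ffun card_bool.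
by rewrite card_prod card_bool mulnC.
Qed.

(** Right after the letter, the source of [e] cannot be bad with its target at [~~ r v]; this
    excludes a quarter of all configurations. *)
Lemma card_word_image_arc e : e \in G -> arc_src e != arc_tgt e ->
  4 * #|word_image f [:: arc_tgt e] setT| <= 3 * 2 ^ #|V|.
Proof.
move=> eG ne; set X := word_image _ _ _; set v := arc_tgt e in ne *; set u := arc_src e in ne *.
set S := [set z : config V | (z u == bad r e) && (z v == ~~ r v)].
have sX : X \subset ~: S.
  apply/subsetP=> _ /imsetP[z _ ->]; rewrite apply_word_upds !inE /= upd_out //.
  apply/negP=> /andP[/eqP be]; rewrite upd_val_hit; first by case: (r v).
  exact: hit_arc.
have := subset_leq_card sX; have := card_fixed_pair (bad r e) (~~ r v) ne.
have := cardsC S; rewrite card_ffun card_bool => h1 h2 h3.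
rewrite -(leq_add2l (4 * #|S|)) (@leq_trans (4 * 2 ^ #|V|)) //.
  by rewrite -h1 mulnDr leq_add2l leq_mul2l h3.
by rewrite [4 * 2 ^ _]mulSn leq_add2r.
Qed.

End Nets.

Theorem theorem4 (V : finType) (G : sdigraph V) :
  homogenous G ->
  positive_cycle_free G ->
  (forall i : V, ~~ source G i) ->
  (forall C : {set V}, ~ initial_cycle G C) ->
  forall f : BN V, and_or_net G f ->
  exists w : seq V,
    Rdefinitions.Rle (Raxioms.INR (size w)) (sync_bound #|V|) /\ synchronizing f w.
Proof.
move=> hom pcf ns ni f ao; have [r fE] := net_forced_values ao.
have [dG _] := ao.
have nonneg : (0 <= sync_bound #|V|)%stdR.
  apply: Rmult_le_pos; first exact: pos_INR.
  by apply: pow_le; have := sqrt_pos (INR 5); lra.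
have [V0|/card_gt0P[v0 _]] := posnP #|V|.
  exists [::]; split=> // x y; apply/ffunP=> k.
  by have := card0_eq V0 k.
have [e eG ne] := net_proper_arc fE dG ns ni v0.
set X := word_image f [:: arc_tgt e] setT.
have cX : 4 * #|X| <= 3 * 2 ^ #|V| := card_word_image_arc fE eG ne.
have X0 : 0 < #|X|.
  by apply/card_gt0P; exists (apply_word f [:: arc_tgt e] [ffun _ => true]); apply: imset_f.
have [|w sw mw] := merging_synchronizing_set (m := #|X|.-1) (X := X)
    (net_merging fE dG hom pcf ns ni).
  by rewrite prednK.
exists (arc_tgt e :: w); split; last first.
  move=> x y; rewrite -[_ :: w]cat1s !apply_word_cat; apply: mw; exact: imset_f.
(* As [hom_len] is positive, the first letter is paid for by the one merging saved in [#|X|.-1]. *)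
have L0 : 0 < hom_len #|V|.
  apply: (@leq_trans (hom_len 1)) => //; apply: hom_len_mono.
  by apply/card_gt0P; exists v0.
have size_le : 4 * (size w).+1 <= 3 * (2 ^ #|V| * hom_len #|V|).
  have h : (size w).+1 <= #|X| * hom_len #|V|.
    by rewrite -(prednK X0) mulSn -add1n leq_add.
  apply: leq_trans (leq_mul (leqnn 4) h) _.
  by rewrite mulnA mulnA leq_mul2r cX orbT.
have := Rle_trans _ _ _ (le_INR _ _ (elimT leP size_le)) (hom_len_real #|V|).
rewrite (mult_INR 4) (INR_IZR_INZ 4) (INR_IZR_INZ 40) /sync_bound (INR_IZR_INZ 10).
rewrite -[size (_ :: w)]/(size w).+1; move: (INR _) (pow _ _) => a b.
by simpl IZR; lra.
Qed.
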